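(* Let $\xi_1,\dots,\xi_n$ be independent real random variables with $\mathbf{E}\xi_i=0$, satisfying Bernstein's condition: there is a constant $\varepsilon>0$ such that $|\mathbf{E}\xi_i^k|\le \frac12 k!\,\varepsilon^{k-2}\mathbf{E}\xi_i^2$ for all $k\ge 3$ and $i=1,\dots,n$. Let $S_n=\sum_{i=1}^n\xi_i$ and $\sigma^2=\sum_{i=1}^n\mathbf{E}\xi_i^2>0$. Then for all $0\le x<\frac1{12}\frac{\sigma}{\varepsilon}$, \[ \mathbf{P}(S_n>x\sigma)=\inf_{\lambda\ge0}\mathbf{E}e^{\lambda(S_n-x\sigma)}\;\Big(M(x)+27.99\,\theta\,R(4x\varepsilon/\sigma)\frac{\varepsilon}{\sigma}\Big) \] for some $\theta=\theta(x)$ with $|\theta|\le1$. Moreover, $\inf_{\lambda\ge0}\mathbf{E}e^{\lambda(S_n-x\sigma)}\le B(x,\varepsilon/\sigma)$. In particular, in the i.i.d. case (the $\xi_i$ identically distributed, with $\varepsilon$ and the common distribution fixed and $n\to\infty$), for $0\le x=o(\sqrt n)$, \[ \Big|\mathbf{P}(S_n>x\sigma)-M(x)\inf_{\lambda\ge0}\mathbf{E}e^{\lambda(S_n-x\sigma)}\Big|=O\Big(\frac1{\sqrt n}B(x,\varepsilon/\sigma)\Big). \]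
   Context: $\Phi$ is the standard normal distribution function, $M(x)=(1-\Phi(x))e^{x^2/2}$. For $x\ge0$ and $r>0$, $B(x,r)=\exp\{-\widehat{x}^2/2\}$ with $\widehat{x}=\frac{2x}{1+\sqrt{1+2xr}}$. The function $R$ is defined by $R(t)=\frac{(1-t+6t^2)^3}{(1-3t)^{3/2}(1-t)^7}$ for $0\le t<\frac13$ and $R(t)=\infty$ for $t\ge\frac13$. *)

(* Defs.v *)
From HB Require Import structures.
From mathcomp Require Import all_boot all_order all_algebra.
From mathcomp Require Import all_classical all_reals all_analysis.
Set Implicit Arguments. Unset Strict Implicit. Unset Printing Implicit Defensive.
Import Order.TTheory GRing.Theory Num.Theory.
Local Open Scope ring_scope.
Local Open Scope classical_set_scope.

Section defs.
Context {R : realType}.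

Definition Phi (x : R) : R := fine (normal_prob 0 1 `]-oo, x]).

Definition Mills (x : R) : R := (1 - Phi x) * expR (x ^+ 2 / 2).

Definition xhat (x r : R) : R := 2 * x / (1 + Num.sqrt (1 + 2 * x * r)).
Definition Bfun (x r : R) : R := expR (- (xhat x r) ^+ 2 / 2).

(** R(t) = (1 - t + 6t^2)^3 / ((1-3t)^{3/2} (1-t)^7) for 0 <= t < 1/3.
    For t >= 1/3 the paper sets R(t) = +oo; here R is only ever used on
    [0, 1/3), and the junk value 0 is returned otherwise. *)
Definition Rfun (t : R) : R :=
  if t < 1/3 then
    (1 - t + 6 * t ^+ 2) ^+ 3 /
      (((1 - 3 * t) `^ (3/2)) * (1 - t) ^+ 7)
  else 0.
End defs.

Definition mutually_independent {d} {T : measurableType d} {R : realType}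
  (P : probability T R) {I : eqType} (X : I -> T -> R) : Prop :=
  forall (s : seq I) (B : I -> set R), uniq s ->
    (forall i, measurable (B i)) ->
    P (\big[setI/setT]_(i <- s) (X i @^-1` B i)) =
    (\prod_(i <- s) P (X i @^-1` B i))%E.

Definition identically_distributed {d} {T : measurableType d} {R : realType}
  (P : probability T R) {I : Type} (X : I -> T -> R) : Prop :=
  forall i j (B : set R), measurable B -> P (X i @^-1` B) = P (X j @^-1` B).

Definition bernstein_condition {d} {T : measurableType d} {R : realType}
  (P : probability T R) (X : T -> R) (eps : R) : Prop :=
  forall k : nat, (3 <= k)%N ->
    (`| 'E_P[fun w => (X w ^+ k)%R] | <=
      ((1/2) * k`!%:R * eps ^+ (k - 2))%:E * 'E_P[fun w => (X w ^+ 2)%R])%E.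

Definition inf_mgf {d} {T : measurableType d} {R : realType}
  (P : probability T R) (Y : T -> R) (a : R) : \bar R :=
  ereal_inf [set ('E_P[fun w => expR (l * (Y w - a))])%E | l in [set l : R | 0 <= l]].

(* Main.v *)
Require Import Defs.
From HB Require Import structures.
From mathcomp Require Import all_boot all_order all_algebra.
From mathcomp Require Import all_classical all_reals all_analysis.
From mathcomp Require Import measurable_realfun ring lra.
Set Implicit Arguments.
Unset Strict Implicit.
Unset Printing Implicit Defensive.
Import Order.TTheory GRing.Theory Num.Theory.
Import numFieldNormedType.Exports.
Local Open Scope ereal_scope.
Local Open Scope ring_scope.
Local Open Scope classical_set_scope.

(* Let Q be the law with density proportional to exp(lambda S_n), where lambda is
   the saddlepoint: the Q-mean of S_n is x sigma.  Then
     P(S_n > x sigma) = Z E_Q[h(W)],   h(w) = exp(-a w) 1_{w > 0},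
   where Z = inf_l E exp(l (S_n - x sigma)), W is S_n - x sigma normalised under Q
   and a is lambda times the Q-standard deviation of S_n.  Under Q the summands
   remain independent, and the expectation of h under the normal law is M(a), so
   Stein's method (h is a difference of two nonincreasing functions having concave
   primitives, to which a concentration inequality applies) bounds
   E_Q[h(W)] - M(a) by the sum of the third absolute moments.  Bernstein's
   condition controls the tilted mean, variance and third moment of each summand,
   and M(a) - M(x) is bounded through 1/a - 1/x.  Rescaling by eps, everything
   depends on tau = lambda eps in [0, 23/200], and 27.99 R(4 x eps / sigma) comes
   out of polynomial inequalities in tau. *)

(** * The Mills ratio *)

(** Two obstacles shape the argument. First, h jumps at 0, hence so does the derivative of the Stein
    solution, and comparing that derivative at nearby points costs a concentration bound instead of
    a Lipschitz constant. Treating the two monotone pieces of h separately would pay this cost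
    twice; the weights c1, c2 of [supergradient_taylor] are the same for both pieces and add up to
    |y|, so it is paid once. Second, the concentration inequality for a sum with one summand left
    out loses a factor 1 / (1 - 2 kappa), where kappa bounds the variance of one normalised summand.
    Whenever the claimed error is at most 1, eps / sigma is small enough for kappa = 1/65. The
    constant: put r = eps / sigma, p = x r and D = (1 - 12 p) (1 - 4 p)^4. The Stein factor 2
    sqrt(pi / 2) + 4 / (1 - 2/65) is at most 6.96, the normalised third moments sum to at most 3.58
    r / D, and passing from M(a) to M(x) costs at most 3 r / D. Now 6.96 * 3.58 + 3 < 27.99, and 1 /
    D <= R(4 p). *)

Section mean_value.
Context {R : realType}.
Implicit Types (f df : R -> R) (a b w : R).

Lemma is_derive_mvt f df a b : a <= b ->
  (forall x, a <= x <= b -> is_derive x 1 f (df x)) ->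
  exists2 c, a <= c <= b & f b - f a = df c * (b - a).
Proof.
move=> ab fE; have [||c cab ->] := @MVT_segment _ f df _ _ ab.
- by move=> x xab; apply: fE; rewrite !ltW ?(itvP xab).
- apply: derivable_within_continuous => x xab.
  by have := fE x; rewrite !(itvP xab) => /(_ isT) [].
- by exists c => //; rewrite !(itvP cab).
Qed.

Lemma is_derive_le0 f df a b : a <= b ->
  (forall x, a <= x <= b -> is_derive x 1 f (df x)) ->
  (forall x, a <= x <= b -> df x <= 0) -> f b <= f a.
Proof.
move=> ab fE df0; have [c cab fba] := is_derive_mvt ab fE.
by rewrite -subr_le0 fba mulr_le0_ge0 ?df0 ?subr_ge0.
Qed.

Lemma is_derive_ge0 f df a b : a <= b ->
  (forall x, a <= x <= b -> is_derive x 1 f (df x)) ->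
  (forall x, a <= x <= b -> 0 <= df x) -> f a <= f b.
Proof.
move=> ab fE df0; have [c cab fba] := is_derive_mvt ab fE.
by rewrite -subr_ge0 fba mulr_ge0 ?df0 ?subr_ge0.
Qed.

Lemma is_derive_inv a : a != 0 -> is_derive a 1 (fun x : R => x^-1) (- a ^- 2).
Proof.
move=> a0; have -> : - a ^- 2 = - a ^- 2 *: (1 : R) by rewrite /GRing.scale/= mulr1.
exact: (@is_deriveV _ id).
Qed.

(** Normal tails are compared with elementary functions through this lemma: only the sign of a
    derivative and a limit at infinity are needed, no estimate of an integral. *)
Lemma cvg0_is_derive_le0 f df w :
  (forall x, w <= x -> is_derive x 1 f (df x)) ->
  (forall x, w <= x -> df x <= 0) ->
  f x @[x --> +oo] --> (0 : R) -> 0 <= f w.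
Proof.
move=> fE df0 f0; rewrite -(cvg_lim _ f0)//; apply: limr_le; first by apply/cvg_ex; exists 0.
near=> x; have wx : w <= x by near: x; apply: nbhs_pinfty_ge; exact: num_real.
by apply: (is_derive_le0 wx) => y /andP[wy _]; [exact: fE|exact: df0].
Unshelve. all: by end_near. Qed.

End mean_value.

Section mills_ratio.
Context {R : realType}.
Implicit Types w u v y a : R.

Let c : R := normal_peak 1.

Lemma std_normal_pdfE w : normal_pdf 0 1 w = c * expR (- (w ^+ 2 / 2)).
Proof.
by rewrite normal_pdfE ?oner_neq0// /normal_fun subr0 expr1n mulNr.
Qed.

Lemma std_normal_pdf_gt0 w : 0 < normal_pdf 0 1 w.
Proof. by rewrite std_normal_pdfE mulr_gt0 ?expR_gt0// normal_peak_gt0 ?oner_neq0. Qed.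

Lemma is_derive_Phi w : is_derive w 1 (@Phi R) (normal_pdf 0 1 w).
Proof.
have ww1 : w < w + 1 by rewrite ltrDl.
have iw : lebesgue_measure.-integrable `]-oo, (w + 1)] (EFin \o normal_pdf (0:R) 1).
  by apply: integrableS (integrable_normal_pdf 0 1).
have cw := continuous_normal_pdf (m := 0) (oner_neq0 R) (x := w).
have [|d1 d2] := continuous_FTC1 ww1 iw _ cw; first by rewrite ltNyr.
by apply: (DeriveDef d1); rewrite -derive1E; exact: d2.
Qed.

Let idR : measurableTypeR R -> R := idfun.

#[local] HB.instance Definition _ :=
  @isMeasurableFun.Build _ _ _ _ idR (@measurable_id _ _ setT).

Lemma cvg_Phi_y : Phi w @[w --> +oo] --> (1 : R).
Proof.
have h := @cvg_cdfy1 _ _ _ (normal_prob 0 1 : probability _ R) (idR : {RV _ >-> R}).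
have -> : Phi = fine \o cdf (idR : {RV (normal_prob 0 1 : probability _ R) >-> R}).
  by apply/funext => w.
exact: fine_cvg h.
Qed.

Lemma Phi0 : Phi 0 = 1 / 2 :> R.
Proof.
have p0 (x : R) : 0 <= normal_pdf 0 1 x by exact: normal_pdf_ge0.
have cp : continuous (normal_pdf (0:R) 1) := continuous_normal_pdf (oner_neq0 R).
have ev : (normal_pdf (0:R) 1) =1 normal_pdf 0 1 \o -%R.
  by move=> x; rewrite /= !std_normal_pdfE sqrrN.
have := ge0_symfun_integralT p0 cp ev.
rewrite integral_normal_pdf.
have mp (A : set R) : measurable_fun A (EFin \o normal_pdf (0:R) 1).
  by apply/measurable_EFinP; exact: (measurable_funTS (measurable_normal_pdf _ _)).
rewrite -set_itvcy.
set H := (\int[_]_(x in _) _)%E => h1.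
have : (normal_prob (0:R) 1 (~` `]-oo, (0:R)%R]) = 1 - normal_prob (0:R) 1 `]-oo, (0:R)%R])%E.
  exact: probability_setC.
rewrite setCitvl {1}/normal_prob integral_itv_obnd_cbnd//.
rewrite -/H /Phi => h2.
have : normal_prob 0 1 `]-oo, (0:R)] \is a fin_num by exact: fin_num_measure.
move=> hf; rewrite -[LHS]/(fine _); move: hf h2.
move: H h1 => H h1; case: (normal_prob _ _ _) => // p _ h2.
case: H h1 h2 => [q||] //= [] h1 [] h2; lra.
Qed.

Lemma Phi_le1 w : Phi w <= 1.
Proof.
rewrite -lee_fin /Phi fineK; last exact: fin_num_measure.
exact: probability_le1.
Qed.

(** [Mills] is this ratio times 1 / sqrt(2 pi). Without that factor the ratio N satisfies N' = w N -
    1, on which all later computations rest. *)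
Definition mills_scaled w := (1 - Phi w) / normal_pdf 0 1 w.

Lemma MillsE w : Mills w = c * mills_scaled w.
Proof.
rewrite /Mills /mills_scaled std_normal_pdfE invfM -expRN opprK.
have c0 : c != 0 by rewrite gt_eqF// normal_peak_gt0 ?oner_neq0.
by field.
Qed.

Local Notation N := mills_scaled.

Lemma is_derive_pdf w : is_derive w 1 (normal_pdf 0 1 : R -> R) (- w * normal_pdf 0 1 w).
Proof.
rewrite std_normal_pdfE.
have -> : normal_pdf 0 1 = (fun w : R => c * expR (- (w ^+ 2 / 2))).
  by apply/funext => x; rewrite std_normal_pdfE.
apply: is_derive_eq; rewrite /GRing.scale/=.
by field.
Qed.

Lemma is_derive_mills w : is_derive w 1 N (w * N w - 1).
Proof.
have pw : normal_pdf 0 1 w != 0 by rewrite gt_eqF// std_normal_pdf_gt0.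
have dP := is_derive_Phi w; have dp := is_derive_pdf w.
rewrite /N.
apply: is_derive_eq. 
rewrite /GRing.scale/=.
by field.
Qed.

Lemma mills_scaled_ge0 w : 0 <= N w.
Proof. by rewrite divr_ge0 ?subr_ge0 ?Phi_le1 ?normal_pdf_ge0. Qed.

Let c_gt0 : 0 < c. Proof. by rewrite normal_peak_gt0 ?oner_neq0. Qed.

Let pdf_le w : normal_pdf 0 1 w <= c.
Proof. exact: normal_pdf_ub (oner_neq0 _). Qed.

Let cvg_c_inv : c / w @[w --> +oo] --> (0 : R).
Proof.
apply/cvgrPdist_le => /= e e0; near=> x.
have x0 : 0 < x by near: x; apply: nbhs_pinfty_gt; exact: num_real.
have cx : 0 <= c / x by rewrite divr_ge0// ltW.
rewrite sub0r normrN ger0_norm// ler_pdivrMr//.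
by rewrite mulrC -ler_pdivrMr.
Unshelve. all: by end_near. Qed.

Let cvg_tail : 1 - Phi w @[w --> +oo] --> (0 : R).
Proof. by rewrite -(subrr (1 : R)); apply: cvgB; [exact: cvg_cst|exact: cvg_Phi_y]. Qed.

(** The difference phi / w - (1 - Phi) tends to 0 and has derivative - phi / w^2. *)
Lemma mul_mills_scaled_le1 w : 0 <= w -> w * N w <= 1.
Proof.
rewrite le_eqVlt => /predU1P[<-|w0]; first by rewrite mul0r.
have : 0 <= normal_pdf 0 1 w / w - (1 - Phi w).
  apply: (@cvg0_is_derive_le0 _ (fun w => normal_pdf 0 1 w / w - (1 - Phi w))
     (fun w => - normal_pdf 0 1 w / w ^+ 2)).
  - move=> x wx; have x0 : x != 0 by rewrite gt_eqF// (lt_le_trans w0).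
    have dP := is_derive_Phi x; have dp := is_derive_pdf x.
    have dV := is_derive_inv x0.
    apply: is_derive_eq; rewrite /GRing.scale/=.
    by field.
  - by move=> x wx; rewrite mulNr oppr_le0 divr_ge0 ?normal_pdf_ge0 ?sqr_ge0.
  - rewrite -[X in _ --> X](subrr (0 : R)); apply: cvgB; last exact: cvg_tail.
    apply: (squeeze_cvgr _ (cvg_cst 0) cvg_c_inv).
    near=> x; have x0 : 0 < x by near: x; apply: nbhs_pinfty_gt; exact: num_real.
    rewrite ler_pM2r ?invr_gt0// pdf_le andbT.
    by rewrite divr_ge0 ?normal_pdf_ge0// ltW.
rewrite subr_ge0 /N mulrA ler_pdivrMr ?std_normal_pdf_gt0// mul1r.
by rewrite ler_pdivlMr// mulrC.
Unshelve. all: by end_near. Qed.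

(** Same scheme; here the difference of the two sides, times phi, has derivative - 2 phi / (1 +
    w^2)^2. *)
Lemma mills_scaled_ge w : 0 <= w -> w / (1 + w ^+ 2) <= N w.
Proof.
move=> w0; have q0 (x : R) : 0 < 1 + x ^+ 2 by rewrite ltr_pwDl ?ltr01 ?sqr_ge0.
have : 0 <= 1 - Phi w - normal_pdf 0 1 w * (w / (1 + w ^+ 2)).
  apply: (@cvg0_is_derive_le0 _ (fun w => 1 - Phi w - normal_pdf 0 1 w * (w / (1 + w ^+ 2)))
     (fun w => - (2 * normal_pdf 0 1 w / (1 + w ^+ 2) ^+ 2))).
  - move=> x wx; have x0 : 1 + x ^+ 2 != 0 by rewrite gt_eqF.
    have dP := is_derive_Phi x; have dp := is_derive_pdf x.
    apply: is_derive_eq; rewrite /GRing.scale/=.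
    by field.
  - by move=> x wx; rewrite oppr_le0 mulr_ge0 ?invr_ge0 ?sqr_ge0// mulr_ge0 ?normal_pdf_ge0.
  - rewrite -[X in _ --> X](subrr (0 : R)); apply: cvgB; first exact: cvg_tail.
    apply: (squeeze_cvgr _ (cvg_cst 0) cvg_c_inv).
    near=> x; have x0 : 0 < x by near: x; apply: nbhs_pinfty_gt; exact: num_real.
    have xq : 0 <= x / (1 + x ^+ 2) by rewrite divr_ge0// ltW.
    rewrite mulr_ge0 ?normal_pdf_ge0//= ler_pM ?normal_pdf_ge0//.
    by rewrite ler_pdivrMr// mulrC ler_pdivlMr//; nra.
by rewrite subr_ge0 /N ler_pdivlMr ?std_normal_pdf_gt0// mulrC.
Unshelve. all: by end_near. Qed.

Lemma mills_scaled_nincr u v : 0 <= u -> u <= v -> N v <= N u.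
Proof.
move=> u0 uv; apply: (is_derive_le0 uv) => x /andP[ux _]; first exact: is_derive_mills.
by rewrite subr_le0 mul_mills_scaled_le1 ?(le_trans u0).
Qed.

(** By N' = w N - 1 and the lower bound on N, the function N - 1/w is nondecreasing. This serves to
    compare M(a) with M(x) for large arguments: 1/a - 1/x stays of order eps / sigma there, while a
    - x does not. *)
Lemma mills_scaled_subV u v : 0 < u -> u <= v -> N u - N v <= u^-1 - v^-1.
Proof.
move=> u0 uv.
suff : N u - u^-1 <= N v - v^-1 by lra.
apply: (@is_derive_ge0 _ (fun w => N w - w^-1) (fun w => w * N w - 1 + w ^- 2) _ _ uv) => x /andP[ux _].
  have x0 : x != 0 by rewrite gt_eqF// (lt_le_trans u0).
  have dN := is_derive_mills x; have dV := is_derive_inv x0.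
  apply: is_derive_eq; rewrite /GRing.scale/=.
  by field.
have x0 := lt_le_trans u0 ux.
have := mills_scaled_ge (ltW x0).
rewrite ler_pdivrMr ?ltr_pwDl ?ltr01 ?sqr_ge0// => h.
rewrite -(pmulr_lge0 _ (exprn_gt0 2 x0)) mulrDl mulVf ?expf_neq0 ?gt_eqF//.
have := ler_wpM2l (ltW x0) h; have := mul_mills_scaled_le1 (ltW x0); lra.
Qed.

Lemma mills_scaled0 : N 0 = (2 * c)^-1.
Proof.
rewrite /N Phi0 std_normal_pdfE expr0n mul0r oppr0 expR0 mulr1 invfM.
by congr (_ * _); lra.
Qed.

Lemma mills_scaled0_sqr : N 0 ^+ 2 = pi / 2.
Proof.
rewrite mills_scaled0 /c /normal_peak expr1n mul1r exprVn exprMn exprVn sqr_sqrtr.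
  by rewrite mulr2n invfM invrK; field.
by rewrite mulrn_wge0// pi_ge0.
Qed.

Lemma mills_scaled0_ge1 : 1 <= N 0.
Proof.
rewrite -(@ler_pXn2r _ 2)// ?nnegrE ?mills_scaled_ge0// mills_scaled0_sqr expr1n.
by have := @pi_ge2 R; lra.
Qed.

Lemma mills_scaled0_sqr_le2 : N 0 ^+ 2 <= 2.
Proof. by rewrite mills_scaled0_sqr; have := @pihalf_lt2 R; lra. Qed.

(** In this form later estimates see pi only through 1 <= N 0 and N 0 ^+ 2 <= 2. *)
Lemma Mills_scaledE w : Mills w = N w / (2 * N 0).
Proof.
rewrite MillsE mills_scaled0; have := c_gt0 => /lt0r_neq0 c0.
by field; rewrite c0.
Qed.

End mills_ratio.

(** * The Stein equation *)

Section supergradient.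
Context {R : realType}.
Implicit Types (K k : R -> R).

(** Concavity of [K] with a chosen supergradient [k]. It expresses that [k] is nonincreasing with
    primitive [K], and covers a discontinuous [k] without derivatives or integrals. *)
Definition supergradient K k := forall u v : R, K v - K u <= k u * (v - u).

Lemma supergradient_nincr K k u v : supergradient K k -> u <= v -> k v <= k u.
Proof.
move=> Kk; rewrite le_eqVlt => /predU1P[->//|uv].
have := Kk u v; have := Kk v u; move=> h1 h2.
have : k v * (v - u) <= k u * (v - u) by lra.
by rewrite ler_pM2r ?subr_gt0.
Qed.

(* The two excess weights are shared by all pairs [K, k]: this is what lets the
   errors of two such pairs be subtracted without doubling their sum. *)
Lemma supergradient_taylor (y s : R) : exists c1 c2 : R,
  [/\ 0 <= c1, 0 <= c2, c1 + c2 = `|y| &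
    forall K k, supergradient K k -> forall w lo hi : R,
    lo <= 0 <= hi -> lo <= y <= hi -> lo <= s <= hi ->
    - (c2 * (k (w + lo) - k (w + hi))) <= y * k (w + s) - (K (w + y) - K w) <=
      c1 * (k (w + lo) - k (w + hi))].
Proof.
have pos (z t : R) : 0 <= z -> exists c1 c2 : R,
  [/\ 0 <= c1, 0 <= c2, c1 + c2 = z &
    forall K k, supergradient K k -> forall w lo hi : R,
    lo <= 0 <= hi -> lo <= z <= hi -> lo <= t <= hi ->
    - (c2 * (k (w + lo) - k (w + hi))) <= z * k (w + t) - (K (w + z) - K w) <=
      c1 * (k (w + lo) - k (w + hi))].
  (* [c2] is the length of the part of [0, z] to the left of [t], where k (w + .) is at least k (w +
     t); on the remaining length z - c2 it is at most that. These lengths do not depend on [k]. *)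
  move=> z0; pose c2 := Num.max 0 (Num.min t z); exists (z - c2), c2.
  have c20 : 0 <= c2 by rewrite le_max lexx.
  have c2z : c2 <= z by rewrite ge_max z0/= ge_min lexx orbT.
  split; rewrite ?subr_ge0 ?subrK// => K k Kk w lo hi.
  move=> /andP[lo0 hi0] /andP[loz hiz] /andP[lot hit].
  have h1 := Kk (w + z) (w + c2); have h2 := Kk (w + c2) w.
  have h3 := Kk w (w + c2); have h4 := Kk (w + c2) (w + z).
  have mono a b : a <= b -> k (w + b) <= k (w + a).
    by move=> ab; apply: (supergradient_nincr Kk); rewrite lerD2l.
  have kw : k (w + 0) = k w by rewrite addr0.
  have klo0 := mono _ _ lo0; have khi0 := mono _ _ hi0; rewrite kw in klo0 khi0.
  have kloz := mono _ _ loz; have khiz := mono _ _ hiz.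
  have klot := mono _ _ lot; have khit := mono _ _ hit.
  have mz a b : a <= b -> z * a <= z * b by exact: ler_wpM2l.
  have [t0|t0] := leP t 0.
    have c2E : c2 = 0 by rewrite /c2 max_l// ge_min t0.
    move: h1 h2 h3 h4; rewrite c2E !addr0 subr0 => h1 h2 h3 h4.
    have k1 := mz _ _ (mono _ _ t0); rewrite kw in k1.
    have := mz _ _ klot; have := mz _ _ khiz; lra.
  have [zt|tz] := leP z t.
    have c2E : c2 = z by rewrite /c2 min_r// max_r.
    move: h1 h2 h3 h4; rewrite c2E => h1 h2 h3 h4.
    have k1 := mz _ _ (mono _ _ zt).
    have := mz _ _ klo0; have := mz _ _ khit; lra.
  have c2E : c2 = t by rewrite /c2 min_l ?ltW// max_r// ltW.
  move: h1 h2 h3 h4; rewrite c2E => h1 h2 h3 h4.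
  have mzt a b : a <= b -> (z - t) * a <= (z - t) * b.
    by apply: ler_wpM2l; rewrite subr_ge0 ltW.
  have mt a b : a <= b -> t * a <= t * b by apply: ler_wpM2l; rewrite ltW.
  have k1 := mono _ _ (ltW tz); have k2 := mono _ _ (ltW t0); rewrite kw in k2.
  have := mt _ _ klo0; have := mzt _ _ khiz; have := mt _ _ khit; have := mzt _ _ klot.
  have := mzt _ _ k1; have := mt _ _ k2.
  lra.
have [y0|y0] := leP 0 y; first by rewrite ger0_norm//; exact: pos.
(* For y < 0 the increment is read from the base point w + y. This reverses the sign of the error
   and so swaps the two weights. *)
have [|c1 [c2 [c10 c20 c12 H]]] := pos (- y) (s - y); first by rewrite oppr_ge0 ltW.
exists c2, c1; split => //; first by rewrite addrC c12 ltr0_norm.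
move=> K k Kk w lo hi lohi0 lohiy lohis.
have := H K k Kk (w + y) (lo - y) (hi - y).
rewrite !lerBlDr !lerBrDr !add0r addNr !subrK => /(_ lohiy lohi0 lohis).
have e a : w + y + (a - y) = w + a by lra.
rewrite !e addrK; lra.
Qed.

End supergradient.

Section stein_solution.
Context {R : realType}.
Variable a : R.
Hypothesis a0 : 0 <= a.
Local Notation N := (@mills_scaled R).
Local Notation m := (Mills a).
Implicit Types u v w y s : R.

Definition tilted_tail w : R := if 0 < w then expR (- a * w) else 0.
Definition step_down w : R := if w <= 0 then 1 else 0.
Definition step_down_prim w : R := Num.min w 0.
Definition exp_down w : R := expR (- a * Num.max w 0).
(** The case a = 0 is separate because a quotient by 0 is 0, whereas the limit of (1 - exp(- a w)) /
    a is w. *)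
Definition exp_down_prim w : R :=
  if w <= 0 then w else if a == 0 then w else (1 - expR (- a * w)) / a.

Lemma tilted_tailE w : tilted_tail w = exp_down w - step_down w.
Proof.
rewrite /tilted_tail /exp_down /step_down; case: ltP => w0.
  by rewrite subr0.
by rewrite mulr0 expR0 subrr.
Qed.

Lemma step_down01 w : 0 <= step_down w <= 1.
Proof. by rewrite /step_down; case: ifP; rewrite ?ler01 ?lexx. Qed.

Lemma exp_down01 w : 0 <= exp_down w <= 1.
Proof.
rewrite /exp_down expR_ge0/= -expR0 ler_expR mulNr oppr_le0 mulr_ge0//.
by rewrite le_max lexx orbT.
Qed.

Lemma step_down_supergradient : supergradient step_down_prim step_down.
Proof.
move=> u v; rewrite /step_down_prim /step_down.
have [u0|u0] := leP u 0.
  by rewrite mul1r lerD2r ge_min lexx.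
by rewrite subr0 mul0r ge_min lexx orbT.
Qed.

Let exp1 w : 1 - expR (- a * w) <= a * w.
Proof. by have := expR_ge1Dx (- a * w); lra. Qed.

Lemma exp_down_supergradient : supergradient exp_down_prim exp_down.
Proof.
have Kle v : exp_down_prim v <= v.
  rewrite /exp_down_prim; case: ifPn => // /negP; case: ifPn => // an0.
  move=> _; rewrite ler_pdivrMr; first by rewrite (mulrC v).
  by rewrite lt0r an0.
move=> u v; rewrite {2}/exp_down_prim /exp_down.
have [u0|u0] := leP u 0; first by rewrite mulr0 expR0 mul1r lerD2r.
have [aE|an0] := eqVneq a 0.
  have -> : expR (- a * u) = 1 by rewrite aE oppr0 mul0r expR0.
  by rewrite mul1r lerD2r.
have ap : 0 < a by rewrite lt0r an0.
rewrite /exp_down_prim (negbTE an0); set q := expR (- a * u).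
have q0 : 0 < q by exact: expR_gt0.
have q1 : q <= 1 by rewrite /q -expR0 ler_expR mulNr oppr_le0 mulr_ge0// ltW.
have [v0|v0] := leP v 0.
  have h : a * u * q <= 1 - q.
    have := expR_ge1Dx (a * u); have : expR (a * u) * q = 1.
      by rewrite /q mulNr -expRD subrr expR0.
    by have := ltW q0 ; nra.
  have : u * q <= (1 - q) / a by rewrite ler_pdivlMr// mulrAC (mulrC u).
  by nra.
rewrite -mulrBl ler_pdivrMr//.
have -> : 1 - expR (- a * v) - (1 - q) = q * (1 - expR (- a * (v - u))).
  have -> : - a * v = - a * u + - a * (v - u) by ring.
  by rewrite expRD -/q; ring.
rewrite -mulrA; apply: ler_wpM2l; first exact: ltW.
by rewrite (mulrC (v - u)); exact: exp1.
Qed.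

(** The bounded solution of f' - w f = h - M(a) with h = [tilted_tail], in closed form. Each branch
    solves the equation because N' = w N - 1, and the branches agree at 0 because M(a) = N(a) / (2
    N(0)). *)
Definition stein_fun w : R :=
  if w <= 0 then - m * N (- w) else m * N w - expR (- a * w) * N (w + a).

(** The derivative as dictated by the Stein equation. At 0, where f has a corner, it is the left
    derivative, since [tilted_tail] vanishes there. *)
Definition stein_fun' w : R := w * stein_fun w + tilted_tail w - m.

(** Its derivative is w f(w), a Lipschitz function: the jump of f' sits entirely in the concave
    primitives that are split off. *)
Definition stein_smooth w : R :=
  stein_fun w - exp_down_prim w + step_down_prim w + m * w.

Let Mills_ge0 : 0 <= m.
Proof.
by rewrite Mills_scaledE mulr_ge0 ?mills_scaled_ge0// invr_ge0 mulr_ge0// mills_scaled_ge0.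
Qed.

Let N0_gt0 : 0 < N 0.
Proof. by rewrite (lt_le_trans ltr01) ?mills_scaled0_ge1. Qed.

Let Mills_le : m <= 1 / 2.
Proof.
rewrite Mills_scaledE ler_pdivrMr; last exact: mulr_gt0.
by have := mills_scaled_nincr (lexx 0) a0; lra.
Qed.

Let N_le w : 0 <= w -> N w <= N 0.
Proof. by move=> w0; apply: mills_scaled_nincr. Qed.

Let fL w : R := - m * N (- w).
Let fR w : R := m * N w - expR (- a * w) * N (w + a).

Let fL0 : fL 0 = fR 0.
Proof.
rewrite /fL /fR mulr0 expR0 oppr0 mul1r add0r Mills_scaledE.
by field; rewrite gt_eqF.
Qed.

Let dNopp w : is_derive w 1 (fun x => N (- x)) (1 + w * N (- w)).
Proof.
have h := is_derive_mills (- w).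
have := @is_derive1_comp _ _ -%R w _ _ h (is_deriveN (is_derive_id w 1)).
move=> h'; apply: (is_derive_eq h'); rewrite /GRing.scale/=; ring.
Qed.

Let dNadd w : is_derive w 1 (fun x => N (x + a)) ((w + a) * N (w + a) - 1).
Proof.
have h := is_derive_mills (w + a).
have := @is_derive1_comp _ _ (fun x => x + a) w _ _ h (is_deriveD (is_derive_id w 1) (is_derive_cst a w 1)).
move=> h'; apply: (is_derive_eq h'); rewrite /GRing.scale/=; ring.
Qed.

Let dexp w : is_derive w 1 (fun x => expR (- a * x)) (- a * expR (- a * w)).
Proof. apply: is_derive_eq; rewrite /GRing.scale/=; ring. Qed.

Let gL w : R := w * fL w.
Let gR w : R := w * fR w.
Let DL w : R := fL w + m * w.
Let DR w : R := fR w - (if a == 0 then w else (1 - expR (- a * w)) / a) + m * w.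

Let dfL w : is_derive w 1 fL (w * fL w - m).
Proof.
have h := dNopp w; apply: is_derive_eq; rewrite /GRing.scale/= /fL; ring.
Qed.

Let dfR w : is_derive w 1 fR (w * fR w + expR (- a * w) - m).
Proof.
have h := dNadd w; have h1 := is_derive_mills w; have h2 := dexp w.
apply: is_derive_eq; rewrite /GRing.scale/= /fR; ring.
Qed.

Let dDL w : is_derive w 1 DL (gL w).
Proof.
have h := dfL w; apply: is_derive_eq; rewrite /GRing.scale/= /gL; ring.
Qed.

Let dDR w : is_derive w 1 DR (gR w).
Proof.
have h := dfR w; have h2 := dexp w; rewrite /DR.
have [aE|an0] := eqVneq a 0.
  apply: is_derive_eq; rewrite /GRing.scale/= /gR aE oppr0 mul0r expR0; ring.
apply: is_derive_eq; rewrite /GRing.scale/= /gR; field.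
exact: an0.
Qed.

Let dgL w : is_derive w 1 gL (- m * ((1 + w ^+ 2) * N (- w) + w)).
Proof.
have h := dfL w; apply: is_derive_eq; rewrite /GRing.scale/= /fL; ring.
Qed.

Let dgR w : is_derive w 1 gR (m * ((1 + w ^+ 2) * N w - w) -
   expR (- a * w) * ((1 + w ^+ 2) * N (w + a) - w)).
Proof.
have h := dfR w; apply: is_derive_eq; rewrite /GRing.scale/= /fR; ring.
Qed.

(** The bounded quantity is the second derivative of N at v. With v = - w it governs the derivative
    of w f(w) on the left, with v = w the first term of that derivative on the right. *)
Let N2_bounds v : 0 <= v -> 0 <= (1 + v ^+ 2) * N v - v <= N 0.
Proof.
move=> v0; apply/andP; split.
  by rewrite subr_ge0 mulrC -ler_pdivrMr ?mills_scaled_ge// ltr_pwDl ?ltr01 ?sqr_ge0.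
have := mul_mills_scaled_le1 v0; have := N_le v0; have : v * (v * N v) <= v * 1.
  by rewrite ler_wpM2l// mul_mills_scaled_le1.
lra.
Qed.

Let N0_ge1 : 1 <= N 0. Proof. exact: mills_scaled0_ge1. Qed.

Let dgL_le w : w <= 0 -> `|- m * ((1 + w ^+ 2) * N (- w) + w)| <= N 0.
Proof.
move=> w0; have := @N2_bounds (- w); rewrite oppr_ge0 sqrrN opprK => /(_ w0).
set z := _ + w; move=> /andP[z0 z1]; rewrite mulNr normrN ger0_norm; last exact: mulr_ge0.
by have := Mills_le; have := Mills_ge0; nra.
Qed.

Let dgR_le w : 0 <= w -> `|m * ((1 + w ^+ 2) * N w - w) -
   expR (- a * w) * ((1 + w ^+ 2) * N (w + a) - w)| <= N 0.
Proof.
move=> w0; have /andP[z0 z1] := N2_bounds w0; move: z0 z1.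
set z := _ * _ - w => z0 z1.
have wa0 : 0 <= w + a by rewrite addr_ge0.
set q := expR _; set t := _ * _ - w.
have q0 : 0 < q by exact: expR_gt0.
have q1 : q <= 1 by rewrite /q -expR0 ler_expR mulNr oppr_le0 mulr_ge0.
have aw0 : 0 <= a * w by rewrite mulr_ge0.
(* This is z exp(- z) <= 1/2, obtained from exp z = e exp(z - 1) >= 2 z. It compensates the possibly
   negative lower bound - a w of [t]. *)
have qaw : q * (a * w) <= 1 / 2.
  have : q * expR (a * w) = 1 by rewrite /q mulNr -expRD addrC subrr expR0.
  have h : 2 * (a * w) <= expR (a * w).
    have := expR_ge1Dx (a * w - 1); have := expR_ge1Dx (1 : R).
    have -> : expR (a * w) = expR (a * w - 1) * expR 1 by rewrite -expRD subrK.
    by nra.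
  have := ler_wpM2l (ltW q0) h; lra.
have t1 : t <= N 0.
  have h1 := mul_mills_scaled_le1 wa0; have h2 := N_le wa0.
  have h3 := mills_scaled_ge0 (w + a).
  have h4 : w * N (w + a) <= 1 by nra.
  have h5 : w * (w * N (w + a)) <= w * 1 by rewrite ler_wpM2l.
  rewrite /t; lra.
have t2 : - (a * w) <= t.
  have h1 := mills_scaled_ge wa0.
  have p0 : 0 < 1 + (w + a) ^+ 2 by rewrite ltr_pwDl ?ltr01 ?sqr_ge0.
  rewrite ler_pdivrMr// in h1.
  rewrite -(ler_pM2r p0) /t.
  have : (1 + w ^+ 2) * (w + a) <= (1 + w ^+ 2) * (N (w + a) * (1 + (w + a) ^+ 2)).
    by rewrite ler_wpM2l// addr_ge0 ?sqr_ge0.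
  have : 0 <= a * (1 + w * ((w + a) ^+ 2 - (w + a) + 1)).
    by rewrite mulr_ge0// addr_ge0// mulr_ge0//; nra.
  lra.
have m0 := Mills_ge0; have m1 := Mills_le.
have mz : 0 <= m * z <= N 0 / 2 by apply/andP; split; [rewrite mulr_ge0|nra].
have qt1 : q * t <= N 0 by nra.
have qt2 : - (1 / 2) <= q * t by nra.
move: (m * z) (q * t) mz qt1 qt2 => mz qt /andP[mz0 mz1] qt1 qt2.
have N1 := N0_ge1.
by rewrite ler_norml; apply/andP; split; lra.
Qed.

Let gE w : w * stein_fun w = if w <= 0 then gL w else gR w.
Proof. by rewrite /stein_fun; case: ifP. Qed.

Let DE w : stein_smooth w = if w <= 0 then DL w else DR w.
Proof.
rewrite /stein_smooth /stein_fun /exp_down_prim /step_down_prim.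
case: leP => w0; first by rewrite /DL /fL; ring.
by rewrite /DR /fR addr0.
Qed.

Let g0 : gL 0 = gR 0. Proof. by rewrite /gL /gR !mul0r. Qed.

Let D0 : DL 0 = DR 0.
Proof.
rewrite /DL /DR fL0 !mulr0; case: ifP => _; first by rewrite subr0.
by rewrite expR0 subrr mul0r subr0.
Qed.

Let gLip u v : u <= v -> `|v * stein_fun v - u * stein_fun u| <= N 0 * (v - u).
Proof.
have L x y : x <= y -> y <= 0 -> `|gL y - gL x| <= N 0 * (y - x).
  move=> xy y0; have [c /andP[cx cy] ->] := is_derive_mvt xy (fun w _ => dgL w).
  by rewrite normrM (ger0_norm (_ : 0 <= y - x)) ?subr_ge0// ler_wpM2r ?subr_ge0 ?dgL_le ?(le_trans cy).
have Rr x y : x <= y -> 0 <= x -> `|gR y - gR x| <= N 0 * (y - x).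
  move=> xy y0; have [c /andP[cx cy] ->] := is_derive_mvt xy (fun w _ => dgR w).
  rewrite normrM (ger0_norm (_ : 0 <= y - x)) ?subr_ge0//.
  by apply: ler_wpM2r; rewrite ?subr_ge0//; exact/dgR_le/(le_trans y0).
move=> uv; rewrite !gE; have [v0|v0] := leP v 0.
  by rewrite (le_trans uv v0) L.
have [u0|u0] := leP u 0; last by rewrite Rr// ltW.
have := L _ _ u0 (lexx _); have := Rr _ _ (ltW v0) (lexx _); rewrite g0.
have := ler_normD (gR v - gR 0) (gR 0 - gL u); rewrite addrA subrK; lra.
Qed.

Lemma stein_fun_mul_lipschitz u v :
  `|v * stein_fun v - u * stein_fun u| <= N 0 * `|v - u|.
Proof.
have [uv|/ltW vu] := leP u v; first by rewrite (ger0_norm (_ : 0 <= v - u)) ?subr_ge0// gLip.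
by rewrite distrC (distrC v) (ger0_norm (_ : 0 <= u - v)) ?subr_ge0// gLip.
Qed.

Let smooth_taylor u v (e l : R) : u <= v -> `|u - e| <= l -> `|v - e| <= l ->
  `|(v - u) * (e * stein_fun e) - (stein_smooth v - stein_smooth u)| <= N 0 * l * (v - u).
Proof.
have near_e c x y : x <= c <= y -> `|x - e| <= l -> `|y - e| <= l ->
    `|e * stein_fun e - c * stein_fun c| <= N 0 * l.
  move=> /andP[xc cy] xl yl.
  apply: (le_trans (stein_fun_mul_lipschitz _ _)); rewrite ler_pM2l//.
  move: xl yl; rewrite !ler_norml; lra.
have L x y : x <= y -> y <= 0 -> `|x - e| <= l -> `|y - e| <= l ->
    `|(y - x) * (e * stein_fun e) - (DL y - DL x)| <= N 0 * l * (y - x).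
  move=> xy y0 xl yl; have [c cxy ->] := is_derive_mvt xy (fun w _ => dDL w).
  have -> : gL c = c * stein_fun c by rewrite gE; case/andP: cxy => _ cy; rewrite (le_trans cy).
  rewrite (mulrC (y - x)) -mulrBl normrM (ger0_norm (_ : 0 <= y - x)) ?subr_ge0//.
  by rewrite ler_wpM2r ?subr_ge0//; exact: near_e cxy xl yl.
have Rr x y : x <= y -> 0 <= x -> `|x - e| <= l -> `|y - e| <= l ->
    `|(y - x) * (e * stein_fun e) - (DR y - DR x)| <= N 0 * l * (y - x).
  move=> xy x0 xl yl; have [c cxy ->] := is_derive_mvt xy (fun w _ => dDR w).
  have -> : gR c = c * stein_fun c.
    rewrite gE; case/andP: cxy => cx _; case: ifPn => // c0.
    have -> : c = 0 by apply/eqP; rewrite eq_le c0 (le_trans x0).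
    by rewrite g0.
  rewrite (mulrC (y - x)) -mulrBl normrM (ger0_norm (_ : 0 <= y - x)) ?subr_ge0//.
  by rewrite ler_wpM2r ?subr_ge0//; exact: near_e cxy xl yl.
move=> uv ul vl; rewrite !DE; have [v0|v0] := leP v 0.
  by rewrite (le_trans uv v0) L.
have [u0|u0] := leP u 0; last by rewrite Rr// ltW.
have el : `|0 - e| <= l by move: ul vl; rewrite !ler_norml; lra.
have h1 := L _ _ u0 (lexx _) ul el; have h2 := Rr _ _ (ltW v0) (lexx _) el vl.
rewrite D0 in h1.
set s := e * stein_fun e in h1 h2 *.
have := ler_normD ((v - 0) * s - (DR v - DR 0)) ((0 - u) * s - (DR 0 - DL u)).
have -> : (v - 0) * s - (DR v - DR 0) + ((0 - u) * s - (DR 0 - DL u)) =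
   (v - u) * s - (DR v - DL u) by ring.
lra.
Qed.

Lemma stein_smooth_taylor w y s :
  `|y * ((w + s) * stein_fun (w + s)) - (stein_smooth (w + y) - stein_smooth w)| <=
  N 0 * (`|y| + `|s|) * `|y|.
Proof.
have l1 : `|w - (w + s)| <= `|y| + `|s|.
  by rewrite opprD addrA subrr sub0r normrN lerDr.
have l2 : `|w + y - (w + s)| <= `|y| + `|s|.
  by rewrite opprD addrACA subrr add0r ler_normB.
have [y0|y0] := leP 0 y.
  have := smooth_taylor _ l1 l2; rewrite addrAC subrr add0r lerDl => /(_ y0).
  by rewrite (ger0_norm y0).
have := smooth_taylor _ l2 l1; rewrite gerDl (ltW y0) opprD addrA subrr sub0r => /(_ isT).
rewrite (ltr0_norm y0) -normrN; congr (`|_| <= _); ring.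
Qed.

Lemma stein_fun_le w : `|stein_fun w| <= 2 * N 0.
Proof.
have m0 := Mills_ge0; have m1 := Mills_le; rewrite /stein_fun; case: ifPn => w0.
  have h1 := @N_le (- w); rewrite oppr_ge0 in h1; have := h1 w0.
  have := mills_scaled_ge0 (- w); rewrite mulNr normrN ger0_norm; last by rewrite mulr_ge0// mills_scaled_ge0.
  nra.
move: w0; rewrite -ltNge => /ltW w0.
have h1 := N_le w0; have h2 := mills_scaled_ge0 w.
have h3 : N (w + a) <= N 0 by rewrite N_le// addr_ge0.
have h4 := mills_scaled_ge0 (w + a).
have q0 : 0 < expR (- a * w) by exact: expR_gt0.
have q1 : expR (- a * w) <= 1 by rewrite -expR0 ler_expR mulNr oppr_le0 mulr_ge0.
have h5 : 0 <= m * N w <= N 0 by apply/andP; split; [rewrite mulr_ge0|nra].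
have h6 : 0 <= expR (- a * w) * N (w + a) <= N 0 by apply/andP; split; [rewrite mulr_ge0// ltW|nra].
by rewrite ler_norml; apply/andP; split; lra.
Qed.

Lemma measurable_stein_fun : measurable_fun setT stein_fun.
Proof.
apply: measurable_fun_ifT.
- exact: measurable_fun_ler.
- apply: continuous_measurable_fun => w; apply: differentiable_continuous.
  by apply/derivable1_diffP; have [] := dfL w.
- apply: continuous_measurable_fun => w; apply: differentiable_continuous.
  by apply/derivable1_diffP; have [] := dfR w.
Qed.

Lemma measurable_step_down : measurable_fun setT step_down.
Proof. by apply: measurable_fun_ifT => //; exact: measurable_fun_ler. Qed.

Lemma measurable_exp_down : measurable_fun setT exp_down.
Proof.
apply: measurableT_comp => //; apply: measurable_funM => //.
exact: measurable_maxr.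
Qed.

Lemma measurable_tilted_tail : measurable_fun setT tilted_tail.
Proof.
apply: measurable_fun_ifT => //; first exact: measurable_fun_ltr.
by apply: measurableT_comp => //; exact: measurable_funM.
Qed.

(** To be used with y the value of one summand and s that of an independent copy. The Lipschitz part
    costs [B]. The exponential and the step enter f' with opposite signs, hence with [c1] and [c2]
    exchanged, so that each of the two estimates carries total weight |y|. *)
Lemma stein_fun_taylor y s : exists c1 c2 : R,
  [/\ 0 <= c1, 0 <= c2, c1 + c2 = `|y| & exists lo hi, lo <= hi <= lo + (`|y| + `|s|) /\
    forall w,
    let De := exp_down (w + lo) - exp_down (w + hi) in
    let Ds := step_down (w + lo) - step_down (w + hi) in
    let E := y * stein_fun' (w + s) - (stein_fun (w + y) - stein_fun w) in
    let B := N 0 * (`|y| + `|s|) * `|y| in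
    (E <= B + (c1 * De + c2 * Ds)) /\ (- E <= B + (c2 * De + c1 * Ds))].
Proof.
have [c1 [c2 [c10 c20 c12 H]]] := supergradient_taylor y s.
exists c1, c2; split => //.
pose lo := Num.min 0 (Num.min y s); pose hi := Num.max 0 (Num.max y s).
exists lo, hi; split.
  have := ler_norm y; have := ler_norm s; have := ler_norm (- y).
  have := ler_norm (- s); rewrite !normrN => y1 s1 y2 s2.
  have := normr_ge0 y; have := normr_ge0 s => s3 y3.
  apply/andP; split; first by rewrite (@le_trans _ _ 0) ?ge_min ?le_max ?lexx.
  rewrite !ge_max -!lerBlDr !le_min.
  by do !(apply/andP; split); lra.
move=> w De Ds E B.
have b x : (x == 0) || (x == y) || (x == s) -> lo <= x <= hi.
  by rewrite /lo /hi => /orP[/orP[]|] /eqP->; rewrite !ge_min !le_max !lexx ?orbT.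
have b0 := b 0; have by_ := b y; have bs := b s; rewrite !eqxx ?orbT in b0 by_ bs.
have h1 := H _ _ exp_down_supergradient w _ _ (b0 isT) (by_ isT) (bs isT).
have h2 := H _ _ step_down_supergradient w _ _ (b0 isT) (by_ isT) (bs isT).
have := stein_smooth_taylor w y s; rewrite ler_norml -/B.
have -> : E = y * ((w + s) * stein_fun (w + s)) - (stein_smooth (w + y) - stein_smooth w)
   + (y * exp_down (w + s) - (exp_down_prim (w + y) - exp_down_prim w))
   - (y * step_down (w + s) - (step_down_prim (w + y) - step_down_prim w)).
  by rewrite /E /stein_fun' /stein_smooth tilted_tailE; ring.
rewrite /De /Ds; lra.
Qed.

End stein_solution.

(** * Expectation and independence *)

Section Rexpectation.
Context {d} {T : measurableType d} {R : realType} (P : probability T R).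
Local Notation Ex f := (Rintegral P setT f).
Local Notation integ f := (P.-integrable setT (EFin \o f)).
Implicit Types f g : T -> R.

Lemma Rint_cst c : Ex (fun=> c) = c.
Proof.
have P1 : P setT = 1%E by exact: probability_setT.
by rewrite (Rintegral_cst P measurableT) [X in fine X]P1 mulr1.
Qed.

Lemma integ_cst c : integ (fun=> c).
Proof. exact: finite_measure_integrable_cst. Qed.

Lemma integ_measurable f : integ f -> measurable_fun setT f.
Proof. by move=> /integrableP[/measurable_EFinP]. Qed.

Lemma integ_le f g : measurable_fun setT f -> (forall w, `|f w| <= g w) ->
  integ g -> integ f.
Proof.
move=> mf fg ig; apply: le_integrable ig => //; first exact/measurable_EFinP.
by move=> w _; rewrite /= lee_fin (le_trans (fg w))// ler_norm.
Qed.

Lemma integ_bounded f c : measurable_fun setT f -> (forall w, `|f w| <= c) -> integ f.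
Proof. by move=> mf fc; apply: integ_le mf fc (integ_cst c). Qed.

Lemma integD f g : integ f -> integ g -> integ (fun w => f w + g w).
Proof. by move=> fi gi; exact: (integrableD measurableT fi gi). Qed.

Lemma integZl k f : integ f -> integ (fun w => k * f w).
Proof. by move=> fi; exact: (integrableZl measurableT k fi). Qed.

Lemma integZr k f : integ f -> integ (fun w => f w * k).
Proof. by move=> /(integZl k); under eq_fun do rewrite mulrC. Qed.

Lemma integB f g : integ f -> integ g -> integ (fun w => f w - g w).
Proof. by move=> fi gi; exact: (integrableB measurableT fi gi). Qed.

Lemma integ_norm f : integ f -> integ (fun w => `|f w|).
Proof. by move=> fi; exact: (integrable_norm fi). Qed.

Lemma integ_sum (I : Type) (s : seq I) (p : pred I) (F : I -> T -> R) :
  (forall i, p i -> integ (F i)) -> integ (fun w => \sum_(i <- s | p i) F i w).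
Proof.
move=> Fi; have := integrable_sum measurableT s (fun i pi => Fi i pi).
by apply: eq_integrable => // w _; rewrite /= sumEFin.
Qed.

Lemma Rint_sum (I : Type) (s : seq I) (p : pred I) (F : I -> T -> R) :
  (forall i, p i -> integ (F i)) ->
  Ex (fun w => \sum_(i <- s | p i) F i w) = \sum_(i <- s | p i) Ex (F i).
Proof.
move=> Fi; elim: s => [|i s ih].
  rewrite big_nil; under eq_Rintegral do rewrite big_nil.
  exact: Rint_cst.
rewrite big_cons; case: ifPn => pi.
  rewrite -ih -RintegralD//; [|exact: Fi|exact: integ_sum].
  by apply: eq_Rintegral => w _; rewrite big_cons pi.
by rewrite -ih; apply: eq_Rintegral => w _; rewrite big_cons (negbTE pi).
Qed.

Lemma RintD f g : integ f -> integ g -> Ex (fun w => f w + g w) = Ex f + Ex g.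
Proof. by move=> fi gi; rewrite RintegralD. Qed.

Lemma RintB f g : integ f -> integ g -> Ex (fun w => f w - g w) = Ex f - Ex g.
Proof. by move=> fi gi; rewrite RintegralB. Qed.

Lemma RintZl k f : integ f -> Ex (fun w => k * f w) = k * Ex f.
Proof. by move=> fi; rewrite RintegralZl. Qed.

Lemma RintZr k f : integ f -> Ex (fun w => f w * k) = Ex f * k.
Proof. by move=> fi; rewrite RintegralZr. Qed.

Lemma Rint_le f g : integ f -> integ g -> (forall w, f w <= g w) -> Ex f <= Ex g.
Proof. by move=> fi gi fg; apply: le_Rintegral. Qed.

Lemma Rint_ge0 f : (forall w, 0 <= f w) -> 0 <= Ex f.
Proof. by move=> f0; apply: Rintegral_ge0. Qed.

Lemma Rint_norm_le f g : integ f -> integ g -> (forall w, `|f w| <= g w) -> `|Ex f| <= Ex g.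
Proof.
move=> fi gi fg; apply: (le_trans (le_normr_Rintegral _ fi)) => //.
by apply: Rint_le => //; exact: integ_norm.
Qed.

Lemma EFin_Rint f : integ f -> (Ex f)%:E = (\int[P]_w (f w)%:E)%E.
Proof. by move=> fi; rewrite fineK// integrable_fin_num. Qed.

End Rexpectation.

Section independent_pair.
Context {d} {T : measurableType d} {R : realType} (P : probability T R).
Local Notation Ex f := (Rintegral P setT f).
Local Notation integ f := (P.-integrable setT (EFin \o f)).
Variables (Y Z : T -> R).
Hypotheses (mY : measurable_fun setT Y) (mZ : measurable_fun setT Z).

Definition independent_pair := forall A B : set R, measurable A -> measurable B ->
  P (Y @^-1` A `&` Z @^-1` B) = (P (Y @^-1` A) * P (Z @^-1` B))%E.

Hypothesis YZ : independent_pair.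

Let Y' : {mfun T >-> R} := HB.pack Y (isMeasurableFun.Build _ _ _ _ Y mY).
Let Z' : {mfun T >-> R} := HB.pack Z (isMeasurableFun.Build _ _ _ _ Z mZ).

Let pair_ w : R * R := (Y w, Z w).
Let pair2 (w : T * T) : R * R := (Y w.1, Z w.2).

Let mpair : measurable_fun setT pair_.
Proof. exact: measurable_fun_pair. Qed.

Let mpair2 : measurable_fun setT pair2.
Proof.
apply: measurable_fun_pair; exact: measurableT_comp.
Qed.

Let pair'  : {mfun T >-> (R * R)%type} := HB.pack pair_ (isMeasurableFun.Build _ _ _ _ pair_ mpair).
Let pair2' : {mfun (T * T)%type >-> (R * R)%type} :=
  HB.pack pair2 (isMeasurableFun.Build _ _ _ _ pair2 mpair2).

(** By independence the law of (Y, Z) agrees on rectangles with the law of (Y w, Z w') under P x P;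
    both are therefore the product of the marginal laws. Expectations of functions of (Y, Z) thus
    become iterated integrals over T x T. *)
Let law_pair X : measurable X -> pushforward P pair_ X = pushforward (P \x P)%E pair2 X.
Proof.
move=> mX.
have e1 := @product_measure_unique _ _ _ _ _ (distribution P Y') (distribution P Z').
rewrite -(e1 (distribution P pair') _ _ mX).
  apply: (e1 (distribution (P \x P) pair2') _ _ mX).
  move=> A B mA mB.
  rewrite /distribution /pushforward /=.
  have -> : pair2 @^-1` (A `*` B) = (Y @^-1` A) `*` (Z @^-1` B) by [].
  rewrite product_measure1E//.
  - by rewrite -[X in measurable X]setTI; exact: mY.
  - by rewrite -[X in measurable X]setTI; exact: mZ.
move=> A B mA mB; rewrite /distribution /pushforward /=.
by rewrite -YZ.
Qed.

Lemma independent_pair_tonelli (f : R * R -> \bar R) : measurable_fun setT f ->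
  (forall z, 0 <= f z)%E ->
  (\int[P]_w f (Y w, Z w) = \int[P]_w \int[P]_w' f (Y w, Z w'))%E.
Proof.
move=> mf f0.
have f0' : {in [set: R * R], forall y, (0%R <= f y)%E} by move=> y _; exact: f0.
have := ge0_integral_pushforward mpair P measurableT mf f0'.
rewrite preimage_setT => <-.
rewrite (eq_measure_integral (pushforward (P \x P)%E pair2)); last first.
  by move=> A mA _; exact: law_pair.
rewrite (ge0_integral_pushforward mpair2)// preimage_setT.
rewrite fubini_tonelli1//; last by move=> w; exact: f0.
exact: measurableT_comp.
Qed.

Lemma independent_pair_integ (f : R * R -> R) : measurable_fun setT f ->
  integ (fun w => f (Y w, Z w)) ->
  (P \x P)%E.-integrable setT (fun w => (f (Y w.1, Z w.2))%:E).
Proof.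
move=> mf /integrableP[_ fi]; apply/integrableP; split.
  apply/measurable_EFinP; exact: (measurableT_comp mf mpair2).
have mf' : measurable_fun setT (fun z => `|(f z)%:E|%E).
  by apply: measurableT_comp => //; exact/measurable_EFinP.
rewrite fubini_tonelli1//.
  by rewrite -(independent_pair_tonelli mf').
exact: (measurableT_comp mf' mpair2).
Qed.

(** Every section f (y, Z) is assumed integrable, so that the inner extended-real integral is
    finite, and equal to the real one, at every point. *)
Lemma independent_pair_Fubini (f : R * R -> R) : measurable_fun setT f ->
  integ (fun w => f (Y w, Z w)) -> (forall y, integ (fun w => f (y, Z w))) ->
  integ (fun w => Ex (fun w' => f (Y w, Z w'))) /\
  Ex (fun w => f (Y w, Z w)) = Ex (fun w => Ex (fun w' => f (Y w, Z w'))).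
Proof.
move=> mf fi fyi; have fi2 := independent_pair_integ mf fi.
have e : fubini_F P (fun w => (f (Y w.1, Z w.2))%:E) =
    EFin \o (fun w => Ex (fun w' => f (Y w, Z w'))).
  by apply/funext => w; rewrite /fubini_F /= EFin_Rint//; exact: (fyi (Y w)).
have h1 := integrable_fubini_F fi2; rewrite e in h1.
split => //.
have h2 := integral12_prod_meas1 fi2; rewrite e in h2.
rewrite /Rintegral; congr fine; rewrite h2.
have mf' : measurable_fun setT (EFin \o f) by exact/measurable_EFinP.
have := integral_pushforward mpair mf' _ measurableT; rewrite preimage_setT => <-//.
rewrite (eq_measure_integral (pushforward (P \x P)%E pair2)); last first.
  by move=> A mA _; exact: law_pair.
by rewrite (integral_pushforward mpair2 mf')// preimage_setT.
Qed.

Lemma independent_pair_RintM (f g : R -> R) :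
  measurable_fun setT f -> measurable_fun setT g ->
  integ (f \o Y) -> integ (g \o Z) ->
  integ (fun w => f (Y w) * g (Z w)) /\
  Ex (fun w => f (Y w) * g (Z w)) = Ex (f \o Y) * Ex (g \o Z).
Proof.
move=> mf mg fi gi.
have mfg : measurable_fun setT (fun z : R * R => f z.1 * g z.2).
  by apply: measurable_funM; apply: measurableT_comp.
have fgi : integ (fun w => f (Y w) * g (Z w)).
  apply/integrableP; split.
    by apply/measurable_EFinP; exact: (measurableT_comp mfg mpair).
  have mfg' : measurable_fun setT (fun z : R * R => `|(f z.1 * g z.2)%:E|%E).
    by apply: measurableT_comp => //; exact/measurable_EFinP.
  rewrite (independent_pair_tonelli mfg')//=.
  have e w : (\int[P]_w' (`|f (Y w) * g (Z w')|)%:E = (`|f (Y w)| * Ex (fun w' => `|g (Z w')|))%:E)%E.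
    rewrite -RintZl; last exact: (integ_norm gi).
    by rewrite EFin_Rint; [under eq_integral do rewrite normrM|apply: integZl; exact: (integ_norm gi)].
  under eq_integral do rewrite e.
  have := integrableP _ _ _ (integZr (Ex (fun w' => `|g (Z w')|)) (integ_norm fi)).
  move=> [_]; apply: le_lt_trans; apply: ge0_le_integral => //.
  - move=> w _; rewrite lee_fin mulr_ge0// Rint_ge0//.
  - apply/measurable_EFinP/measurable_funM => //.
    apply: measurableT_comp => //; exact: (measurableT_comp mf mY).
  - apply/measurableT_comp => //; apply/measurable_EFinP/measurable_funM => //.
    apply: measurableT_comp => //; exact: (measurableT_comp mf mY).
  - by move=> w _; rewrite lee_fin ler_norm.
split => //.
have [|_ ->] := independent_pair_Fubini mfg fgi.
  by move=> y /=; exact: (integZl (f y) gi).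
have e w : Ex (fun w' => f (Y w) * g (Z w')) = f (Y w) * Ex (g \o Z).
  by rewrite RintZl.
by rewrite -RintZr//; apply: eq_Rintegral => w _; exact: e.
Qed.

End independent_pair.

Section mutual_independence.
Context {d} {T : measurableType d} {R : realType} (P : probability T R).
Variables (I : eqType) (X : I -> T -> R).
Hypotheses (mX : forall i, measurable_fun setT (X i))
  (indX : mutually_independent P X).

Lemma measurable_event (Y : T -> R) (B : set R) : measurable_fun setT Y ->
  measurable B -> measurable (Y @^-1` B).
Proof. by move=> mY mB; rewrite -[X in measurable X]setTI; exact: mY. Qed.

(* Conditioning on [E] turns the law of [(Y, Z)] into a measure that agrees with
   the unconditional one on rectangles, hence everywhere. *)
Lemma independent_event_pair (E : set T) (Y Z : T -> R) (C : set (R * R)) :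
  measurable E -> measurable_fun setT Y -> measurable_fun setT Z ->
  independent_pair P Y Z ->
  (forall A B, measurable A -> measurable B ->
    P (E `&` (Y @^-1` A `&` Z @^-1` B)) = P E * P (Y @^-1` A `&` Z @^-1` B))%E ->
  measurable C ->
  P (E `&` [set w | C (Y w, Z w)]) = (P E * P [set w | C (Y w, Z w)])%E.
Proof.
move=> mE mY mZ YZ EYZ mC.
have mp : measurable_fun setT (fun w => (Y w, Z w)) by exact: measurable_fun_pair.
have mCp : measurable [set w | C (Y w, Z w)].
  by rewrite -[X in measurable X]setTI; exact: mp.
have [PE0|PE0] := eqVneq (P E) 0%E.
  rewrite PE0 mul0e; apply/eqP; rewrite eq_le measure_ge0 andbT -PE0.
  by apply: le_measure; rewrite ?inE//; exact: measurableI.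
have PEf : P E \is a fin_num by exact: fin_num_measure.
pose c : R := (fine (P E))^-1.
have c0 : 0 <= c by rewrite invr_ge0 fine_ge0.
have cPE : (c%:E * P E = 1)%E.
  by rewrite -(fineK PEf) -EFinM mulVf// fine_eq0.
pose Y' : {mfun T >-> R} := HB.pack Y (isMeasurableFun.Build _ _ _ _ Y mY).
pose Z' : {mfun T >-> R} := HB.pack Z (isMeasurableFun.Build _ _ _ _ Z mZ).
pose p w := (Y w, Z w).
pose p' : {mfun T >-> (R * R)%type} := HB.pack p (isMeasurableFun.Build _ _ _ _ p mp).
have e1 := @product_measure_unique _ _ _ _ _ (distribution P Y') (distribution P Z').
have h1 : (distribution P Y' \x distribution P Z')%E C = P [set w | C (Y w, Z w)].
  by apply: (e1 (distribution P p') _ _ mC) => A B mA mB; rewrite -YZ.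
have h2 : (distribution P Y' \x distribution P Z')%E C = (c%:E * P (E `&` [set w | C (Y w, Z w)]))%E.
  rewrite (e1 (mscale (NngNum c0) (pushforward (mrestr P mE) p)) _ _ mC).
    by rewrite setIC.
  move=> A B mA mB; rewrite -[LHS]/(c%:E * P (p @^-1` (A `*` B) `&` E))%E setIC.
  by rewrite EYZ// muleA cPE mul1e YZ.
by rewrite -h1 h2 muleA (muleC (P E)) cPE mul1e.
Qed.

Section bigop.
Variables (op : R -> R -> R) (z0 : R).
Hypothesis mop : measurable_fun setT (fun z : R * R => op z.1 z.2).
Local Notation S s := (fun w => \big[op/z0]_(i <- s) X i w).

Let mS s : measurable_fun setT (S s).
Proof.
elim: s => [|a s ih].
  by under eq_fun do rewrite big_nil; exact: measurable_cst.
under eq_fun do rewrite big_cons.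
exact: (measurableT_comp mop (measurable_fun_pair (mX a) ih)).
Qed.

(** The induction on [s] needs the spare block [t] of events: the head of [s] is moved into [t]
    before the induction hypothesis is applied to the tail. A general [op] serves sums and products
    alike. *)
Lemma mutually_independent_event_bigop (s t : seq I) (B : I -> set R) (A : set R) :
  uniq (s ++ t) -> (forall i, measurable (B i)) -> measurable A ->
  P ((\big[setI/setT]_(i <- t) (X i @^-1` B i)) `&` S s @^-1` A) =
  (P (\big[setI/setT]_(i <- t) (X i @^-1` B i)) * P (S s @^-1` A))%E.
Proof.
elim: s t A B => [|a s ih] t A B.
  move=> _ mB mA.
  have -> : S [::] = (fun=> z0) by apply/funext => w; rewrite big_nil.
  rewrite preimage_cst; case: ifP => _.
    by rewrite setIT probability_setT mule1.
  by rewrite setI0 measure0 mule0.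
move=> /= /andP[ast ust] mB mA.
set E := \big[_/_]_(i <- t) _.
have mE : measurable E by apply: bigsetI_measurable => i _; exact: measurable_event.
have at_ : a \notin t by move: ast; rewrite mem_cat => /norP[].
have uat : uniq (s ++ a :: t).
  by rewrite uniq_catC /= mem_cat orbC -mem_cat ast uniq_catC.
pose B' (A' : set R) i := if i == a then A' else B i.
have mB' A' : measurable A' -> forall i, measurable (B' A' i).
  by move=> mA' i; rewrite /B'; case: ifP.
have BE A' : \big[setI/setT]_(i <- a :: t) (X i @^-1` B' A' i) = (X a @^-1` A') `&` E.
  rewrite big_cons /B' eqxx; congr (_ `&` _); apply: eq_big_seq => i it.
  by rewrite ifN//; apply: contraNneq at_ => <-.
have tri A1 A2 : measurable A1 -> measurable A2 ->
    P (E `&` (X a @^-1` A1 `&` S s @^-1` A2)) = (P (E `&` X a @^-1` A1) * P (S s @^-1` A2))%E.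
  move=> mA1 mA2; have := ih (a :: t) A2 (B' A1) uat (mB' _ mA1) mA2.
  by rewrite BE setIA (setIC E).
have EA A1 : measurable A1 -> P (E `&` X a @^-1` A1) = (P E * P (X a @^-1` A1))%E.
  move=> mA1; have := indX (s := a :: t) (B := B' A1).
  rewrite BE big_cons {2}/B' eqxx setIC => ->; last exact: mB'.
    rewrite muleC; congr (_ * _)%E; rewrite /E indX//; last by move: ust; rewrite cat_uniq => /and3P[].
    by apply: eq_big_seq => i it; rewrite /B' ifN//; apply: contraNneq at_ => <-.
  by rewrite /= at_; move: ust; rewrite cat_uniq => /and3P[].
have pair_ : independent_pair P (X a) (S s).
  move=> A1 A2 mA1 mA2; have := ih [:: a] A2 (fun=> A1).
  rewrite !big_seq1; apply => //.
  by rewrite cats1 rcons_uniq; move: ast ust; rewrite mem_cat cat_uniq => /norP[-> _] /and3P[->].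
have mC : measurable [set z : R * R | A (op z.1 z.2)].
  by rewrite -[X in measurable X]setTI; exact: mop.
have SE : S (a :: s) @^-1` A = [set w | [set z : R * R | A (op z.1 z.2)] (X a w, S s w)].
  by apply/seteqP; split=> w /=; rewrite big_cons.
rewrite SE; apply: independent_event_pair => //.
by move=> A1 A2 mA1 mA2; rewrite tri// EA// -muleA pair_.
Qed.

Lemma mutually_independent_bigop (j : I) (s : seq I) : uniq s -> j \notin s ->
  independent_pair P (X j) (S s).
Proof.
move=> us js A B mA mB.
have := mutually_independent_event_bigop (t := [:: j]) (B := fun=> A) (A := B) (s := s).
by rewrite !big_seq1; apply => //; rewrite cats1 rcons_uniq js.
Qed.

End bigop.

Lemma mutually_independent_sum (j : I) (s : seq I) : uniq s -> j \notin s ->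
  independent_pair P (X j) (fun w => \sum_(i <- s) X i w).
Proof. by apply: mutually_independent_bigop; exact: measurable_funD. Qed.

Lemma mutually_independent_prod (j : I) (s : seq I) : uniq s -> j \notin s ->
  independent_pair P (X j) (fun w => \prod_(i <- s) X i w).
Proof. by apply: mutually_independent_bigop; exact: measurable_funM. Qed.

Lemma mutually_independent_comp (phi : I -> R -> R) :
  (forall i, measurable_fun setT (phi i)) ->
  mutually_independent P (fun i => phi i \o X i).
Proof.
move=> mphi s B us mB.
have := indX us (B := fun i => phi i @^-1` B i); apply => i.
by rewrite -[X in measurable X]setTI; exact: mphi.
Qed.

End mutual_independence.

(** * Concentration and the normal approximation *)

Section concentration.
Context {d} {T : measurableType d} {R : realType} (P : probability T R).
Local Notation Ex f := (Rintegral P setT f).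
Local Notation integ f := (P.-integrable setT (EFin \o f)).

Lemma integ_of_sqr (Y : T -> R) : measurable_fun setT Y ->
  integ (fun w => Y w ^+ 2) -> integ Y.
Proof.
move=> mY Y2; apply: integ_le mY _ (integD (integ_cst P 1) Y2) => w.
rewrite -[in leRHS]real_normK ?num_real//; have := normr_ge0 (Y w); nra.
Qed.

Section variance.
Variables (I : eqType) (X : I -> T -> R).
Hypotheses (mX : forall i, measurable_fun setT (X i))
  (indX : mutually_independent P X)
  (EX0 : forall i, Ex (X i) = 0)
  (X2 : forall i, integ (fun w => X i w ^+ 2)).
Local Notation S s := (fun w => \sum_(i <- s) X i w).

Let X1 i : integ (X i). Proof. exact: integ_of_sqr. Qed.

Let S1 s : integ (S s). Proof. by apply: integ_sum. Qed.

Lemma variance_sum s : uniq s -> integ (fun w => S s w ^+ 2) /\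
  Ex (fun w => S s w ^+ 2) = \sum_(i <- s) Ex (fun w => X i w ^+ 2).
Proof.
elim: s => [_|a s ih /= /andP[as_ us]].
  rewrite big_nil; have e : (fun w => S [::] w ^+ 2) = fun=> 0.
    by apply/funext => w; rewrite big_nil expr0n.
  by rewrite e Rint_cst; split => //; exact: integ_cst.
have [S2 ES2] := ih us.
have mS : measurable_fun setT (S s) by exact: measurable_sum.
have [XS EXS] := independent_pair_RintM (mX a) mS
  (mutually_independent_sum mX indX us as_) (@measurable_id _ R setT)
  (@measurable_id _ R setT) (X1 a) (S1 s).
have e : (fun w => S (a :: s) w ^+ 2) =
    fun w => (X a w ^+ 2 + 2 * (X a w * S s w)) + S s w ^+ 2.
  by apply/funext => w; rewrite big_cons; ring.
rewrite e; have i1 : integ (fun w => X a w ^+ 2 + 2 * (X a w * S s w)).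
  by apply: integD => //; exact: (integZl 2 XS).
split; first exact: integD.
rewrite RintD// RintD//; last exact: (integZl 2 XS).
rewrite RintZl// big_cons -ES2; congr (_ + _).
have EXS' : Ex (fun w => X a w * S s w) = 0.
  by rewrite [LHS]EXS [X in X * _](EX0 a) mul0r.
by rewrite EXS' mulr0 addr0.
Qed.

(** X_j is centred and independent of S - X_j, so E X_j F(S - X_j) = 0 can be subtracted from the
    j-th term of E S F(S). Used for the concentration test function and again for the Stein
    solution. *)
Lemma Rint_mul_sum_fun s (F : R -> R) c : uniq s -> measurable_fun setT F ->
  (forall v, `|F v| <= c) ->
  (forall j, integ (fun w => X j w * (F (S s w) - F (S s w - X j w)))) /\
  Ex (fun w => S s w * F (S s w)) =
  \sum_(j <- s) Ex (fun w => X j w * (F (S s w) - F (S s w - X j w))).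
Proof.
move=> us mF Fc.
have mS t : measurable_fun setT (S t) by exact: measurable_sum.
have XF j (Y : T -> R) : measurable_fun setT Y -> integ (fun w => X j w * F (Y w)).
  move=> mY; apply: integ_le (integZl c (integ_norm (X1 j))).
    by apply: measurable_funM => //; exact: measurableT_comp.
  by move=> w; rewrite normrM mulrC ler_wpM2r.
have XF1 j := XF j _ (mS s).
have XF2 j : integ (fun w => X j w * F (S s w - X j w)).
  by apply: XF; apply: measurable_funB.
have e j : (fun w => X j w * (F (S s w) - F (S s w - X j w))) =
   fun w => X j w * F (S s w) - X j w * F (S s w - X j w).
  by apply/funext => w; rewrite mulrBr.
split=> [j|]; first by rewrite e; exact: integB.
have -> : (fun w => S s w * F (S s w)) = fun w => \sum_(j <- s) (X j w * F (S s w)).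
  by apply/funext => w; rewrite mulr_suml.
rewrite Rint_sum//; apply: eq_big_seq => j js.
rewrite e RintB//.
have -> : (fun w => X j w * F (S s w - X j w)) = fun w => X j w * F (S (rem j s) w).
  by apply/funext => w; rewrite (big_rem j)//= addrAC subrr add0r.
have iFS : integ (F \o S (rem j s)).
  apply: (@integ_le _ _ _ _ _ (fun=> c)); last exact: integ_cst.
    exact: (measurableT_comp mF (mS _)).
  by move=> w; exact: Fc.
have ind : independent_pair P (X j) (S (rem j s)).
  apply: (mutually_independent_sum mX indX); first exact: rem_uniq.
  by rewrite mem_rem_uniq// inE eqxx.
have [_ h] := @independent_pair_RintM _ _ _ P (X j) (S (rem j s)) (mX j) (mS _) ind
  id F (@measurable_id _ R setT) mF (X1 j) iFS.
by rewrite [X in _ - X]h [X in X * _](EX0 j) mul0r subr0.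
Qed.

End variance.

Section smoothed_concentration.
Variables (I : eqType) (X : I -> T -> R).
Hypotheses (mX : forall i, measurable_fun setT (X i))
  (indX : mutually_independent P X)
  (EX0 : forall i, Ex (X i) = 0)
  (X2 : forall i, integ (fun w => X i w ^+ 2))
  (X3 : forall i, integ (fun w => `|X i w| ^+ 3)).
Local Notation S s := (fun w => \sum_(i <- s) X i w).
Variables (K k : R -> R).
Hypotheses (Kk : supergradient K k) (mK : measurable_fun setT K)
  (mk : measurable_fun setT k) (k01 : forall v, 0 <= k v <= 1).

Let F (l delta v : R) := (l + 2 * delta) / 2 - (K (v + l + delta) - K (v - delta)).

Let F_le l delta v : 0 <= l -> 0 <= delta -> `|F l delta v| <= (l + 2 * delta) / 2.
Proof.
move=> l0 d0.
have h1 := Kk (v - delta) (v + l + delta); have h2 := Kk (v + l + delta) (v - delta).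
have /andP[k1 k2] := k01 (v - delta); have /andP[k3 k4] := k01 (v + l + delta).
have e : v + l + delta - (v - delta) = l + 2 * delta by ring.
have e' : v - delta - (v + l + delta) = - (l + 2 * delta) by ring.
rewrite e in h1; rewrite e' in h2.
by rewrite /F ler_norml; apply/andP; split; nra.
Qed.

Let K_concave u v c : u <= v -> 0 <= c -> K (v + c) - K (u + c) <= K v - K u.
Proof.
move=> uv c0; have [vu|uv'] := leP v (u + c).
  have h1 := Kk (u + c) (v + c); have h2 := Kk v u.
  have h3 := supergradient_nincr Kk vu.
  have e : v + c - (u + c) = v - u by ring.
  rewrite e in h1; nra.
have h1 := Kk v (v + c); have h2 := Kk (u + c) u.
have h3 := supergradient_nincr Kk (ltW uv').
have e : v + c - v = c by ring.
have e' : u - (u + c) = - c by ring.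
rewrite e in h1; rewrite e' in h2; nra.
Qed.

Let F_nondecr l delta u v : 0 <= l -> 0 <= delta -> u <= v -> F l delta u <= F l delta v.
Proof.
move=> l0 d0 uv.
have := @K_concave (u - delta) (v - delta) (l + 2 * delta).
rewrite lerD2r => /(_ uv); rewrite addr_ge0 ?mulr_ge0// => /(_ isT).
have e x : x - delta + (l + 2 * delta) = x + l + delta by ring.
rewrite !e /F; lra.
Qed.

(** The window of [F] is wider than [v, v + l] by delta on each side; over steps of length at most
    delta its slope therefore dominates k - k (. + l) taken at either end of the step. *)
Let F_incr l delta u v : 0 <= l -> 0 <= delta -> u <= v -> v <= u + delta ->
  (v - u) * (k u - k (u + l)) <= F l delta v - F l delta u /\
  (v - u) * (k v - k (v + l)) <= F l delta v - F l delta u.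
Proof.
move=> l0 d0 uv vu.
have h1 := Kk (v - delta) (u - delta); have h2 := Kk (u + l + delta) (v + l + delta).
have e1 : u - delta - (v - delta) = - (v - u) by ring.
have e2 : v + l + delta - (u + l + delta) = v - u by ring.
rewrite e1 in h1; rewrite e2 in h2.
have k1 : k v <= k (v - delta) by apply: (supergradient_nincr Kk); lra.
have k2 : k u <= k (v - delta) by apply: (supergradient_nincr Kk); lra.
have k3 : k (u + l + delta) <= k (u + l) by apply: (supergradient_nincr Kk); lra.
have k4 : k (u + l + delta) <= k (v + l) by apply: (supergradient_nincr Kk); lra.
have uv0 : 0 <= v - u by rewrite subr_ge0.
split.
  have := ler_wpM2l uv0 k2; have := ler_wpM2l uv0 k3; rewrite /F; lra.
have := ler_wpM2l uv0 k1; have := ler_wpM2l uv0 k4; rewrite /F; lra.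
Qed.

(** The weight that a summand of size x contributes: [F] is nondecreasing everywhere, but its growth
    is controlled only over a distance delta. *)
Let trunc (delta x : R) := `|x| * Num.min delta `|x|.

Let mul_F_ge l delta v x : 0 <= l -> 0 <= delta ->
  trunc delta x * (k v - k (v + l)) <= x * (F l delta v - F l delta (v - x)).
Proof.
move=> l0 d0; rewrite /trunc.
have D0 : 0 <= k v - k (v + l).
  by rewrite subr_ge0 (supergradient_nincr Kk)// lerDl.
have [x0|/ltW x0] := leP 0 x.
  rewrite ger0_norm// -mulrA ler_wpM2l//; have [dx|xd] := leP delta x.
    have [||_] := @F_incr l delta (v - delta) v l0 d0; rewrite ?gerBl ?subrK// opprB addrC subrK.
    move=> h; apply: (le_trans h); rewrite lerD2l lerN2.
    by apply: F_nondecr => //; rewrite lerD2l lerN2.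
  have [||_] := @F_incr l delta (v - x) v l0 d0; rewrite ?gerBl//; last by rewrite opprB addrC subrK.
  lra.
rewrite ler0_norm//.
have -> : x * (F l delta v - F l delta (v - x)) =
    - x * (F l delta (v - x) - F l delta v) by ring.
have y0 : 0 <= - x by rewrite oppr_ge0.
rewrite -mulrA; apply: ler_wpM2l => //; have [dx|xd] := leP delta (- x).
  have [||+ _] := @F_incr l delta v (v + delta) l0 d0; rewrite ?lerDl// addrAC subrr add0r.
  move=> h; apply: (le_trans h); rewrite lerD2r.
  by apply: F_nondecr => //; rewrite lerD2l.
have [||+ _] := @F_incr l delta v (v - x) l0 d0; rewrite ?lerDl ?lerD2l//.
  exact: ltW.
by rewrite addrAC subrr add0r.
Qed.

(** For |x| >= delta this is |x| (|x| - 2 delta)^2 >= 0, whence the factor 4. *)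
Let trunc_ge delta x : 0 < delta ->
  x ^+ 2 - `|x| ^+ 3 / (4 * delta) <= trunc delta x.
Proof.
move=> d0; rewrite /trunc -(real_normK (num_real x)); have x0 := normr_ge0 x.
have [dx|xd] := leP delta `|x|; last first.
  rewrite -expr2 lerBlDr lerDl; apply: divr_ge0; first exact: exprn_ge0.
  by rewrite mulr_ge0// ltW.
have h : `|x| ^+ 2 - `|x| * delta <= `|x| ^+ 3 / (4 * delta).
  rewrite ler_pdivlMr ?mulr_gt0//.
  have : 0 <= `|x| * (`|x| - 2 * delta) ^+ 2 by rewrite mulr_ge0 ?sqr_ge0.
  lra.
lra.
Qed.

Let trunc_ge0 delta x : 0 <= delta -> 0 <= trunc delta x.
Proof. by move=> d0; rewrite mulr_ge0// le_min d0 /=. Qed.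

Let trunc_le delta x : 0 <= delta -> trunc delta x <= delta * `|x|.
Proof. by move=> d0; rewrite /trunc mulrC ler_wpM2r// ge_min lexx. Qed.

Let measurable_trunc delta : measurable_fun setT (trunc delta).
Proof.
apply: measurable_funM; first exact: normr_measurable.
by apply: measurable_minr => //; exact: normr_measurable.
Qed.

(* The test function [F] is the primitive of
   [k (v - delta) - k (v + l + delta)], centred so that [|F| <= l / 2 + delta]. *)
Lemma smoothed_concentration s (kappa B l : R) : uniq s -> 0 <= l -> 0 < B ->
  kappa < 1 / 2 ->
  1 - kappa <= \sum_(i <- s) Ex (fun w => X i w ^+ 2) <= 1 ->
  \sum_(i <- s) Ex (fun w => `|X i w| ^+ 3) <= B ->
  Ex (fun w => k (S s w) - k (S s w + l)) <= (l + 2 * B) / (1 - 2 * kappa).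
Proof.
move=> us l0 B0 kap /andP[v1 v2] sB.
(* This choice makes the truncation loss, the sum of E|X_i|^3 / (4 delta), at most 1/2, so that M >=
   1/2 - kappa. The numerator is then l / 2 + 2 delta = l / 2 + B. *)
pose delta := B / 2; have d0 : 0 < delta by rewrite divr_gt0.
have d0' := ltW d0.
have mS : measurable_fun setT (S s) by exact: measurable_sum.
pose D w := k (S s w) - k (S s w + l).
have D0 w : 0 <= D w by rewrite subr_ge0 (supergradient_nincr Kk)// lerDl.
have D1 w : D w <= 1.
  by have := k01 (S s w); have := k01 (S s w + l); rewrite /D; lra.
have mD : measurable_fun setT D.
  apply: measurable_funB; first exact: measurableT_comp.
  by apply: (measurableT_comp mk); exact: measurable_funD.
have iD : integ D by apply: (@integ_bounded _ _ _ P D 1 mD) => w; rewrite ger0_norm.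
pose u i w := trunc delta (X i w).
have mu i : measurable_fun setT (u i) by exact: (measurableT_comp (measurable_trunc delta) (mX i)).
have u0 i w : 0 <= u i w by exact: trunc_ge0.
have X1 i : integ (X i) by exact: integ_of_sqr.
have iu i : integ (u i).
  apply: (integ_le (mu i) _ (integZl delta (integ_norm (X1 i)))) => w.
  by rewrite ger0_norm//; exact: trunc_le.
have u2 i w : u i w ^+ 2 <= delta ^+ 2 * X i w ^+ 2.
  rewrite -(real_normK (num_real (X i w))) -exprMn ler_pXn2r ?nnegrE//.
    exact: trunc_le.
  by rewrite mulr_ge0.
have iu2 i : integ (fun w => u i w ^+ 2).
  apply: (integ_le _ _ (integZl (delta ^+ 2) (X2 i))).
    by apply: measurable_funX; exact: mu.
  by move=> w; rewrite ger0_norm ?sqr_ge0.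
pose m i := Ex (u i).
pose y i w := u i w - m i.
have my i : measurable_fun setT (y i) by apply: measurable_funB; [exact: mu|exact: measurable_cst].
have indy : mutually_independent P y.
  apply: (@mutually_independent_comp _ _ _ _ _ _ indX (fun i x => trunc delta x - m i)) => i.
  by apply: measurable_funB; [exact: measurable_trunc|exact: measurable_cst].
have y2E i : (fun w => y i w ^+ 2) = fun w => u i w ^+ 2 - (2 * m i * u i w - m i ^+ 2).
  by apply/funext => w; rewrite /y; ring.
have iy2' i : integ (fun w => 2 * m i * u i w - m i ^+ 2).
  by apply: integB; [exact: integZl|exact: integ_cst].
have y2 i : integ (fun w => y i w ^+ 2) by rewrite y2E; exact: integB.
have Ey0 i : Ex (y i) = 0.
  by rewrite RintB//; [rewrite Rint_cst subrr|exact: integ_cst].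
have Ey2 i : Ex (fun w => y i w ^+ 2) <= delta ^+ 2 * Ex (fun w => X i w ^+ 2).
  rewrite y2E RintB// RintB; [|exact: integZl|exact: integ_cst].
  have : Ex (fun w => u i w ^+ 2) <= Ex (fun w => delta ^+ 2 * X i w ^+ 2).
    by apply: Rint_le => //; exact: integZl.
  rewrite (RintZl (2 * m i))// (RintZl (delta ^+ 2))// Rint_cst -/(m i).
  have := sqr_ge0 (m i); lra.
pose U w := \sum_(i <- s) u i w; pose M := \sum_(i <- s) m i.
have iU : integ U by apply: integ_sum.
have EU : Ex U = M by rewrite /U Rint_sum.
have Yse w : U w - M = \sum_(i <- s) y i w by rewrite /U /M -sumrB.
have [iY2 EY2] := variance_sum my indy Ey0 y2 us.
have EY2' : Ex (fun w => (U w - M) ^+ 2) <= delta ^+ 2.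
  have -> : (fun w => (U w - M) ^+ 2) = fun w => (\sum_(i <- s) y i w) ^+ 2.
    by apply/funext => w; rewrite Yse.
  rewrite EY2; apply: (@le_trans _ _ (\sum_(i <- s) delta ^+ 2 * Ex (fun w => X i w ^+ 2))).
    by apply: ler_sum => i _; exact: Ey2.
  by rewrite -mulr_sumr; have := sqr_ge0 delta; nra.
have iUM2 : integ (fun w => (U w - M) ^+ 2).
  by under eq_fun do rewrite Yse.
have MB : 1 / 2 - kappa <= M.
  have h i : Ex (fun w => X i w ^+ 2) - Ex (fun w => `|X i w| ^+ 3) / (4 * delta) <= m i.
    rewrite -RintZr// -RintB//; last exact: integZr.
    apply: Rint_le => //; first by apply: integB => //; exact: integZr.
    by move=> w; exact: trunc_ge.
  have : \sum_(i <- s) (Ex (fun w => X i w ^+ 2) - Ex (fun w => `|X i w| ^+ 3) / (4 * delta)) <= M.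
    by apply: ler_sum => i _; exact: h.
  rewrite sumrB -mulr_suml.
  have : (\sum_(i <- s) Ex (fun w => `|X i w| ^+ 3)) / (4 * delta) <= 1 / 2.
    by rewrite ler_pdivrMr ?mulr_gt0// /delta; lra.
  lra.
have mF : measurable_fun setT (F l delta).
  apply: measurable_funB => //; apply: measurable_funB.
    by apply: (measurableT_comp mK); do 2 apply: measurable_funD => //.
  by apply: (measurableT_comp mK); exact: measurable_funB.
have Fc v := @F_le l delta v l0 d0'.
have [iXF EVF] := Rint_mul_sum_fun mX indX EX0 X2 us mF Fc.
have iuD i : integ (fun w => u i w * D w).
  apply: (integ_le _ _ (iu i)); first by apply: measurable_funM => //; exact: mu.
  by move=> w; rewrite ger0_norm; [exact: ler_piMr|exact: mulr_ge0].
have low : Ex (fun w => U w * D w) <= Ex (fun w => S s w * F l delta (S s w)).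
  have -> : (fun w => U w * D w) = fun w => \sum_(i <- s) u i w * D w.
    by apply/funext => w; rewrite /U mulr_suml.
  rewrite EVF Rint_sum//; apply: ler_sum => i _.
  by apply: Rint_le => // w; exact: mul_F_ge.
have [iS2 ES2] := variance_sum mX indX EX0 X2 us.
have iS : integ (S s) by apply: integ_sum.
have upp : Ex (fun w => S s w * F l delta (S s w)) <= (l + 2 * delta) / 2.
  have i1 : integ (fun w => (1 + S s w ^+ 2) * ((l + 2 * delta) / 4)).
    by apply: integZr; apply: integD => //; exact: integ_cst.
  have i2 : integ (fun w => S s w * F l delta (S s w)).
    apply: (integ_le _ _ (integZl ((l + 2 * delta) / 2) (integ_norm iS))).
      by apply: measurable_funM => //; exact: measurableT_comp.
    by move=> w; rewrite normrM mulrC ler_wpM2r.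
  apply: (@le_trans _ _ (Ex (fun w => (1 + S s w ^+ 2) * ((l + 2 * delta) / 4)))).
    apply: Rint_le => // w; apply: (le_trans (ler_norm _)); rewrite normrM.
    have h (a b : R) : 0 <= a -> b <= (l + 2 * delta) / 2 ->
        a * b <= (1 + a ^+ 2) * ((l + 2 * delta) / 4).
      move=> a0 bl; have := ler_wpM2l a0 bl.
      have : 0 <= (a - 1) ^+ 2 * ((l + 2 * delta) / 4).
        by rewrite mulr_ge0 ?sqr_ge0//; lra.
      lra.
    rewrite -(real_normK (num_real (S s w))); exact: h.
  rewrite RintZr; last by apply: integD => //; exact: integ_cst.
  rewrite RintD//; last exact: integ_cst.
  rewrite Rint_cst ES2.
  have : 0 <= (l + 2 * delta) / 4 by lra.
  nra.
(* [U] is replaced by its mean. As 0 <= D <= 1, the price is E|U - M| <= (delta^2 + Var U) / (2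
   delta) <= delta. *)
have dec : M * Ex D - delta <= Ex (fun w => U w * D w).
  have i3 : integ (fun w => (delta ^+ 2 + (U w - M) ^+ 2) * (2 * delta)^-1).
    by apply: integZr; apply: integD => //; exact: integ_cst.
  have i4 : integ (fun w => M * D w - (delta ^+ 2 + (U w - M) ^+ 2) * (2 * delta)^-1).
    by apply: integB => //; exact: integZl.
  have i5 : integ (fun w => U w * D w).
    by under eq_fun do rewrite /U mulr_suml; apply: integ_sum.
  apply: (@le_trans _ _ (Ex (fun w => M * D w - (delta ^+ 2 + (U w - M) ^+ 2) * (2 * delta)^-1))).
    have iMD : integ (fun w => M * D w) by exact: integZl.
    rewrite (RintB iMD i3) (RintZl M iD) RintZr; last by apply: integD => //; exact: integ_cst.
    rewrite (RintD (integ_cst P (delta ^+ 2)) iUM2).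
    rewrite Rint_cst lerD2l lerN2 ler_pdivrMr ?mulr_gt0//.
    move: EY2'; rewrite expr2; lra.
  apply: Rint_le => // w; rewrite lerBlDr.
  have h : `|U w - M| <= (delta ^+ 2 + (U w - M) ^+ 2) * (2 * delta)^-1.
    rewrite ler_pdivlMr ?mulr_gt0// -(real_normK (num_real (U w - M))).
    have := sqr_ge0 (`|U w - M| - delta); lra.
  apply: (@le_trans _ _ (U w * D w + `|U w - M|)); last by rewrite lerD2l.
  have := ler_norm (- (U w - M)); rewrite normrN; have := normr_ge0 (U w - M).
  have := D0 w; have := D1 w; nra.
have ED0 : 0 <= Ex D by exact: Rint_ge0.
rewrite ler_pdivlMr; last lra.
have : (1 / 2 - kappa) * Ex D <= M * Ex D by rewrite ler_wpM2r.
rewrite -/(D _) /delta in upp dec low *; lra.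
Qed.

End smoothed_concentration.
End concentration.

Section stein_bound.
Context {d} {T : measurableType d} {R : realType} (P : probability T R).
Local Notation Ex f := (Rintegral P setT f).
Local Notation integ f := (P.-integrable setT (EFin \o f)).
Variables (I : eqType) (X : I -> T -> R).
Hypotheses (mX : forall i, measurable_fun setT (X i))
  (indX : mutually_independent P X)
  (EX0 : forall i, Ex (X i) = 0)
  (X2 : forall i, integ (fun w => X i w ^+ 2))
  (X3 : forall i, integ (fun w => `|X i w| ^+ 3)).
Local Notation S s := (fun w => \sum_(i <- s) X i w).
Local Notation A := (@mills_scaled R 0).

(** With m = E|Y|, take the expectation of (|Y| - m)^2 (|Y| + m) >= 0. *)
Lemma Rint_sqr_mul_abs_le (Y : T -> R) : measurable_fun setT Y ->
  integ (fun w => Y w ^+ 2) -> integ (fun w => `|Y w| ^+ 3) ->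
  Ex (fun w => Y w ^+ 2) * Ex (fun w => `|Y w|) <= Ex (fun w => `|Y w| ^+ 3).
Proof.
move=> mY Y2 Y3; have Y1 := integ_norm (integ_of_sqr mY Y2).
set m := Ex (fun w => `|Y w|).
have i1 : integ (fun w => m * Y w ^+ 2) by exact: integZl.
have i2 : integ (fun w => `|Y w| ^+ 3 - m * Y w ^+ 2) by exact: integB.
have i3 : integ (fun w => m ^+ 2 * `|Y w|) by exact: integZl.
have i4 : integ (fun w => m ^+ 3 - m ^+ 2 * `|Y w|) by apply: integB => //; exact: integ_cst.
have i5 : integ (fun w => `|Y w| ^+ 3 - m * Y w ^+ 2 + (m ^+ 3 - m ^+ 2 * `|Y w|)) by exact: integD.
have m0 : 0 <= m by exact: Rint_ge0.
have : 0 <= Ex (fun w => `|Y w| ^+ 3 - m * Y w ^+ 2 + (m ^+ 3 - m ^+ 2 * `|Y w|)).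
  apply: Rint_ge0 => w; rewrite -(real_normK (num_real (Y w))).
  have : 0 <= (`|Y w| - m) ^+ 2 * (`|Y w| + m) by rewrite mulr_ge0 ?sqr_ge0 ?addr_ge0.
  lra.
rewrite (RintD i2 i4) (RintB Y3 i1) (RintZl m Y2) (RintB (integ_cst P (m ^+ 3)) i3).
rewrite Rint_cst (RintZl (m ^+ 2) Y1) -/m; lra.
Qed.

Variables (a : R) (s : seq I) (kappa B : R).
Hypotheses (a0 : 0 <= a) (us : uniq s) (B0 : 0 < B) (kap : kappa < 1 / 2)
  (var_le : forall i, i \in s -> Ex (fun w => X i w ^+ 2) <= kappa)
  (var_sum : \sum_(i <- s) Ex (fun w => X i w ^+ 2) = 1)
  (third_le : \sum_(i <- s) Ex (fun w => `|X i w| ^+ 3) <= B).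

Let alpha := (1 - 2 * kappa)^-1.
Let alpha0 : 0 < alpha. Proof. by have := kap; rewrite invr_gt0; lra. Qed.
Local Notation f := (stein_fun a).
Local Notation f' := (stein_fun' a).

Let mS t : measurable_fun setT (S t). Proof. exact: measurable_sum. Qed.
Let X1 i : integ (X i). Proof. exact: integ_of_sqr. Qed.
Let S1 t : integ (S t). Proof. by apply: integ_sum. Qed.

Let mf' : measurable_fun setT f'.
Proof.
apply: measurable_funB => //; apply: measurable_funD; last exact: measurable_tilted_tail.
by apply: measurable_funM => //; exact: measurable_stein_fun.
Qed.

Let f'_le w : `|f' w| <= 2 * A * `|w| + 2.
Proof.
have h1 := stein_fun_le a0 w.
have h2 : `|tilted_tail a w| <= 1.
  have := exp_down01 a0 w; have := step_down01 w; rewrite tilted_tailE ler_norml; lra.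
have h3 : `|Mills a| <= 1.
  have N0 := @mills_scaled_ge0 R a.
  have N1 : mills_scaled a <= A by exact: mills_scaled_nincr.
  have N2 := @mills_scaled0_ge1 R.
  have A2 : 0 <= 2 * A by lra.
  rewrite Mills_scaledE ger0_norm; last exact: divr_ge0.
  by rewrite ler_pdivrMr; lra.
rewrite /stein_fun'; apply: (le_trans (ler_normB _ _)).
have := ler_normD (w * f w) (tilted_tail a w); rewrite normrM.
have : `|w| * `|f w| <= `|w| * (2 * A) by rewrite ler_wpM2l.
lra.
Qed.

(** V omits summand j, so its variance is still at least 1 - kappa, and both monotone pieces obey
    the concentration inequality on a window of length at most |y| + |t|. The weights of the pieces
    add up to |y|, which multiplies the cost alpha (|y| + |t| + 2 B) only once. *)
Let conc j (y t : R) : j \in s -> 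
  `|y * Ex (fun w => f' (S (rem j s) w + t)) -
    Ex (fun w => f (S (rem j s) w + y) - f (S (rem j s) w))| <=
  `|y| * ((A + alpha) * (`|y| + `|t|) + 2 * alpha * B).
Proof.
move=> js; set V := S (rem j s).
have mV : measurable_fun setT V by exact: mS.
have urem : uniq (rem j s) by exact: rem_uniq.
have varV : 1 - kappa <= \sum_(i <- rem j s) Ex (fun w => X i w ^+ 2) <= 1.
  move: var_sum; rewrite (big_rem j)//= => e.
  have := var_le js; have : 0 <= Ex (fun w => X j w ^+ 2) by apply: Rint_ge0 => w; exact: sqr_ge0.
  lra.
have thirdV : \sum_(i <- rem j s) Ex (fun w => `|X i w| ^+ 3) <= B.
  move: third_le; rewrite (big_rem j)//= => e.
  have : 0 <= Ex (fun w => `|X j w| ^+ 3) by apply: Rint_ge0 => w; exact: exprn_ge0.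
  lra.
have C (K k : R -> R) (lo hi : R) : supergradient K k -> measurable_fun setT K -> measurable_fun setT k ->
    (forall v, 0 <= k v <= 1) -> lo <= hi <= lo + (`|y| + `|t|) ->
    integ (fun w => k (V w + lo) - k (V w + hi)) /\
    Ex (fun w => k (V w + lo) - k (V w + hi)) <= alpha * (`|y| + `|t| + 2 * B).
  move=> Kk mK mk k01 /andP[lohi hilo].
  have mks (c : R) : measurable_fun setT (fun v : R => k (v + c)).
    by apply: (measurableT_comp mk); exact: measurable_funD.
  split.
    apply: (@integ_bounded _ _ _ _ _ 1).
      by apply: measurable_funB;
        [exact: (measurableT_comp (mks lo) mV)|exact: (measurableT_comp (mks hi) mV)].
    by move=> w; have := k01 (V w + lo); have := k01 (V w + hi); rewrite ler_norml; lra.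
  have Kk' : supergradient (fun v : R => K (v + lo)) (fun v : R => k (v + lo)).
    by move=> u v; have := Kk (u + lo) (v + lo); rewrite opprD addrACA subrr addr0.
  have mK' : measurable_fun setT (fun v : R => K (v + lo)).
    by apply: (measurableT_comp mK); exact: measurable_funD.
  have := smoothed_concentration mX indX EX0 X2 X3 Kk' mK' (mks lo) (fun v => k01 (v + lo)) urem
    (_ : 0 <= hi - lo) B0 kap varV thirdV; rewrite subr_ge0 lohi => /(_ isT).
  have e : (fun w => k (V w + lo) - k (V w + (hi - lo) + lo)) = fun w => k (V w + lo) - k (V w + hi).
    by apply/funext => w; rewrite -addrA subrK.
  rewrite -/V e => h; apply: (le_trans h).
  rewrite mulrC ler_pM2l//; lra.
have [c1 [c2 [c10 c20 c12 [lo [hi [lohi H]]]]]] := stein_fun_taylor a0 y t.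
have mKe : measurable_fun setT (@exp_down_prim R a).
  apply: measurable_fun_ifT => //; first exact: measurable_fun_ler.
  case: eqP => // _; apply: measurable_funM => //; apply: measurable_funB => //.
  by apply: measurableT_comp => //; exact: measurable_funM.
have mKs : measurable_fun setT (@step_down_prim R) by exact: measurable_minr.
have [ie Ce] := C _ _ lo hi (exp_down_supergradient a0) mKe (@measurable_exp_down _ a) (exp_down01 a0) lohi.
have [is_ Cs] := C _ _ lo hi (@step_down_supergradient R) mKs
  (@measurable_step_down R) (@step_down01 R) lohi.
have if' : integ (fun w => f' (V w + t)).
  apply: (@integ_le _ _ _ _ _ (fun w => 2 * A * (`|V w| + `|t|) + 2)).
  - by apply: (measurableT_comp mf'); exact: measurable_funD.
  - move=> w; apply: (le_trans (f'_le _)); rewrite lerD2r ler_wpM2l ?ler_normD//.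
    by rewrite mulr_ge0// mills_scaled_ge0.
  - apply: integD; last exact: integ_cst.
    have iVn := integ_norm (S1 (rem j s)).
    exact: (integZl (2 * A) (integD iVn (integ_cst P `|t|))).
have mf := measurable_stein_fun a.
have if_ : integ (fun w => f (V w + y) - f (V w)).
  apply: (@integ_bounded _ _ _ _ _ (2 * A + 2 * A)).
    by apply: measurable_funB; apply: (measurableT_comp mf) => //; exact: measurable_funD.
  by move=> w; apply: (le_trans (ler_normB _ _)); apply: lerD; exact: stein_fun_le.
set E := y * _ - _; have EE : E = Ex (fun w => y * f' (V w + t) - (f (V w + y) - f (V w))).
  by rewrite (RintB (integZl y if') if_) (RintZl y if').
have iE : integ (fun w => y * f' (V w + t) - (f (V w + y) - f (V w))).
  by apply: integB => //; exact: integZl.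
set b := A * (`|y| + `|t|) * `|y| in H.
set De := fun w => exp_down a (V w + lo) - exp_down a (V w + hi) in ie Ce.
set Ds := fun w => step_down (V w + lo) - step_down (V w + hi) in is_ Cs.
have comb (p q : R) : integ (fun w => b + (p * De w + q * Ds w)) /\
    Ex (fun w => b + (p * De w + q * Ds w)) = b + (p * Ex De + q * Ex Ds).
  have i1 := integZl p ie; have i2 := integZl q is_; have i3 := integD i1 i2.
  split; first by apply: integD => //; exact: integ_cst.
  by rewrite (RintD (integ_cst P b) i3) Rint_cst (RintD i1 i2) (RintZl p ie) (RintZl q is_).
have fin (p q : R) : 0 <= p -> 0 <= q -> p + q = `|y| ->
    b + (p * Ex De + q * Ex Ds) <= `|y| * ((A + alpha) * (`|y| + `|t|) + 2 * alpha * B).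
  move=> p0 q0 pq; have := ler_wpM2l p0 Ce; have := ler_wpM2l q0 Cs.
  by rewrite /b -pq; lra.
rewrite ler_norml EE; apply/andP; split.
  rewrite lerNl; apply: le_trans (fin c2 c1 c20 c10 _); last by rewrite addrC.
  have [ic <-] := comb c2 c1.
  rewrite -mulN1r -RintZl//; apply: Rint_le => //; first exact: integZl.
  by move=> w; rewrite mulN1r; have [_] := H (V w).
apply: le_trans (fin c1 c2 c10 c20 c12).
have [ic <-] := comb c1 c2.
by apply: Rint_le => // w; have [] := H (V w).
Qed.

(** By the Stein equation the left side is |E f'(S) - E S f(S)|. Summand j contributes E X_j^2 E
    f'(S) - E X_j (f(S) - f(S - X_j)); averaging [conc] over y = X_j and an independent copy t
    bounds this by 2 (A + alpha) E|X_j|^3 + 2 alpha B E X_j^2. Summation over j gives 2 (A + alpha)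
    + 2 alpha times B. *)
Lemma stein_bound :
  `|Ex (fun w => tilted_tail a (S s w)) - Mills a| <=
  (2 * A + 4 / (1 - 2 * kappa)) * B.
Proof.
have mf := measurable_stein_fun a.
have [iXf ESf] := Rint_mul_sum_fun mX indX EX0 X2 us mf (stein_fun_le a0).
have if' t (c : R) : integ (fun w => f' (S t w + c)).
  apply: (@integ_le _ _ _ _ _ (fun w => 2 * A * (`|S t w| + `|c|) + 2)).
  - by apply: (measurableT_comp mf'); exact: measurable_funD.
  - move=> w; apply: (le_trans (f'_le _)); rewrite lerD2r ler_wpM2l ?ler_normD//.
    by rewrite mulr_ge0// mills_scaled_ge0.
  - apply: integD; last exact: integ_cst.
    exact: (integZl (2 * A) (integD (integ_norm (S1 t)) (integ_cst P `|c|))).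
have if'0 : integ (fun w => f' (S s w)).
  by have := if' s 0; under eq_fun do rewrite addr0.
have iSf : integ (fun w => S s w * f (S s w)).
  apply: (integ_le _ _ (integZl (2 * A) (integ_norm (S1 s)))).
    by apply: measurable_funM => //; exact: (measurableT_comp mf).
  by move=> w; rewrite normrM mulrC ler_wpM2r// stein_fun_le.
set c := Ex (fun w => f' (S s w)).
have -> : Ex (fun w => tilted_tail a (S s w)) - Mills a = c - Ex (fun w => S s w * f (S s w)).
  have ih : integ (fun w => tilted_tail a (S s w)).
    apply: (@integ_bounded _ _ _ P (fun w => tilted_tail a (S s w)) 1).
      exact: (measurableT_comp (measurable_tilted_tail a)).
    move=> w; have := exp_down01 a0 (S s w); have := step_down01 (S s w).
    by rewrite tilted_tailE ler_norml; lra.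
  rewrite -[in LHS](Rint_cst P (Mills a)) -(RintB ih (integ_cst P (Mills a))) -(RintB if'0 iSf).
  by apply: eq_Rintegral => w _; rewrite /stein_fun'; ring.
rewrite ESf -[c]mul1r -var_sum mulr_suml -sumrB.
pose C := A + alpha; have C0 : 0 <= C by rewrite addr_ge0 ?mills_scaled_ge0// ltW.
pose v j := Ex (fun w => X j w ^+ 2); pose t3 j := Ex (fun w => `|X j w| ^+ 3).
suff key j : j \in s -> `|v j * c - Ex (fun w => X j w * (f (S s w) - f (S s w - X j w)))| <=
    C * (2 * t3 j) + 2 * alpha * B * v j.
  apply: (le_trans (ler_norm_sum _ _ _)).
  apply: (@le_trans _ _ (\sum_(j <- s) (C * (2 * t3 j) + 2 * alpha * B * v j))).
    by rewrite big_seq [leRHS]big_seq; apply: ler_sum => j js; exact: key.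
  rewrite big_split/= -mulr_sumr -mulr_sumr -mulr_sumr var_sum mulr1.
  have := ler_wpM2l C0 third_le; rewrite /C -/alpha; lra.
move=> js; set V := S (rem j s).
have mV : measurable_fun setT V by exact: mS.
have iV : integ V by exact: S1.
have SE w : S s w = V w + X j w by rewrite (big_rem j)//= addrC.
have ind : independent_pair P (X j) V.
  apply: (mutually_independent_sum mX indX); first exact: rem_uniq.
  by rewrite mem_rem_uniq// inE eqxx.
pose theta (y : R) := Ex (fun w => f (V w + y) - f (V w)).
have ibf (y : R) : integ (fun w => f (V w + y) - f (V w)).
  apply: (@integ_bounded _ _ _ P (fun w => f (V w + y) - f (V w)) (2 * A + 2 * A)).
    by apply: measurable_funB; apply: (measurableT_comp mf) => //; exact: measurable_funD.
  by move=> w; apply: (le_trans (ler_normB _ _)); apply: lerD; exact: stein_fun_le.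
(* [c] averages [y |-> E f'(V + y)] over the law of [X j] *)
have mF1 : measurable_fun setT (fun z : R * R => f' (z.2 + z.1)).
  by apply: (measurableT_comp mf'); exact: measurable_funD.
have i1 : integ (fun w => f' (V w + X j w)).
  by under eq_fun do rewrite -SE.
have [ipsi Epsi] := independent_pair_Fubini (mX j) mV ind mF1 i1 (fun y => if' (rem j s) y).
rewrite /= in ipsi Epsi.
have cE : c = Ex (fun w => Ex (fun w' => f' (V w' + X j w))).
  by rewrite -Epsi; apply: eq_Rintegral => w _; rewrite SE.
have mF2 : measurable_fun setT (fun z : R * R => z.1 * (f (z.2 + z.1) - f z.2)).
  apply: measurable_funM => //; apply: measurable_funB; apply: (measurableT_comp mf) => //.
  exact: measurable_funD.
have e2 : (fun w => X j w * (f (S s w) - f (S s w - X j w))) =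
    fun w => X j w * (f (V w + X j w) - f (V w)).
  by apply/funext => w; rewrite SE addrK.
have i2 := iXf j; rewrite e2 in i2 *.
have [ith Eth] := independent_pair_Fubini (mX j) mV ind mF2 i2 (fun y => integZl y (ibf y)).
rewrite /= in ith Eth.
have e3 : (fun w => Ex (fun w' => X j w * (f (V w' + X j w) - f (V w')))) =
    fun w => X j w * theta (X j w).
  by apply/funext => w; rewrite (RintZl (X j w) (ibf (X j w))).
rewrite e3 in ith Eth; rewrite Eth.
pose n1 := Ex (fun w => `|X j w|).
have iX1 := integ_norm (X1 j).
have dev (y : R) : `|y * c - theta y| <= `|y| * (C * (`|y| + n1) + 2 * alpha * B).
  have ip : integ (fun w => y * Ex (fun w' => f' (V w' + X j w)) - theta y).
    by apply: integB; [exact: integZl|exact: integ_cst].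
  have -> : y * c - theta y = Ex (fun w => y * Ex (fun w' => f' (V w' + X j w)) - theta y).
    by rewrite (RintB (integZl y ipsi) (integ_cst P (theta y))) Rint_cst (RintZl y ipsi) cE.
  have iq : integ (fun w => `|y| * (C * (`|y| + `|X j w|) + 2 * alpha * B)).
    apply: integZl; apply: integD; last exact: integ_cst.
    exact: (integZl C (integD (integ_cst P `|y|) iX1)).
  apply: (le_trans (Rint_norm_le ip iq (fun w => conc _ _ js))).
  have i5 := integD (integ_cst P `|y|) iX1.
  have i6 := integD (integZl C i5) (integ_cst P (2 * alpha * B)).
  by rewrite (RintZl `|y| i6) (RintD (integZl C i5) (integ_cst P (2 * alpha * B)))
    (RintZl C i5) (RintD (integ_cst P `|y|) iX1) !Rint_cst.
have -> : v j * c - Ex (fun w => X j w * theta (X j w)) =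
    Ex (fun w => X j w * (X j w * c - theta (X j w))).
  rewrite -(RintZr c (X2 j)) -(RintB (integZr c (X2 j)) ith).
  by apply: eq_Rintegral => w _; ring.
have i7 : integ (fun w => X j w * (X j w * c - theta (X j w))).
  have := integB (integZr c (X2 j)) ith.
  by apply: eq_integrable => // w _; rewrite /=; congr _%:E; ring.
have i8 : integ (fun w => C * `|X j w| ^+ 3 + (C * n1 + 2 * alpha * B) * X j w ^+ 2).
  by apply: integD; exact: integZl.
have le7 w : `|X j w * (X j w * c - theta (X j w))| <=
    C * `|X j w| ^+ 3 + (C * n1 + 2 * alpha * B) * X j w ^+ 2.
  rewrite normrM -(real_normK (num_real (X j w))).
  by have := ler_wpM2l (normr_ge0 (X j w)) (dev (X j w)); lra.
apply: (le_trans (Rint_norm_le i7 i8 le7)).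
rewrite (RintD (integZl C (X3 j)) (integZl (C * n1 + 2 * alpha * B) (X2 j))).
rewrite (RintZl C (X3 j)) (RintZl _ (X2 j)) -/(v j) -/(t3 j).
have := ler_wpM2l C0 (Rint_sqr_mul_abs_le (mX j) (X2 j) (X3 j)).
rewrite -/n1 -/(v j) -/(t3 j); lra.
Qed.

End stein_bound.

(** * Exponential tilting *)

Section tilted_measure.
Context {d} {T : measurableType d} {R : realType} (P : probability T R).
Local Notation Ex f := (Rintegral P setT f).
Local Notation integ f := (P.-integrable setT (EFin \o f)).
Variable D : T -> R.
Hypotheses (D0 : forall w, 0 <= D w) (iD : integ D) (ED : Ex D = 1).

Definition tilt (A : set T) : \bar R := (\int[P]_(w in A) (D w)%:E)%E.

Let tilt0 : tilt set0 = 0%E. Proof. exact: integral_set0. Qed.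

Let tilt_ge0 A : (0 <= tilt A)%E.
Proof. by apply: integral_ge0 => w _; rewrite lee_fin. Qed.

Let tilt_sigma_additive : semi_sigma_additive tilt.
Proof.
move=> A mA tA mUA; rewrite /tilt integral_bigcup//; last first.
  by apply: (integrableS _ _ (subsetT _)).
apply: is_cvg_ereal_nneg_natsum_cond => n _ _.
by apply: integral_ge0 => w _; rewrite lee_fin.
Qed.

HB.instance Definition _ := isMeasure.Build _ _ _ tilt tilt0 tilt_ge0 tilt_sigma_additive.

Let tilt_setT : tilt setT = 1%E.
Proof. by rewrite /tilt -EFin_Rint// ED. Qed.

HB.instance Definition _ := @Measure_isProbability.Build _ _ R tilt tilt_setT.

Definition tilted_prob : probability T R := tilt.

Let mD : measurable_fun setT D. Proof. exact: (integ_measurable iD). Qed.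

(** [D] agrees almost everywhere with the Radon-Nikodym derivative of the tilted law, so the change
    of variables for that derivative carries over. *)
Lemma ge0_integral_tilt (f : T -> \bar R) : measurable_fun setT f ->
  (forall w, 0 <= f w)%E ->
  (\int[tilted_prob]_w f w = \int[P]_w (f w * (D w)%:E))%E.
Proof.
move=> mf f0.
have dom : tilted_prob `<< P.
  apply/null_content_dominatesP => A mA PA0.
  by apply: null_set_integral => //; apply/measurable_EFinP; exact: (measurable_funTS mD).
rewrite -(Radon_Nikodym_SigmaFinite.change_of_variables dom)//.
have iRN := Radon_Nikodym_SigmaFinite.f_integrable dom.
apply: ge0_ae_eq_integral => //.
- by apply: emeasurable_funM => //; exact: measurable_int iRN.
- by apply: emeasurable_funM => //; exact/measurable_EFinP.
- by move=> w _; rewrite mule_ge0//; exact: Radon_Nikodym_SigmaFinite.f_ge0.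
- by move=> w _; rewrite mule_ge0// lee_fin.
have : ae_eq P setT (Radon_Nikodym_SigmaFinite.f tilted_prob P) (EFin \o D).
  apply: integral_ae_eq => //; first exact/measurable_EFinP.
  by move=> A _ mA; rewrite -Radon_Nikodym_SigmaFinite.f_integral.
by apply: filterS => w /= h wT; rewrite h.
Qed.

Lemma integ_tilt (f : T -> R) : measurable_fun setT f ->
  tilted_prob.-integrable setT (EFin \o f) <-> integ (fun w => f w * D w).
Proof.
move=> mf.
have mfD : measurable_fun setT (EFin \o (fun w => f w * D w)).
  by apply/measurable_EFinP; exact: measurable_funM.
have e : (\int[tilted_prob]_w `|(EFin \o f) w| = \int[P]_w `|(f w * D w)%R%:E|)%E.
  rewrite ge0_integral_tilt//.
    by apply: eq_integral => w _; rewrite /= -EFinM normrM (ger0_norm (D0 w)).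
  by apply: measurableT_comp => //; exact/measurable_EFinP.
split=> /integrableP[_ fi]; apply/integrableP; split => //.
- by rewrite -e.
- exact/measurable_EFinP.
- by rewrite e.
Qed.

Lemma Rint_tilt (f : T -> R) : measurable_fun setT f ->
  Rintegral tilted_prob setT f = Ex (fun w => f w * D w).
Proof.
move=> mf; rewrite /Rintegral; congr fine.
have mf' : measurable_fun setT (EFin \o f) by exact/measurable_EFinP.
rewrite integralE [RHS]integralE; congr (_ - _)%E.
  rewrite ge0_integral_tilt//; last exact: measurable_funepos.
  by apply: eq_integral => w _; rewrite !funeposE/= -!EFin_max -EFinM maxr_pMl// mul0r.
rewrite ge0_integral_tilt//; last exact: measurable_funeneg.
by apply: eq_integral => w _; rewrite !funenegE/= -!EFin_max -EFinM maxr_pMl// mul0r mulNr.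
Qed.

End tilted_measure.

Section tilted_family.
Context {d} {T : measurableType d} {R : realType} (P : probability T R).
Local Notation Ex f := (Rintegral P setT f).
Local Notation integ f := (P.-integrable setT (EFin \o f)).
Variables (I : finType) (X : I -> T -> R).
Hypotheses (mX : forall i, measurable_fun setT (X i)) (indX : mutually_independent P X).

Lemma Rint_prod (h : I -> R -> R) (s : seq I) : uniq s ->
  (forall i, measurable_fun setT (h i)) -> (forall i, integ (h i \o X i)) ->
  integ (fun w => \prod_(i <- s) h i (X i w)) /\
  Ex (fun w => \prod_(i <- s) h i (X i w)) = \prod_(i <- s) Ex (h i \o X i).
Proof.
move=> us mh ih; elim: s us => [_|a s IH /= /andP[as_ us]].
  under eq_fun do rewrite big_nil.
  by rewrite big_nil Rint_cst; split => //; exact: integ_cst.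
have [is_ Es] := IH us.
have mhX i : measurable_fun setT (h i \o X i) by exact: measurableT_comp.
have ind := mutually_independent_prod mhX (mutually_independent_comp indX mh) us as_.
have mprod : measurable_fun setT (fun w => \prod_(i <- s) h i (X i w)).
  exact: (integ_measurable is_).
have [i1 e1] := independent_pair_RintM (mhX a) mprod ind (@measurable_id _ R setT)
  (@measurable_id _ R setT) (ih a) is_.
under eq_fun do rewrite big_cons.
split => //; rewrite big_cons -Es; exact: e1.
Qed.

Variable g : I -> R -> R.
Hypotheses (mg : forall i, measurable_fun setT (g i)) (g0 : forall i x, 0 <= g i x)
  (ig : forall i, integ (g i \o X i)) (Eg : forall i, Ex (g i \o X i) = 1).

Definition density w := \prod_i g i (X i w).

Let density_ge0 w : 0 <= density w.
Proof. by apply: prodr_ge0 => i _. Qed.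

Let uI : uniq (index_enum I). Proof. exact: index_enum_uniq. Qed.

Let integ_density : integ density.
Proof. by have [] := Rint_prod uI mg ig. Qed.

Let Rint_density : Ex density = 1.
Proof. by have [_ ->] := Rint_prod uI mg ig; apply: big1 => i _. Qed.

Definition tilted_family_prob : probability T R :=
  tilted_prob density_ge0 integ_density Rint_density.
Local Notation Q := tilted_family_prob.

(** The density has one factor per variable, and by independence under P all factors except that of
    [j] integrate to 1: the tilted law of [X j] depends on [g j] alone. *)
Lemma integ_tilted (phi : R -> R) j : measurable_fun setT phi ->
  integ (fun w => phi (X j w) * g j (X j w)) ->
  Q.-integrable setT (EFin \o (phi \o X j)) /\
  Rintegral Q setT (phi \o X j) = Ex (fun w => phi (X j w) * g j (X j w)).
Proof.
move=> mphi ip; have mpX : measurable_fun setT (phi \o X j) by exact: measurableT_comp.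
pose h i x := if i == j then phi x * g i x else g i x.
have mh i : measurable_fun setT (h i).
  by rewrite /h; case: eqP => // _; exact: measurable_funM.
have ih i : integ (h i \o X i).
  rewrite /h; case: eqP => [->|_]; last exact: ig.
  exact: ip.
have e w : phi (X j w) * density w = \prod_i h i (X i w).
  rewrite /density (bigD1 j)//= (bigD1 j _ (F := fun i => h i (X i w)))//=.
  rewrite mulrA /h eqxx; congr (_ * _); apply: eq_bigr => i ij.
  by rewrite (negbTE ij).
have [i1 e1] := Rint_prod uI mh ih.
have EQ : (fun w => (phi \o X j) w * density w) = fun w => \prod_i h i (X i w).
  by apply/funext => w; exact: e.
split; first by apply/integ_tilt => //; rewrite EQ.
rewrite Rint_tilt// EQ e1 (bigD1 j)//= big1 ?mulr1.
  by apply: eq_Rintegral => w _; rewrite /h /= eqxx.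
by move=> i ij; rewrite /h (negbTE ij); exact: Eg.
Qed.

Let tilt_event (s : seq I) (B : I -> set R) : uniq s -> (forall i, measurable (B i)) ->
  Q (\big[setI/setT]_(i <- s) (X i @^-1` B i)) =
  (\prod_(i <- s) Ex (fun w => \1_(B i) (X i w) * g i (X i w)))%:E.
Proof.
move=> us mB; set E := \big[_/_]_(i <- s) _.
have mE : measurable E by apply: bigsetI_measurable => i _; exact: measurable_event.
pose h i x := if i \in s then \1_(B i) x * g i x else g i x.
have mh i : measurable_fun setT (h i).
  by rewrite /h; case: (i \in s) => //; exact: measurable_funM.
have ih1 i : integ (fun w => \1_(B i) (X i w) * g i (X i w)).
  apply: (@integ_le _ _ _ _ _ (g i \o X i)) => //.
    by apply: measurable_funM; apply: measurableT_comp.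
  move=> w; rewrite normrM (ger0_norm (g0 _ _)) ler_piMl// indicE.
  by case: (_ \in _); rewrite ?normr1 ?normr0.
have ih i : integ (h i \o X i).
  by rewrite /h; case: (i \in s); [exact: ih1|exact: ig].
have [i1 e1] := Rint_prod uI mh ih.
have e w : \1_E w * density w = \prod_i h i (X i w).
  have -> : \1_E w = \prod_(i <- s) \1_(B i) (X i w) :> R.
    rewrite /E; elim: (s) => [|a t IHt]; first by rewrite !big_nil indicT.
    rewrite !big_cons indicI /= IHt; congr (_ * _); rewrite !indicE; congr (_ _).
  have -> : density w = (\prod_(i in s) g i (X i w)) * \prod_(i | i \notin s) g i (X i w).
    exact: (bigID (mem s)).
  rewrite [RHS](bigID (mem s))/= mulrA; congr (_ * _); last first.
    by apply: eq_bigr => i /negbTE is_; rewrite /h is_.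
  rewrite [X in X * _]big_uniq//= -big_split/=.
  by apply: eq_bigr => i is_; rewrite /h is_.
have -> : Q E = (Ex (fun w => \1_E w * density w))%:E.
  rewrite EFin_Rint; last by under eq_fun do rewrite e.
  rewrite -[LHS]/(\int[P]_(w in E) (density w)%:E)%E integral_mkcond.
  apply: eq_integral => w _; rewrite /patch indicE.
  by case: (w \in E); rewrite ?mul1r ?mul0r.
under eq_fun do rewrite e.
rewrite e1 (bigID (mem s))/= [X in _ * X]big1 ?mulr1; last first.
  by move=> i /negbTE is_; rewrite /h is_; exact: Eg.
congr _%:E; rewrite [RHS]big_uniq//=; apply: eq_bigr => i is_.
by apply: eq_Rintegral => w _; rewrite /h /= is_.
Qed.

Lemma mutually_independent_tilted : mutually_independent Q X.
Proof.
move=> s B us mB; rewrite tilt_event// -prodEFin; apply: eq_bigr => i _.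
have := tilt_event (s := [:: i]) (B := B) isT mB.
by rewrite !big_seq1.
Qed.

End tilted_family.

(** * Moments under Bernstein's condition *)

Section binomial_series.
Context {R : realType}.

(** Partial sums of the negative binomial series. By Pascal's rule, multiplication by 1 - t turns
    the sum for j + 1 into the sum for j minus a nonnegative remainder. *)
Lemma sum_binomial_le (t : R) (j n : nat) : 0 <= t < 1 ->
  \sum_(k < n) 'C(k + j, j)%:R * t ^+ k <= (1 - t) ^- j.+1.
Proof.
move=> /andP[t0 t1]; have s0 : 0 < 1 - t by rewrite subr_gt0.
elim: j => [|j ih].
  rewrite expr1 -[leRHS]mul1r ler_pdivlMr// mulrC.
  have -> : \sum_(k < n) 'C(k + 0, 0)%:R * t ^+ k = \sum_(k < n) t ^+ k.
    by apply: eq_bigr => k _; rewrite addn0 bin0 mul1r.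
  by have := subrX1 t n; have := exprn_ge0 n t0; lra.
rewrite exprS invfM mulrC ler_pdivlMr// mulrC; apply: le_trans ih.
suff -> : (1 - t) * \sum_(k < n) 'C(k + j.+1, j.+1)%:R * t ^+ k =
    \sum_(k < n) 'C(k + j, j)%:R * t ^+ k - 'C(n + j, j.+1)%:R * t ^+ n.
  by rewrite gerBl mulr_ge0 ?exprn_ge0.
elim: n => [|n ihn]; first by rewrite !big_ord0 bin_small// mul0r subrr mulr0.
have e1 : 'C(n + j.+1, j.+1)%:R = 'C(n + j, j.+1)%:R + 'C(n + j, j)%:R :> R.
  by rewrite addnS binS natrD.
have e2 : 'C(n.+1 + j, j.+1)%:R = 'C(n + j, j.+1)%:R + 'C(n + j, j)%:R :> R.
  by rewrite addSn binS natrD.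
rewrite !big_ord_recr/= mulrDr ihn e1 e2 exprS; ring.
Qed.

Lemma fact_add_div (k j : nat) :
  (k + j)`!%:R / k`!%:R = j`!%:R * 'C(k + j, j)%:R :> R.
Proof.
have h := bin_fact (leq_addl k j); rewrite addnK in h.
rewrite -h !natrM; field.
by rewrite pnatr_eq0 -lt0n fact_gt0.
Qed.

Definition exp_partial (n : nat) (x : R) : R := \sum_(k < n) x ^+ k / k`!%:R.

Lemma cvg_exp_partial x : exp_partial n x @[n --> \oo] --> expR x.
Proof.
have -> : exp_partial ^~ x = series (exp_coeff x).
  by apply/funext => n; rewrite /exp_partial /series /= big_mkord.
exact: is_cvg_series_exp_coeff.
Qed.

Lemma exp_partial_norm_le n x : `|exp_partial n x| <= exp_partial n `|x|.
Proof.
apply: (le_trans (ler_norm_sum _ _ _)); apply: ler_sum => k _.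
by rewrite normrM normrX (ger0_norm (_ : 0 <= k`!%:R^-1))// invr_ge0.
Qed.

Lemma exp_partial_nondecr x m n : 0 <= x -> (m <= n)%N -> exp_partial m x <= exp_partial n x.
Proof.
move=> x0 mn; rewrite -(subnKC mn) /exp_partial big_split_ord/= lerDl.
by apply: sumr_ge0 => k _; rewrite divr_ge0 ?exprn_ge0.
Qed.

Lemma exp_partial_le n x : 0 <= x -> exp_partial n x <= expR x.
Proof.
move=> x0; have c := @cvg_exp_partial x.
rewrite -(cvg_lim _ c)//; apply: limr_ge; first by apply/cvg_ex; exists (expR x).
by near=> m; apply: exp_partial_nondecr => //; near: m; exact: nbhs_infty_ge.
Unshelve. all: by end_near. Qed.

End binomial_series.

Section bernstein_moments.
Context {d} {T : measurableType d} {R : realType} (P : probability T R).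
Local Notation Ex f := (Rintegral P setT f).
Local Notation integ f := (P.-integrable setT (EFin \o f)).

Lemma Rint_dominated_cvg (fn : nat -> T -> R) (f g : T -> R) :
  (forall n, measurable_fun setT (fn n)) -> integ f -> integ g ->
  (forall w, fn n w @[n --> \oo] --> f w) -> (forall n w, `|fn n w| <= g w) ->
  Ex (fn n) @[n --> \oo] --> Ex f.
Proof.
move=> mfn fi gi fnf fng.
have h := @dominated_cvg _ _ _ P setT measurableT (fun n => EFin \o fn n) (EFin \o f) (EFin \o g).
apply: fine_cvg; rewrite EFin_Rint//; apply: h => //.
- by move=> n; exact/measurable_EFinP.
- by move=> w _; apply: cvg_EFin; [near=> n|exact: fnf].
- by move=> n w _; rewrite /= lee_fin.
Unshelve. all: by end_near. Qed.

Variable Y : T -> R.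
Hypotheses (mY : measurable_fun setT Y) (iY : forall k, integ (fun w => Y w ^+ k))
  (EY0 : Ex Y = 0).
Let v := Ex (fun w => Y w ^+ 2).
Hypothesis mom : forall k : nat, (2 <= k)%N -> `|Ex (fun w => Y w ^+ k)| <= k`!%:R / 2 * v.

Let v0 : 0 <= v. Proof. by apply: Rint_ge0 => w; exact: sqr_ge0. Qed.

Let even_pow (k : nat) w : ~~ odd k -> `|Y w| ^+ k = Y w ^+ k.
Proof. by move=> ok; rewrite -normrX ger0_norm// exprn_even_ge0. Qed.

Let iYn k : integ (fun w => `|Y w| ^+ k).
Proof. by under eq_fun do rewrite -normrX; exact: (integ_norm (iY k)). Qed.

(** The hypothesis bounds signed moments, which do not control |Y|^k for odd k; there |Y|^k is at
    most the mean of its two even neighbours, at the price of a larger factorial. Only finiteness of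
    exponential moments is drawn from this bound, so the constant is crude. *)
Let abs_mom k : Ex (fun w => `|Y w| ^+ k) <= (1 + v) * k.+1`!%:R.
Proof.
have even_ (m : nat) : ~~ odd m -> Ex (fun w => `|Y w| ^+ m) <= (1 + v) * m`!%:R.
  move=> om; under eq_Rintegral do rewrite even_pow//.
  case: m om => [_|[//|m om]].
    under eq_Rintegral do rewrite expr0.
    by rewrite Rint_cst fact0 mulr1 lerDl.
  apply: (le_trans (ler_norm _)); apply: (le_trans (mom _)) => //.
  have := ler0n R m.+2`!; have := mulr_ge0 (ler0n R m.+2`!) v0; lra.
have f1 : (k`!%:R : R) <= k.+1`!%:R by rewrite ler_nat factS leq_pmull.
have [ok|ok] := boolP (odd k); last first.
  by apply: (le_trans (even_ _ ok)); rewrite ler_wpM2l// addr_ge0.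
case: k ok f1 => // k ok f1.
have i1 : integ (fun w => (`|Y w| ^+ k + `|Y w| ^+ k.+2) * 2^-1).
  by apply: integZr; exact: integD.
apply: (@le_trans _ _ (Ex (fun w => (`|Y w| ^+ k + `|Y w| ^+ k.+2) * 2^-1))).
  apply: Rint_le => // w; rewrite ler_pdivlMr// !exprS.
  have := exprn_ge0 k (normr_ge0 (Y w)); have := sqr_ge0 (`|Y w| - 1); nra.
rewrite (RintZr 2^-1 (integD (iYn k) (iYn k.+2))) (RintD (iYn k) (iYn k.+2)).
rewrite ler_pdivrMr//.
have h1 := even_ k ok; have h2 : Ex (fun w => `|Y w| ^+ k.+2) <= (1 + v) * k.+2`!%:R.
  by apply: even_; rewrite /= negbK.
have f2 : (k`!%:R : R) <= k.+2`!%:R.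
  by rewrite ler_nat (@leq_trans k.+1`!)// factS leq_pmull.
have : (1 + v) * k`!%:R <= (1 + v) * k.+2`!%:R by rewrite ler_wpM2l// addr_ge0.
lra.
Qed.

Variable t : R.
Hypothesis t01 : 0 <= t < 1.

Let partial_abs j n : integ (fun w => `|Y w| ^+ j * exp_partial n (t * `|Y w|)) /\
  Ex (fun w => `|Y w| ^+ j * exp_partial n (t * `|Y w|)) <=
  (1 + v) * j.+1`!%:R * (1 - t) ^- j.+2.
Proof.
have t0 : 0 <= t by case/andP: t01.
have e : (fun w => `|Y w| ^+ j * exp_partial n (t * `|Y w|)) =
    fun w => \sum_(k < n) (t ^+ k / k`!%:R) * `|Y w| ^+ (k + j).
  apply/funext => w; rewrite /exp_partial mulr_sumr; apply: eq_bigr => k _.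
  by rewrite exprMn exprD; ring.
have i1 (k : 'I_n) : integ (fun w => (t ^+ k / k`!%:R) * `|Y w| ^+ (k + j)) by exact: integZl.
rewrite e; split; first by apply: integ_sum.
rewrite Rint_sum//; apply: (@le_trans _ _
  (\sum_(k < n) ((1 + v) * j.+1`!%:R) * ('C(k + j.+1, j.+1)%:R * t ^+ k))).
  apply: ler_sum => k _; rewrite (RintZl _ (iYn (k + j))).
  apply: (@le_trans _ _ (t ^+ k / k`!%:R * ((1 + v) * (k + j).+1`!%:R))).
    by rewrite ler_wpM2l// divr_ge0 ?exprn_ge0.
  have h := fact_add_div k j.+1; rewrite addnS in h *.
  have -> : t ^+ k / k`!%:R * ((1 + v) * (k + j).+1`!%:R) =
     t ^+ k * (1 + v) * ((k + j).+1`!%:R / k`!%:R) by ring.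
  by rewrite h; rewrite le_eqVlt; apply/orP; left; apply/eqP; ring.
rewrite -mulr_sumr ler_wpM2l ?mulr_ge0 ?addr_ge0//.
exact: sum_binomial_le.
Qed.

(** Monotone convergence along the partial sums of the exponential, whose integrals are bounded
    uniformly because t < 1. *)
Lemma integ_abs_exp j : integ (fun w => `|Y w| ^+ j * expR (t * `|Y w|)).
Proof.
have t0 : 0 <= t by case/andP: t01.
have mF n : measurable_fun setT (fun w => `|Y w| ^+ j * exp_partial n (t * `|Y w|)).
  exact: (integ_measurable (partial_abs j n).1).
have c w : (`|Y w| ^+ j * exp_partial n (t * `|Y w|))%:E @[n --> \oo] -->
    (`|Y w| ^+ j * expR (t * `|Y w|))%:E.
  by apply: cvg_EFin; [near=> n|apply: cvgM; [exact: cvg_cst|exact: cvg_exp_partial]].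
have mf : measurable_fun setT (fun w => `|Y w| ^+ j * expR (t * `|Y w|)).
  apply: measurable_funM; first by apply: measurable_funX; exact: measurableT_comp.
  by apply: measurableT_comp => //; apply: measurable_funM => //; exact: measurableT_comp.
apply/integrableP; split; first exact/measurable_EFinP.
under eq_integral => w _.
  rewrite /= ger0_norm ?mulr_ge0 ?exprn_ge0 ?expR_ge0//.
  rewrite -(cvg_lim _ (c w))//.
  over.
rewrite monotone_convergence//; last 3 first.
- by move=> n; exact/measurable_EFinP.
- move=> n w _; rewrite lee_fin mulr_ge0 ?exprn_ge0//.
  by apply: sumr_ge0 => k _; rewrite divr_ge0// exprn_ge0// mulr_ge0.
- move=> w _ m n mn; rewrite lee_fin ler_wpM2l ?exprn_ge0//.
  by apply: exp_partial_nondecr => //; rewrite mulr_ge0.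
apply: (@le_lt_trans _ _ ((1 + v) * j.+1`!%:R * (1 - t) ^- j.+2)%:E); last by rewrite ltry.
apply: lime_le.
  apply: ereal_nondecreasing_is_cvgn => m n mn; apply: ge0_le_integral => //.
  - move=> w _; rewrite lee_fin mulr_ge0 ?exprn_ge0//.
    by apply: sumr_ge0 => k _; rewrite divr_ge0// exprn_ge0// mulr_ge0.
  - exact/measurable_EFinP.
  - exact/measurable_EFinP.
  - move=> w _; rewrite lee_fin ler_wpM2l ?exprn_ge0//.
    by apply: exp_partial_nondecr => //; rewrite mulr_ge0.
near=> n; have [i1 le1] := partial_abs j n.
by rewrite -EFin_Rint// lee_fin.
Unshelve. all: by end_near. Qed.

Lemma measurable_mul_exp j : measurable_fun setT (fun w => Y w ^+ j * expR (t * Y w)).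
Proof.
apply: measurable_funM; first exact: measurable_funX.
by apply: measurableT_comp => //; exact: measurable_funM.
Qed.

Lemma integ_mul_exp j : integ (fun w => Y w ^+ j * expR (t * Y w)).
Proof.
have t0 : 0 <= t by case/andP: t01.
apply: (integ_le (measurable_mul_exp j) _ (integ_abs_exp j)) => w.
rewrite normrM normrX (ger0_norm (expR_ge0 _)) ler_wpM2l ?exprn_ge0//.
by rewrite ler_expR ler_wpM2l// ler_norm.
Qed.

(* Termwise integration of the exponential series, the tail being dominated by
   [sum_k 'C(k + j, j) t^k = (1 - t)^-(j+1)]. *)
Lemma exp_moment_bound (j m : nat) : (2 <= m + j)%N ->
  `|Ex (fun w => Y w ^+ j * expR (t * Y w)) -
    \sum_(k < m) t ^+ k / k`!%:R * Ex (fun w => Y w ^+ (k + j))| <=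
  v * j`!%:R / 2 * ((1 - t) ^- j.+1 - \sum_(k < m) 'C(k + j, j)%:R * t ^+ k).
Proof.
move=> mj; have t0 : 0 <= t by case/andP: t01.
pose fn n w := Y w ^+ j * exp_partial n (t * Y w).
have e n : fn n = fun w => \sum_(k < n) (t ^+ k / k`!%:R) * Y w ^+ (k + j).
  apply/funext => w; rewrite /fn /exp_partial mulr_sumr; apply: eq_bigr => k _.
  by rewrite exprMn exprD; ring.
have i1 (k : nat) : integ (fun w => (t ^+ k / k`!%:R) * Y w ^+ (k + j)) by exact: integZl.
have ifn n : integ (fn n) by rewrite e; apply: integ_sum.
have Efn n : Ex (fn n) = \sum_(k < n) (t ^+ k / k`!%:R) * Ex (fun w => Y w ^+ (k + j)).
  by rewrite e Rint_sum//; apply: eq_bigr => k _; rewrite (RintZl _ (iY (k + j))).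
have cv : Ex (fn n) @[n --> \oo] --> Ex (fun w => Y w ^+ j * expR (t * Y w)).
  apply: (Rint_dominated_cvg _ (integ_mul_exp j) (integ_abs_exp j)).
  - by move=> n; exact: (integ_measurable (ifn n)).
  - by move=> w; apply: cvgM; [exact: cvg_cst|exact: cvg_exp_partial].
  - move=> n w; rewrite normrM normrX ler_wpM2l ?exprn_ge0//.
    apply: (le_trans (exp_partial_norm_le _ _)); rewrite normrM (ger0_norm t0).
    by apply: exp_partial_le; rewrite mulr_ge0.
set M := \sum_(k < m) _ * Ex _; set C := \sum_(k < m) _ * t ^+ _.
have cv' : `|Ex (fn n) - M| @[n --> \oo] --> `|Ex (fun w => Y w ^+ j * expR (t * Y w)) - M|.
  by apply: cvg_norm; apply: cvgB => //; exact: cvg_cst.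
rewrite -(cvg_lim _ cv')//; apply: limr_le; first by apply/cvg_ex; eexists; exact: cv'.
near=> n; have mn : (m <= n)%N by near: n; exact: nbhs_infty_ge.
rewrite Efn -(subnKC mn) big_split_ord/= -/M addrAC subrr add0r.
apply: (le_trans (ler_norm_sum _ _ _)).
apply: (@le_trans _ _ (v * j`!%:R / 2 * \sum_(k < n - m) 'C(m + k + j, j)%:R * t ^+ (m + k))).
  rewrite mulr_sumr; apply: ler_sum => k _.
  rewrite normrM ger0_norm ?divr_ge0 ?exprn_ge0//.
  apply: (@le_trans _ _ (t ^+ (m + k) / (m + k)`!%:R * ((m + k + j)`!%:R / 2 * v))).
    rewrite ler_wpM2l ?divr_ge0 ?exprn_ge0//; apply: mom.
    by rewrite addnAC (leq_trans mj)// leq_addr.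
  have h := fact_add_div (m + k) j.
  have -> : t ^+ (m + k) / (m + k)`!%:R * ((m + k + j)`!%:R / 2 * v) =
     t ^+ (m + k) * v / 2 * ((m + k + j)`!%:R / (m + k)`!%:R) by ring.
  by rewrite h le_eqVlt; apply/orP; left; apply/eqP; ring.
rewrite ler_wpM2l ?divr_ge0 ?mulr_ge0// lerBrDl.
have := sum_binomial_le j n t01; rewrite -(subnKC mn) big_split_ord/=.
by rewrite addKn.
Unshelve. all: by end_near. Qed.

Local Notation u := (1 - t)^-1.

Let t0 : 0 <= t. Proof. by case/andP: t01. Qed.
Let s0 : 0 < 1 - t. Proof. by rewrite subr_gt0; case/andP: t01. Qed.

Lemma integ_exp : integ (fun w => expR (t * Y w)).
Proof. by have := integ_mul_exp 0; under eq_fun do rewrite expr0 mul1r. Qed.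

Lemma mgf_ge1 : 1 <= Ex (fun w => expR (t * Y w)).
Proof.
have iY1 : integ Y by have := iY 1; under eq_fun do rewrite expr1.
have i1 : integ (fun w => 1 + t * Y w) by apply: integD; [exact: integ_cst|exact: integZl].
have <- : Ex (fun w => 1 + t * Y w) = 1.
  by rewrite (RintD (integ_cst P 1) (integZl t iY1)) (RintZl t iY1) Rint_cst EY0 mulr0 addr0.
by apply: Rint_le => // [|w]; [exact: integ_exp|exact: expR_ge1Dx].
Qed.

Lemma mgf_le : Ex (fun w => expR (t * Y w)) <= 1 + v / 2 * (t ^+ 2 * u).
Proof.
have := @exp_moment_bound 0 2 isT.
under eq_Rintegral do rewrite expr0 mul1r.
have -> : \sum_(k < 2) t ^+ k / k`!%:R * Ex (fun w => Y w ^+ (k + 0)) = 1.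
  rewrite !big_ord_recr big_ord0 /= !add0n.
  under eq_Rintegral do rewrite expr0.
  under [X in _ + _ * X]eq_Rintegral do rewrite expr1.
  by rewrite Rint_cst EY0 expr0 fact0 invr1; ring.
have -> : \sum_(k < 2) 'C(k + 0, 0)%:R * t ^+ k = 1 + t.
  by rewrite !big_ord_recr big_ord0 /= !bin0; ring.
rewrite fact0 mulr1 expr1 => /(le_trans (ler_norm _)).
have e : u - (1 + t) = t ^+ 2 * u by field; rewrite gt_eqF.
by rewrite e; lra.
Qed.

Lemma exp_moment1_bound :
  `|Ex (fun w => Y w * expR (t * Y w)) - t * v| <= v / 2 * (u ^+ 2 - 1 - 2 * t).
Proof.
have := @exp_moment_bound 1 2 isT.
under eq_Rintegral do rewrite expr1.
have -> : \sum_(k < 2) t ^+ k / k`!%:R * Ex (fun w => Y w ^+ (k + 1)) = t * v.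
  rewrite !big_ord_recr big_ord0 /= !add0n.
  under eq_Rintegral do rewrite expr1.
  by rewrite EY0 mulr0 !add0r expr1 invr1 mulr1.
have -> : \sum_(k < 2) 'C(k + 1, 1)%:R * t ^+ k = 1 + 2 * t.
  by rewrite !big_ord_recr big_ord0 /= !bin1; ring.
by rewrite mulr1 -exprVn opprD addrA.
Qed.

Lemma exp_moment2_bound :
  `|Ex (fun w => Y w ^+ 2 * expR (t * Y w)) - v| <= v * (u ^+ 3 - 1).
Proof.
have := @exp_moment_bound 2 1 isT.
have -> : \sum_(k < 1) t ^+ k / k`!%:R * Ex (fun w => Y w ^+ (k + 2)) = v.
  by rewrite big_ord_recr big_ord0 /= expr0 fact0 invr1 !mul1r add0r.
have -> : \sum_(k < 1) 'C(k + 2, 2)%:R * t ^+ k = 1 :> R.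
  by rewrite big_ord_recr big_ord0 /= expr0 add0r mulr1.
by rewrite -exprVn (_ : 2`!%:R = 2%:R)// mulfK.
Qed.

Lemma exp_moment4_le : Ex (fun w => Y w ^+ 4 * expR (t * Y w)) <= 12 * v * u ^+ 5.
Proof.
have := @exp_moment_bound 4 0 isT; rewrite !big_ord0 !subr0 -exprVn => h.
apply: (le_trans (ler_norm _)); apply: (le_trans h).
by rewrite (_ : 4`!%:R = 24%:R)//; lra.
Qed.

Lemma exp_abs_moment3_le :
  integ (fun w => `|Y w| ^+ 3 * expR (t * Y w)) /\
  Ex (fun w => `|Y w| ^+ 3 * expR (t * Y w)) <= 97 / 28 * v * u ^+ 4.
Proof.
have u0 : 0 < u by rewrite invr_gt0.
have i3 : integ (fun w => `|Y w| ^+ 3 * expR (t * Y w)).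
  apply: (integ_le _ _ (integ_abs_exp 3)).
    apply: measurable_funM; first by apply: measurable_funX; exact: measurableT_comp.
    by apply: measurableT_comp => //; exact: measurable_funM.
  move=> w; rewrite ger0_norm ?mulr_ge0 ?exprn_ge0 ?expR_ge0// ler_wpM2l ?exprn_ge0//.
  by rewrite ler_expR ler_wpM2l// ler_norm.
split=> //.
(* AM-GM: [|Y|^3 <= c / 2 Y^2 + Y^4 / (2 c)], with [c] nearly optimal. *)
pose c := 7 / 2 * u; have c0 : 0 < c by rewrite mulr_gt0.
have i2 := integZl (c / 2) (integ_mul_exp 2); have i4 := integZl ((2 * c)^-1) (integ_mul_exp 4).
apply: (@le_trans _ _ (Ex (fun w => c / 2 * (Y w ^+ 2 * expR (t * Y w)) +
    (2 * c)^-1 * (Y w ^+ 4 * expR (t * Y w))))).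
  apply: Rint_le => // [|w]; first exact: integD.
  have -> : c / 2 * (Y w ^+ 2 * expR (t * Y w)) + (2 * c)^-1 * (Y w ^+ 4 * expR (t * Y w)) =
    (c / 2 * Y w ^+ 2 + (2 * c)^-1 * Y w ^+ 4) * expR (t * Y w) by ring.
  rewrite ler_wpM2r ?expR_ge0//.
  have e : Y w ^+ 4 = (`|Y w| ^+ 2) ^+ 2 by rewrite real_normK ?num_real// -exprM.
  rewrite e -(real_normK (num_real (Y w))); move: `|Y w| (normr_ge0 (Y w)) => y y0.
  have -> : c / 2 * y ^+ 2 + (2 * c)^-1 * (y ^+ 2) ^+ 2 = y ^+ 3 + y ^+ 2 * (y - c) ^+ 2 / (2 * c).
    by field; rewrite gt_eqF.
  by rewrite lerDl; apply: divr_ge0; [apply: mulr_ge0; exact: sqr_ge0|rewrite mulr_ge0// ltW].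
rewrite (RintD i2 i4) (RintZl _ (integ_mul_exp 2)) (RintZl _ (integ_mul_exp 4)).
have h2 : Ex (fun w => Y w ^+ 2 * expR (t * Y w)) <= v * u ^+ 3.
  have := le_trans (ler_norm _) exp_moment2_bound; lra.
have h4 := exp_moment4_le.
have c20 : 0 <= c / 2 by rewrite ltW// divr_gt0.
have c2i0 : 0 <= (2 * c)^-1 by rewrite invr_ge0 mulr_ge0// ltW.
have h2' := ler_wpM2l c20 h2; have h4' := ler_wpM2l c2i0 h4.
have e2 : c / 2 * (v * u ^+ 3) = 7 / 4 * (v * u ^+ 4) by rewrite /c; move: u => u'; field.
have e4 : (2 * c)^-1 * (12 * v * u ^+ 5) = 12 / 7 * (v * u ^+ 4).
  by rewrite /c; field; rewrite gt_eqF.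
have : 0 <= v * u ^+ 4.
  by apply: mulr_ge0; [exact: v0|apply: exprn_ge0; exact: ltW].
lra.
Qed.

(** Here (E Y^2)^2 <= E Y^4 <= (4! / 2) E Y^2. In units of eps no summand has variance above 12,
    which lets expressions quadratic in the variance be replaced by linear ones, summable over the
    family. *)
Lemma variance_le12 : v <= 12.
Proof.
have v00 := v0.
have i1 : integ (fun w => v ^+ 2 - 2 * v * Y w ^+ 2).
  by apply: integB; [exact: integ_cst|exact: integZl].
have i2 : integ (fun w => Y w ^+ 4 + (v ^+ 2 - 2 * v * Y w ^+ 2)) by exact: integD.
have : 0 <= Ex (fun w => Y w ^+ 4 + (v ^+ 2 - 2 * v * Y w ^+ 2)).
  apply: Rint_ge0 => w; have -> : Y w ^+ 4 + (v ^+ 2 - 2 * v * Y w ^+ 2) = (Y w ^+ 2 - v) ^+ 2 by ring.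
  exact: sqr_ge0.
rewrite (RintD (iY 4) i1) (RintB (integ_cst P (v ^+ 2)) (integZl (2 * v) (iY 2))).
rewrite (RintZl (2 * v) (iY 2)) Rint_cst -/v.
have := le_trans (ler_norm _) (@mom 4 isT); rewrite (_ : 4`!%:R = 24%:R)// => h1 h2.
have [->|vn0] := eqVneq v 0; first by [].
have vp : 0 < v by rewrite lt0r vn0 v0.
have : v * v <= 12 * v by move: h1 h2; rewrite expr2; lra.
by rewrite ler_pM2r.
Qed.

End bernstein_moments.

(** * Polynomial inequalities in tau *)

Section numerics.
Context {R : realType}.
Variable t : R.
Hypothesis t_range : 0 <= t <= 23 / 200.

(* Polynomial inequalities on [0, 23/200] are certified by the nonnegativity of
   coefficients in the Bernstein basis of that interval. *)
Let bernstein_ge0 k m : 0 <= t ^+ k * (23 / 200 - t) ^+ m.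
Proof.
case/andP: t_range => t0 t1; apply: mulr_ge0; apply: exprn_ge0; last rewrite subr_ge0; assumption.
Qed.

Lemma num_h_pos : 0 < 1 - 3 * t - 283 / 10 * t ^+ 2.
Proof. case/andP: t_range => *; nra. Qed.

(** The polynomial squared on the right is the factor lost by the tilted variance, and t - 234/100
    t^2 is a lower bound for p = x eps / sigma. Hence the square is at least the factor 1 - 12 p of
    D. *)
Lemma num_h_sqr : 1 - 12 * (t - 234 / 100 * t ^+ 2) <= (1 - 3 * t - 283 / 10 * t ^+ 2) ^+ 2.
Proof.
have := bernstein_ge0 1 3; have := bernstein_ge0 2 2; have := bernstein_ge0 3 1.
have := bernstein_ge0 4 0; lra.
Qed.

Lemma num_mean : (t - 234 / 100 * t ^+ 2) * ((1 - t) * (1 - t + 6 * t ^+ 2)) <=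
  t - 7 / 2 * t ^+ 2 + 2 * t ^+ 3.
Proof.
have := bernstein_ge0 2 3; have := bernstein_ge0 3 2; have := bernstein_ge0 4 1.
have := bernstein_ge0 5 0; lra.
Qed.

Lemma num_variance : (1 - 3 * t - 283 / 10 * t ^+ 2) * ((1 - t) ^+ 4 * (1 - t + 6 * t ^+ 2)) <=
  (2 * (1 - t) ^+ 3 - 1) * (1 - t) ^+ 2 - 12 * (t * (1 - t / 2)) ^+ 2 * (1 - t + 6 * t ^+ 2).
Proof.
have := bernstein_ge0 2 6; have := bernstein_ge0 3 5; have := bernstein_ge0 4 4.
have := bernstein_ge0 5 3; have := bernstein_ge0 6 2; have := bernstein_ge0 7 1.
have := bernstein_ge0 8 0; lra.
Qed.

Lemma num_third : (97 / 28 * (1 - t) + 24 * t * (2 - t)) *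
  (1 - 4 * (t - 234 / 100 * t ^+ 2)) ^+ 4 <= 358 / 100 * (1 - t) ^+ 5.
Proof.
have [t0 t1] := andP t_range.
set g := _ + _; set w := 1 - 4 * _.
(* [z], [y] and [k] are upper bounds for w / (1 - t), z^2 and g y. They replace one inequality of
   degree 10 by a chain of inequalities of degree at most 5. *)
pose z := 1 - 3 * t + 36 / 5 * t ^+ 2.
pose y := 1 - 6 * t + 234 / 10 * t ^+ 2 - 37 * t ^+ 3.
pose k := 97 / 28 + 238 / 10 * t - 114 * t ^+ 2.
have w0 : 0 <= w by rewrite /w; have := sqr_ge0 t; lra.
have g0 : 0 <= g.
  by rewrite /g; apply: addr_ge0; apply: mulr_ge0; lra.
have k0 : 0 <= k by rewrite /k; nra.
have wz : w <= (1 - t) * z.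
  rewrite /w /z; have := bernstein_ge0 2 1; have := bernstein_ge0 3 0; lra.
have zy : z ^+ 2 <= y.
  rewrite /z /y; have := bernstein_ge0 3 1; have := bernstein_ge0 4 0; lra.
have y0 : 0 <= y by apply: le_trans zy; exact: sqr_ge0.
have gy : g * y <= k.
  rewrite /g /y /k; have := bernstein_ge0 1 4; have := bernstein_ge0 2 3.
  have := bernstein_ge0 3 2; have := bernstein_ge0 4 1; have := bernstein_ge0 5 0; lra.
have ky : k * y <= 358 / 100 * (1 - t).
  rewrite /k /y; have := bernstein_ge0 0 7; have := bernstein_ge0 1 6.
  have := bernstein_ge0 2 5; have := bernstein_ge0 3 4; have := bernstein_ge0 4 3.
  have := bernstein_ge0 5 2; have := bernstein_ge0 6 1; have := bernstein_ge0 7 0; lra.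
have w4 : w ^+ 4 <= (1 - t) ^+ 4 * (y * y).
  apply: (@le_trans _ _ (((1 - t) * z) ^+ 4)).
    by apply: lerXn2r => //; rewrite nnegrE//; exact: le_trans wz.
  have -> : ((1 - t) * z) ^+ 4 = (1 - t) ^+ 4 * (z ^+ 2 * z ^+ 2) by ring.
  apply: ler_wpM2l; first by apply: exprn_ge0; lra.
  by apply: ler_pM => //; exact: sqr_ge0.
apply: (le_trans (ler_wpM2l g0 w4)).
have -> : g * ((1 - t) ^+ 4 * (y * y)) = (1 - t) ^+ 4 * (g * y * y) by ring.
have -> : 358 / 100 * (1 - t) ^+ 5 = (1 - t) ^+ 4 * (358 / 100 * (1 - t)) by ring.
apply: ler_wpM2l; first by apply: exprn_ge0; lra.
by apply: le_trans ky; apply: ler_wpM2r.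
Qed.

(** With h the second factor, (1 - (1 - 2 t) h) / t <= 5 + 223/10 t; this quotient over h is the
    coefficient of r in the bound on 1/a - 1/x when a <= x, up to the factor h. *)
Lemma num_mills : (5 + 223 / 10 * t) * (1 - 3 * t - 283 / 10 * t ^+ 2) <= 6.
Proof.
case/andP: t_range => t0 t1.
have := exprn_ge0 3 t0; have := sqr_ge0 t; nra.
Qed.
End numerics.

Section numeric_constants.
Context {R : realType}.

Lemma num_third_ge0 : 0 <= 358 / 100 :> R.
Proof. lra. Qed.

(** Here n is sqrt(pi / 2), known through its bounds 1 and sqrt 2; 2 sqrt 2 + 260/63 is just below
    6.96. *)
Lemma num_stein_constant (n : R) : 1 <= n -> n ^+ 2 <= 2 ->
  0 <= 2 * n + 4 / (1 - 2 * (1 / 65)) /\ 2 * n + 4 / (1 - 2 * (1 / 65)) <= 696 / 100.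
Proof.
have -> : 4 / (1 - 2 * (1 / 65)) = 260 / 63 :> R by field.
by move=> n1 n2; split; nra.
Qed.

Lemma num_total (r a b : R) : 0 < r -> a <= 696 / 100 * (358 / 100) * r -> b <= 3 * r ->
  a + b <= 2799 / 100 * r.
Proof. lra. Qed.
End numeric_constants.

(** * Mean, variance and third moment of one tilted summand *)

Section tilted_bernstein.
Context {d} {T : measurableType d} {R : realType} (P : probability T R).
Local Notation Ex f := (Rintegral P setT f).
Local Notation integ f := (P.-integrable setT (EFin \o f)).
Variable Y : T -> R.
Hypotheses (mY : measurable_fun setT Y) (iY : forall k, integ (fun w => Y w ^+ k))
  (EY0 : Ex Y = 0).
Let v := Ex (fun w => Y w ^+ 2).
Hypothesis mom : forall k : nat, (2 <= k)%N -> `|Ex (fun w => Y w ^+ k)| <= k`!%:R / 2 * v.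
Variable t : R.
Hypothesis t_range : 0 <= t <= 23 / 200.

Definition exp_weight (x : R) := expR (t * x) / Ex (fun w => expR (t * Y w)).

Let t01 : 0 <= t < 1.
Proof. by case/andP: t_range => t0 t1; apply/andP; split=> //; lra. Qed.
Let t0 : 0 <= t. Proof. by case/andP: t_range. Qed.
Let q0 : 0 < 1 - t. Proof. by rewrite subr_gt0; case/andP: t01. Qed.
Let u := (1 - t)^-1.
Let m := Ex (fun w => expR (t * Y w)).
Let v0 : 0 <= v. Proof. by apply: Rint_ge0 => w; exact: sqr_ge0. Qed.
Let m1 : 1 <= m. Proof. exact: (mgf_ge1 mY iY EY0 mom t01). Qed.
Let m0 : 0 < m. Proof. exact: lt_le_trans m1. Qed.
Let u0 : 0 < u. Proof. by rewrite invr_gt0. Qed.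
Let qu : (1 - t) * u = 1. Proof. by rewrite mulfV// gt_eqF. Qed.
Let u1 : 1 <= u.
Proof. have := qu; have := t0; have := u0; nra. Qed.
Let v12 : v <= 12. Proof. exact: (variance_le12 iY mom). Qed.
(** The bound v <= 12 turns 1 + v t^2 u / 2 into (1 - t + 6 t^2) / (1 - t), with the same quadratic
    as in the numerator of R. *)
Let mle : m <= (1 - t + 6 * t ^+ 2) * u.
Proof.
apply: (le_trans (mgf_le mY iY EY0 mom t01)); rewrite -/u -/v.
have -> : (1 - t + 6 * t ^+ 2) * u = 1 + 12 / 2 * (t ^+ 2 * u).
  have -> : (1 - t + 6 * t ^+ 2) * u = (1 - t) * u + 6 * (t ^+ 2 * u) by ring.
  by rewrite qu; lra.
rewrite lerD2l ler_wpM2r//; last by rewrite ler_wpM2r.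
by rewrite mulr_ge0 ?sqr_ge0// ltW.
Qed.

Lemma exp_weight_ge0 x : 0 <= exp_weight x.
Proof. by rewrite mulr_ge0 ?expR_ge0// invr_ge0 ltW. Qed.

Lemma measurable_exp_weight : measurable_fun setT exp_weight.
Proof.
by apply: measurable_funM => //; apply: measurableT_comp => //; exact: measurable_funM.
Qed.

Lemma integ_exp_weight : integ (exp_weight \o Y).
Proof. exact: integZr (integ_exp mY iY mom t01). Qed.

Lemma Rint_exp_weight : Ex (exp_weight \o Y) = 1.
Proof.
rewrite /comp /exp_weight (RintZr _ (integ_exp mY iY mom t01)) -/m.
by rewrite divff// gt_eqF.
Qed.

Lemma integ_pow_exp_weight k : integ (fun w => Y w ^+ k * exp_weight (Y w)).
Proof.
have := integZr m^-1 (integ_mul_exp mY iY mom t01 k).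
by under eq_fun do rewrite -mulrA.
Qed.

Lemma Rint_pow_exp_weight k : Ex (fun w => Y w ^+ k * exp_weight (Y w)) =
  Ex (fun w => Y w ^+ k * expR (t * Y w)) / m.
Proof.
rewrite -(RintZr _ (integ_mul_exp mY iY mom t01 k)).
by apply: eq_Rintegral => w _; rewrite /exp_weight mulrA.
Qed.

(** The exponent 1 is kept so that the lemmas on [Y w ^+ k] apply directly. *)
Definition tilted_mean := Ex (fun w => Y w ^+ 1 * exp_weight (Y w)).
Local Notation b := tilted_mean.
Local Notation M2 := (Ex (fun w => Y w ^+ 2 * exp_weight (Y w))).

Let n1 : b = Ex (fun w => Y w * expR (t * Y w)) / m.
Proof. by rewrite /b Rint_pow_exp_weight; under eq_Rintegral do rewrite expr1. Qed.

Let n1_bound := exp_moment1_bound mY iY EY0 mom t01.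

Let u2E : (u ^+ 2 - 1) / 2 = t * (1 - t / 2) * u ^+ 2.
Proof. have := qu => h; have : u ^+ 2 - 1 = u ^+ 2 - ((1 - t) * u) ^+ 2 by rewrite h expr1n. lra. Qed.

(** E Y exp(t Y) is at least (2 t - (u^2 - 1) / 2) v, and the normaliser m is bounded by [mle]. At t
    = 23/200 the coefficient of v is just above 1/12, as [saddlepoint_exists] requires. *)
Lemma tilted_mean_ge : (t - 234 / 100 * t ^+ 2) * v <= b.
Proof.
rewrite n1 ler_pdivlMr//.
move: n1_bound; rewrite ler_norml => /andP[h _]; move: h; rewrite -/u -/v => h.
set p := t - _; have p0 : 0 <= p.
  by rewrite /p; have := t0; case/andP: t_range => ? ?; nra.
have h1 : p * ((1 - t) * (1 - t + 6 * t ^+ 2)) * u ^+ 2 <= (t - 7 / 2 * t ^+ 2 + 2 * t ^+ 3) * u ^+ 2.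
  by rewrite ler_wpM2r ?sqr_ge0//; exact: num_mean.
have e1 : p * ((1 - t) * (1 - t + 6 * t ^+ 2)) * u ^+ 2 = p * ((1 - t + 6 * t ^+ 2) * u).
  transitivity (p * ((1 - t + 6 * t ^+ 2) * u) * ((1 - t) * u)); first by ring.
  by rewrite qu mulr1.
have e2 : (t - 7 / 2 * t ^+ 2 + 2 * t ^+ 3) * u ^+ 2 = 2 * t - (u ^+ 2 - 1) / 2.
  have -> : 2 * t = 2 * t * ((1 - t) * u) ^+ 2 by rewrite qu expr1n mulr1.
  by rewrite u2E; lra.
have h2 : p * v * m <= p * ((1 - t + 6 * t ^+ 2) * u) * v.
  by rewrite mulrAC ler_wpM2r// ler_wpM2l.
have h3 : p * ((1 - t + 6 * t ^+ 2) * u) * v <= (2 * t - (u ^+ 2 - 1) / 2) * v.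
  by rewrite ler_wpM2r// -e1 -e2.
lra.
Qed.

Lemma tilted_mean_ge0 : 0 <= b.
Proof.
apply: le_trans tilted_mean_ge; apply: mulr_ge0; last exact: v0.
by have := t0; case/andP: t_range => ? ?; nra.
Qed.

Lemma tilted_mean_le : b <= t * (1 - t / 2) * u ^+ 2 * v.
Proof.
have N0 : 0 <= Ex (fun w => Y w * expR (t * Y w)).
  by have := tilted_mean_ge0; rewrite n1 pmulr_lge0// invr_gt0.
rewrite n1; apply: (@le_trans _ _ (Ex (fun w => Y w * expR (t * Y w)))).
  by rewrite ler_pdivrMr// ler_peMr.
move: n1_bound; rewrite ler_norml => /andP[_ h]; move: h; rewrite -/u -/v -u2E; lra.
Qed.

Let n2_bound := exp_moment2_bound mY iY mom t01.

Lemma tilted_moment2_le : M2 <= u ^+ 3 * v.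
Proof.
rewrite Rint_pow_exp_weight.
apply: (@le_trans _ _ (Ex (fun w => Y w ^+ 2 * expR (t * Y w)))).
  by rewrite ler_pdivrMr// ler_peMr//; apply: Rint_ge0 => w; rewrite mulr_ge0 ?sqr_ge0 ?expR_ge0.
move: n2_bound; rewrite ler_norml => /andP[_ h]; move: h; rewrite -/u -/v; lra.
Qed.

(** The second moment is at least (2 - u^3) v / m; the bound on the squared mean is quadratic in v
    and is made linear by v <= 12. *)
Lemma tilted_variance_ge : (1 - 3 * t - 283 / 10 * t ^+ 2) * v <= M2 - b ^+ 2.
Proof.
set h := (X in X * v <= _).
pose z := 1 - t + 6 * t ^+ 2; have z0 : 0 < z by rewrite ltr_wpDr// mulr_ge0// sqr_ge0.
have q3 : 0 <= 2 * (1 - t) ^+ 3 - 1.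
  by case/andP: t_range => ? ?; have := sqr_ge0 t; nra.
pose c := t * (1 - t / 2); have c0 : 0 <= c.
  by rewrite mulr_ge0// subr_ge0; case/andP: t_range => ? ?; lra.
have b2 : b ^+ 2 <= 12 * c ^+ 2 * u ^+ 4 * v.
  have hb := tilted_mean_le; have hb0 := tilted_mean_ge0.
  apply: (@le_trans _ _ ((c * u ^+ 2 * v) ^+ 2)); first by rewrite !expr2 ler_pM.
  have -> : (c * u ^+ 2 * v) ^+ 2 = v * (c ^+ 2 * u ^+ 4 * v) by ring.
  have -> : 12 * c ^+ 2 * u ^+ 4 * v = 12 * (c ^+ 2 * u ^+ 4 * v) by ring.
  rewrite ler_wpM2r//; apply: mulr_ge0; last exact: v0.
  by apply: mulr_ge0; [exact: sqr_ge0|apply: exprn_ge0; exact: ltW].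
have m2 : (2 * (1 - t) ^+ 3 - 1) * u ^+ 2 / z * v <= M2.
  rewrite Rint_pow_exp_weight ler_pdivlMr//.
  apply: (@le_trans _ _ ((2 * (1 - t) ^+ 3 - 1) * u ^+ 2 / z * v * (z * u))).
    rewrite ler_wpM2l//; apply: mulr_ge0; last exact: v0.
    by apply: mulr_ge0; [apply: mulr_ge0 => //; exact: sqr_ge0|rewrite invr_ge0 ltW].
  have -> : (2 * (1 - t) ^+ 3 - 1) * u ^+ 2 / z * v * (z * u) =
    (2 * ((1 - t) * u) ^+ 3 - u ^+ 3) * v by field; rewrite gt_eqF.
  rewrite qu expr1n; move: n2_bound; rewrite ler_norml => /andP[h' _].
  by move: h'; rewrite -/u -/v; lra.
have key : h <= ((2 * (1 - t) ^+ 3 - 1) * u ^+ 2 / z) - 12 * c ^+ 2 * u ^+ 4.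
  have := num_variance t_range; rewrite -/h -/c -/z.
  rewrite -ler_pdivlMr; last by rewrite mulr_gt0// exprn_gt0.
  move=> /le_trans; apply; rewrite le_eqVlt; apply/orP; left; apply/eqP.
  by rewrite /u; field; rewrite gt_eqF//= gt_eqF.
have := ler_wpM2r v0 key; lra.
Qed.

(** The term 4 b M2 is the cost of centring at the tilted mean, charged here in advance. The
    coefficient 24 t (2 - t) is 4 times 12 t (1 - t / 2), again by v <= 12. *)
Lemma tilted_abs_moment3_le :
  integ (fun w => `|Y w| ^+ 3 * exp_weight (Y w)) /\
  Ex (fun w => `|Y w| ^+ 3 * exp_weight (Y w)) + 4 * b * M2 <=
    (97 / 28 * (1 - t) + 24 * t * (2 - t)) * u ^+ 5 * v.
Proof.
have [i3 h3] := exp_abs_moment3_le mY iY mom t01.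
split.
  by have := integZr m^-1 i3; under eq_fun do rewrite -mulrA.
have -> : Ex (fun w => `|Y w| ^+ 3 * exp_weight (Y w)) = Ex (fun w => `|Y w| ^+ 3 * expR (t * Y w)) / m.
  by rewrite -(RintZr _ i3); apply: eq_Rintegral => w _; rewrite /exp_weight mulrA.
have h3' : Ex (fun w => `|Y w| ^+ 3 * expR (t * Y w)) / m <= 97 / 28 * v * u ^+ 4.
  apply: le_trans h3; rewrite ler_pdivrMr// ler_peMr//.
  by apply: Rint_ge0 => w; rewrite mulr_ge0 ?exprn_ge0 ?expR_ge0.
have M20 : 0 <= M2 by apply: Rint_ge0 => w; rewrite mulr_ge0 ?sqr_ge0 ?exp_weight_ge0.
have c0 : 0 <= t * (1 - t / 2).
  by rewrite mulr_ge0// subr_ge0; case/andP: t_range => ? ?; lra.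
have hbM : b * M2 <= t * (1 - t / 2) * u ^+ 2 * 12 * (u ^+ 3 * v).
  apply: ler_pM; [exact: tilted_mean_ge0|exact: M20| |exact: tilted_moment2_le].
  apply: (le_trans tilted_mean_le); rewrite ler_wpM2l//.
  by apply: mulr_ge0 => //; exact: sqr_ge0.
have e : (97 / 28 * (1 - t) + 24 * t * (2 - t)) * u ^+ 5 * v =
  97 / 28 * v * u ^+ 4 * ((1 - t) * u) + 4 * (t * (1 - t / 2) * u ^+ 2 * 12 * (u ^+ 3 * v)).
  by lra.
by rewrite e qu mulr1; lra.
Qed.

End tilted_bernstein.

(** * The saddlepoint *)

Section lipschitz.
Context {R : realType}.

Lemma cvg_within_lipschitz (A : set R) (f : R -> R) (L x : R) :
  (forall y, A y -> `|f x - f y| <= L * `|x - y|) ->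
  f y @[y --> within A (nbhs x)] --> f x.
Proof.
move=> h; apply/cvgrPdist_lt => e e0; rewrite near_withinE.
have L0 : 0 < `|L| + 1 by rewrite ltr_wpDl.
near=> y => Ay; apply: (le_lt_trans (h _ Ay)).
apply: (@le_lt_trans _ _ ((`|L| + 1) * `|x - y|)).
  by rewrite ler_wpM2r// (le_trans (ler_norm _))// lerDl.
rewrite mulrC -ltr_pdivlMr//.
near: y; apply: cvgr_dist_lt => //; exact: divr_gt0.
Unshelve. all: by end_near. Qed.

Lemma expR_sub_le (a b : R) : `|expR a - expR b| <= `|a - b| * expR (Num.max a b).
Proof.
wlog ab : a b / a <= b.
  move=> h; case/orP: (le_total a b) => [/h//|/h].
  by rewrite distrC (distrC b) maxC.
rewrite (max_idPr ab) !ler0_norm ?subr_le0 ?ler_expR// !opprB.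
have := expR_ge1Dx (a - b); rewrite expRD expRN => /(ler_wpM2r (expR_ge0 b)).
by rewrite mulfVK ?gt_eqF ?expR_gt0//; lra.
Qed.
End lipschitz.

Section tilted_continuity.
Context {d} {T : measurableType d} {R : realType} (P : probability T R).
Local Notation Ex f := (Rintegral P setT f).
Local Notation integ f := (P.-integrable setT (EFin \o f)).
Variable Y : T -> R.
Hypotheses (mY : measurable_fun setT Y) (iY : forall k, integ (fun w => Y w ^+ k)).
Hypothesis mom : forall k : nat, (2 <= k)%N ->
  `|Ex (fun w => Y w ^+ k)| <= k`!%:R / 2 * Ex (fun w => Y w ^+ 2).

(** The moment is Lipschitz in the exponent on [0, c], with constant E |Y|^(k+1) exp(c |Y|), finite
    because c < 1. *)
Lemma exp_moment_continuous (k : nat) (c : R) : 0 <= c < 1 ->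
  forall t, `[0, c] t ->
  Ex (fun w => Y w ^+ k * expR (z * Y w)) @[z --> within `[0, c] (nbhs t)] -->
  Ex (fun w => Y w ^+ k * expR (t * Y w)).
Proof.
move=> /andP[c0 c1] t; rewrite /= in_itv/= => /andP[t0 tc].
have i z : 0 <= z <= c -> integ (fun w => Y w ^+ k * expR (z * Y w)).
  move=> /andP[z0 zc]; apply: integ_mul_exp => //.
  by rewrite z0 (le_lt_trans zc).
have ia : integ (fun w => `|Y w| ^+ k.+1 * expR (c * `|Y w|)).
  by apply: integ_abs_exp => //; rewrite c0.
apply: (@cvg_within_lipschitz _ _ (fun z => Ex (fun w => Y w ^+ k * expR (z * Y w)))
  (Ex (fun w => `|Y w| ^+ k.+1 * expR (c * `|Y w|)))) => z.
rewrite /= in_itv/= => /andP[z0 zc].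
have it := i _ (introT andP (conj t0 tc)); have iz := i _ (introT andP (conj z0 zc)).
rewrite -(RintB it iz) mulrC -(RintZl _ ia).
apply: Rint_norm_le; [exact: integB|exact: integZl|move=> w].
have -> : Y w ^+ k * expR (t * Y w) - Y w ^+ k * expR (z * Y w) =
  Y w ^+ k * (expR (t * Y w) - expR (z * Y w)) by ring.
have -> : `|t - z| * (`|Y w| ^+ k.+1 * expR (c * `|Y w|)) =
  `|Y w| ^+ k * (`|t * Y w - z * Y w| * expR (c * `|Y w|)).
  by rewrite -mulrBl normrM exprS; ring.
rewrite normrM normrX ler_wpM2l ?exprn_ge0//.
apply: (le_trans (expR_sub_le _ _)); rewrite ler_wpM2l// ler_expR ge_max.
have h z' : 0 <= z' -> z' <= c -> z' * Y w <= c * `|Y w|.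
  move=> z'0 z'c; apply: (@le_trans _ _ (z' * `|Y w|)); first by rewrite ler_wpM2l// ler_norm.
  by rewrite ler_wpM2r.
by rewrite !h.
Qed.

Lemma tilted_mean_continuous (EY0 : Ex Y = 0) (c : R) : 0 <= c < 1 ->
  forall t, `[0, c] t ->
  tilted_mean P Y z @[z --> within `[0, c] (nbhs t)] --> tilted_mean P Y t.
Proof.
move=> c01 t tc; have [c0 c1] := andP c01.
have e z : `[0, c] z -> tilted_mean P Y z = Ex (fun w => Y w ^+ 1 * expR (z * Y w)) /
   Ex (fun w => Y w ^+ 0 * expR (z * Y w)).
  rewrite /= in_itv/= => /andP[z0 zc]; have z01 : 0 <= z < 1 by rewrite z0 (le_lt_trans zc).
  rewrite /tilted_mean; under [X in _ / X]eq_Rintegral do rewrite expr0 mul1r.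
  rewrite -(RintZr _ (integ_mul_exp mY iY mom z01 1)).
  by apply: eq_Rintegral => w _; rewrite /exp_weight mulrA.
rewrite (e t tc).
apply: (@cvg_trans _ (Ex (fun w => Y w ^+ 1 * expR (z * Y w)) /
   Ex (fun w => Y w ^+ 0 * expR (z * Y w)) @[z --> within `[0, c] (nbhs t)])).
  by apply: near_eq_cvg; rewrite near_withinE; near=> z => /e.
apply: cvgM; first exact: exp_moment_continuous.
apply: cvgV; last exact: exp_moment_continuous.
under eq_Rintegral do rewrite expr0 mul1r.
rewrite gt_eqF// (lt_le_trans ltr01)// (mgf_ge1 mY iY EY0 mom)//.
by move: tc; rewrite /= in_itv/= => /andP[-> tc]; rewrite (le_lt_trans tc).
Unshelve. all: by end_near. Qed.

End tilted_continuity.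

Section saddlepoint.
Context {d} {T : measurableType d} {R : realType} (P : probability T R).
Local Notation Ex f := (Rintegral P setT f).
Local Notation integ f := (P.-integrable setT (EFin \o f)).
Variables (I : finType) (X : I -> T -> R).
Hypotheses (mX : forall i, measurable_fun setT (X i))
  (iX : forall i k, integ (fun w => X i w ^+ k)) (EX0 : forall i, Ex (X i) = 0).
Hypothesis mom : forall i (k : nat), (2 <= k)%N ->
  `|Ex (fun w => X i w ^+ k)| <= k`!%:R / 2 * Ex (fun w => X i w ^+ 2).

(* By [tilted_mean_ge] the tilted mean at 23/200 already exceeds 1/12 of the variance. *)
Lemma saddlepoint_exists (p : R) : 0 <= p <= 1 / 12 -> exists t : R,
  0 <= t <= 23 / 200 /\
  \sum_i tilted_mean P (X i) t = p * \sum_i Ex (fun w => X i w ^+ 2).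
Proof.
move=> /andP[p0 p1]; have c0 : 0 <= 23 / 200 :> R by lra.
have c01 : 0 <= (23 / 200 : R) < 1 by lra.
have r0 : 0 <= (0 : R) <= 23 / 200 by lra.
have rc : 0 <= (23 / 200 : R) <= 23 / 200 by lra.
have v0 i : 0 <= Ex (fun w => X i w ^+ 2) by apply: Rint_ge0 => w; exact: sqr_ge0.
(* At t = 0 the lower and the upper bound on the tilted mean are both 0. *)
have f0 : \sum_i tilted_mean P (X i) 0 = 0.
  apply: big1 => i _; apply/le_anti.
  rewrite (tilted_mean_ge0 (mX i) (iX i) (EX0 i) (mom i) r0) andbT.
  by apply: (le_trans (tilted_mean_le (mX i) (iX i) (EX0 i) (mom i) r0)); rewrite !mul0r.
have f1 : p * \sum_i Ex (fun w => X i w ^+ 2) <= \sum_i tilted_mean P (X i) (23 / 200).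
  rewrite mulr_sumr; apply: ler_sum => i _.
  apply: le_trans (tilted_mean_ge (mX i) (iX i) (EX0 i) (mom i) rc).
  by apply: ler_wpM2r; [exact: v0|lra].
have [||t tI ft] := @IVT R (fun t => \sum_i tilted_mean P (X i) t) 0 (23 / 200)
    (p * \sum_i Ex (fun w => X i w ^+ 2)) c0.
- apply/subspace_continuousP => t tI.
  apply: (cvg_big (op := +%R)) => [|i _]; first exact: add_continuous.
  exact: (tilted_mean_continuous (mX i) (iX i) (mom i) (EX0 i) c01 tI).
- apply/andP; split.
    apply: (@le_trans _ _ (\sum_i tilted_mean P (X i) 0)).
      by rewrite ge_min; apply/orP; left; exact: lexx.
    by rewrite f0; apply: mulr_ge0 => //; apply: sumr_ge0 => i _; exact: v0.
  by apply: (le_trans f1); rewrite le_max; apply/orP; right; exact: lexx.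
by exists t; split => //; move: tI; rewrite in_itv.
Qed.
End saddlepoint.

Section centered_third_moment.
Context {d} {T : measurableType d} {R : realType} (P : probability T R).
Local Notation Ex f := (Rintegral P setT f).
Local Notation integ f := (P.-integrable setT (EFin \o f)).

(** Expand |z - b|^3 <= (|z| + |b|) (z - b)^2. The majorant [F] is arranged so that its constant and
    linear terms cancel in expectation, b being the mean. *)
Lemma abs_centered_moment3_le (Y : T -> R) : integ Y -> integ (fun w => Y w ^+ 2) ->
  integ (fun w => `|Y w| ^+ 3) ->
  integ (fun w => `|Y w - Ex Y| ^+ 3) /\
  Ex (fun w => `|Y w - Ex Y| ^+ 3) <=
    Ex (fun w => `|Y w| ^+ 3) + 4 * `|Ex Y| * Ex (fun w => Y w ^+ 2).
Proof.
move=> i1 i2 i3; set b := Ex Y.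
pose F w := `|Y w| ^+ 3 + (4 * `|b| * Y w ^+ 2 + (2 * `|b| * b ^+ 2 + (- (2 * `|b| * b)) * Y w)).
have iL : integ (fun w => 2 * `|b| * b ^+ 2 + (- (2 * `|b| * b)) * Y w).
  by apply: integD; [exact: integ_cst|exact: integZl].
have iM : integ (fun w => 4 * `|b| * Y w ^+ 2 + (2 * `|b| * b ^+ 2 + (- (2 * `|b| * b)) * Y w)).
  by apply: integD => //; exact: integZl.
have iF : integ F by exact: integD.
have h w : `|Y w - b| ^+ 3 <= F w.
  rewrite /F; move: (Y w) => z.
  have e1 : `|z - b| ^+ 3 = `|z - b| * (z - b) ^+ 2 by rewrite exprS real_normK ?num_real.
  have e2 : `|z| ^+ 3 = `|z| * z ^+ 2 by rewrite exprS real_normK ?num_real.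
  have h1 := ler_wpM2r (sqr_ge0 (z - b)) (ler_normB z b).
  have h2 : - (b * z) * `|z| <= `|b| * z ^+ 2.
    have -> : `|b| * z ^+ 2 = `|b| * `|z| * `|z| by rewrite -mulrA -expr2 real_normK ?num_real.
    by rewrite ler_wpM2r// -normrM -normrN ler_norm.
  have h3 : b ^+ 2 * `|z| <= `|b| * (z ^+ 2 + b ^+ 2).
    rewrite -(real_normK (num_real b)) -(real_normK (num_real z)) expr2 -mulrA ler_wpM2l//.
    by have := sqr_ge0 (`|b| - `|z|); have := sqr_ge0 `|b|; have := sqr_ge0 `|z|; nra.
  by rewrite e1 e2; nra.
have ia : integ (fun w => `|Y w - b| ^+ 3).
  apply: (integ_le _ _ iF) => [|w].
    apply: measurable_funX; apply: measurableT_comp => //.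
    by apply: measurable_funB => //; exact: integ_measurable i1.
  by rewrite ger0_norm ?exprn_ge0.
split=> //; apply: (le_trans (Rint_le ia iF h)).
rewrite (RintD i3 iM) (RintD (integZl _ i2) iL).
rewrite (RintD (integ_cst P (2 * `|b| * b ^+ 2)) (integZl _ i1)) (RintZl _ i2) (RintZl _ i1).
by rewrite Rint_cst -/b; lra.
Qed.

End centered_third_moment.

(** * The sum under the tilted law *)

Section exponential_tilt.
Context {d} {T : measurableType d} {R : realType} (P : probability T R).
Local Notation Ex f := (Rintegral P setT f).
Local Notation integ f := (P.-integrable setT (EFin \o f)).
Variables (I : finType) (X : I -> T -> R).
Hypotheses (mX : forall i, measurable_fun setT (X i)) (indX : mutually_independent P X)
  (iX : forall i k, integ (fun w => X i w ^+ k)) (EX0 : forall i, Ex (X i) = 0).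
Hypothesis mom : forall i (k : nat), (2 <= k)%N ->
  `|Ex (fun w => X i w ^+ k)| <= k`!%:R / 2 * Ex (fun w => X i w ^+ 2).
Variable t : R.
Hypothesis t_range : 0 <= t <= 23 / 200.

Let t01 : 0 <= t < 1. Proof. by case/andP: t_range => ? ?; apply/andP; split; lra. Qed.

Let g i := exp_weight P (X i) t.
Let mg i : measurable_fun setT (g i) := measurable_exp_weight P (X i) t.
Let g0 i x : 0 <= g i x := exp_weight_ge0 (mX i) (iX i) (EX0 i) (mom i) t_range x.
Let ig i : integ (g i \o X i) := integ_exp_weight (mX i) (iX i) (mom i) t_range.
Let Eg i : Ex (g i \o X i) = 1 := Rint_exp_weight (mX i) (iX i) (EX0 i) (mom i) t_range.

Definition exp_tilt : probability T R := tilted_family_prob mX indX mg g0 ig Eg.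
Local Notation Q := exp_tilt.
Local Notation EQ f := (Rintegral Q setT f).
Local Notation integQ f := (Q.-integrable setT (EFin \o f)).

Lemma mutually_independent_exp_tilt : mutually_independent Q X.
Proof. exact: mutually_independent_tilted. Qed.

Lemma exp_tilt_moment (phi : R -> R) i : measurable_fun setT phi ->
  integ (fun w => phi (X i w) * exp_weight P (X i) t (X i w)) ->
  integQ (phi \o X i) /\
  EQ (phi \o X i) = Ex (fun w => phi (X i w) * exp_weight P (X i) t (X i w)).
Proof. exact: integ_tilted. Qed.

Definition rvsum w := \sum_i X i w.
Local Notation S := rvsum.
Let y := \sum_i tilted_mean P (X i) t.

Lemma measurable_rvsum : measurable_fun setT S.
Proof. exact: measurable_sum. Qed.

Definition mgf_at := Ex (fun w => expR (t * (S w - y))).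
Local Notation Z := mgf_at.

Let m i := Ex (fun w => expR (t * X i w)).
Let m0 i : 0 < m i.
Proof. exact: lt_le_trans ltr01 (mgf_ge1 (mX i) (iX i) (EX0 i) (mom i) t01). Qed.

Let densityE w : density X g w = (\prod_i (m i)^-1) * expR (t * y) * expR (t * (S w - y)).
Proof.
rewrite /density -mulrA -expRD mulrBr addrCA subrr addr0 mulr_sumr expR_sum -big_split/=.
by apply: eq_bigr => i _; rewrite mulrC.
Qed.

Let c := (\prod_i (m i)^-1) * expR (t * y).
Let c0 : 0 < c.
Proof. by rewrite mulr_gt0 ?expR_gt0// prodr_gt0// => i _; rewrite invr_gt0. Qed.

Let iexp : integ (fun w => expR (t * (S w - y))).
Proof.
have := integZl c^-1 (proj1 (Rint_prod mX indX (index_enum_uniq I) mg ig)).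
by under eq_fun do rewrite -/(density X g _) densityE -/c mulKf ?gt_eqF//.
Qed.

Let ZE : c * Z = 1.
Proof.
have := proj2 (Rint_prod mX indX (index_enum_uniq I) mg ig).
under eq_Rintegral do rewrite -/(density X g _) densityE -/c.
by rewrite (RintZl _ iexp) => ->; apply: big1 => i _; exact: Eg.
Qed.

Lemma mgf_at_gt0 : 0 < Z.
Proof. by rewrite -(pmulr_rgt0 _ c0) ZE. Qed.

Let dE w : density X g w = expR (t * (S w - y)) / Z.
Proof.
rewrite densityE -/c mulrC; congr (_ * _).
by rewrite -[LHS]mulr1 -(mulfV (lt0r_neq0 mgf_at_gt0)) mulrA ZE mul1r.
Qed.

Lemma integral_exp_tilt (f : T -> R) : measurable_fun setT f -> (forall w, 0 <= f w) ->
  (\int[P]_w (f w)%:E = Z%:E * \int[Q]_w (f w * expR (- (t * (S w - y))))%:E)%E.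
Proof.
move=> mf f0; have mE : measurable_fun setT (fun w => expR (- (t * (S w - y)))).
  apply: measurableT_comp => //; apply: measurableT_comp => //.
  apply: measurable_funM => //; apply: measurable_funB => //; exact: measurable_rvsum.
rewrite /exp_tilt /tilted_family_prob ge0_integral_tilt; last 2 first.
- by apply/measurable_EFinP; exact: measurable_funM.
- by move=> w; rewrite lee_fin mulr_ge0 ?expR_ge0.
rewrite -ge0_integralZl//.
- apply: eq_integral => w _; rewrite -!EFinM; congr (_%:E).
  rewrite dE expRN; field.
  by rewrite !gt_eqF ?mgf_at_gt0 ?expR_gt0.
- apply/measurable_EFinP; apply: measurable_funM; first exact: measurable_funM.
  apply: (integ_measurable (proj1 (Rint_prod mX indX (index_enum_uniq I) mg ig))).
- move=> w _; rewrite lee_fin mulr_ge0 ?mulr_ge0 ?expR_ge0//.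
  by apply: prodr_ge0 => i _; exact: g0.
- by rewrite lee_fin ltW// mgf_at_gt0.
Qed.

Lemma exp_tilt_mean i : integQ (X i) /\ EQ (X i) = tilted_mean P (X i) t.
Proof.
have ip := integ_pow_exp_weight (mX i) (iX i) (mom i) t_range 1.
have [] := @exp_tilt_moment (fun z => z ^+ 1) i _ ip; first exact: measurable_funX.
rewrite /tilted_mean => h1 h2; split; first by move: h1; rewrite /comp /=; under eq_fun do rewrite expr1.
by rewrite -h2; apply: eq_Rintegral => w _; rewrite /= expr1.
Qed.

Lemma exp_tilt_sum_mean : integQ S /\ EQ S = y.
Proof.
have iS : integQ S by apply: integ_sum => i _; exact: (exp_tilt_mean i).1.
split=> //; rewrite /rvsum Rint_sum => [|i _]; last exact: (exp_tilt_mean i).1.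
by apply: eq_bigr => i _; exact: (exp_tilt_mean i).2.
Qed.

(* Under the tilted law [S - y] is centred, so [1 + z <= e^z] shows that no
   other exponent does better. *)
Lemma inf_mgf_saddlepoint : inf_mgf P S y = Z%:E.
Proof.
apply/eqP; rewrite eq_le; apply/andP; split.
  apply: ereal_inf_lbound; exists t; first by case/andP: t01.
  by rewrite expectation.unlock -EFin_Rint.
apply: le_ereal_inf_tmp => _ [l l0 <-].
pose F w := expR (l * (S w - y)) * expR (- (t * (S w - y))).
have mE s : measurable_fun setT (fun w => expR (s * (S w - y))).
  apply: measurableT_comp => //; apply: measurable_funM => //.
  by apply: measurable_funB => //; exact: measurable_rvsum.
have mF : measurable_fun setT F.
  apply: measurable_funM; first exact: mE.
  by have := mE (- t); under eq_fun do rewrite mulNr.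
have F0 w : 0 <= F w by rewrite mulr_ge0 ?expR_ge0.
rewrite expectation.unlock (integral_exp_tilt (mE l)); last by move=> w; exact: expR_ge0.
rewrite -[leLHS]mule1 lee_pmul2l//; last by rewrite lte_fin mgf_at_gt0.
have [->|Foo] := eqVneq (\int[Q]_w (F w)%:E)%E +oo%E; first exact: leey.
have iF : integQ F.
  apply/integrableP; split; first exact/measurable_EFinP.
  under eq_integral do rewrite /= ger0_norm//.
  by rewrite ltey.
have [iS ES] := exp_tilt_sum_mean.
have iL : integQ (fun w => (l - t) * (S w - y)).
  by apply: integZl; apply: integB => //; exact: integ_cst.
have EL : EQ (fun w => 1 + (l - t) * (S w - y)) = 1.
  rewrite (RintD (integ_cst Q 1) iL) (RintZl _ (integB iS (integ_cst Q y))).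
  by rewrite (RintB iS (integ_cst Q y)) ES !Rint_cst subrr mulr0 addr0.
rewrite -(EFin_Rint iF) lee_fin -EL; apply: Rint_le => // [|w].
  by apply: integD => //; exact: integ_cst.
by rewrite /F -expRD -mulrBl expR_ge1Dx.
Qed.

Lemma integ_tilted_tail (a : R) : 0 <= a ->
  integQ (fun w => tilted_tail a (S w - y)) /\
  0 <= EQ (fun w => tilted_tail a (S w - y)) <= 1.
Proof.
move=> a0; have b w : 0 <= tilted_tail a (S w - y) <= 1.
  rewrite /tilted_tail; case: ifPn => [sy|_]; last by rewrite lexx ler01.
  by rewrite expR_ge0 -[leRHS]expR0 ler_expR mulNr oppr_le0 mulr_ge0// ltW.
have i1 : integQ (fun w => tilted_tail a (S w - y)).
  apply: (@integ_bounded _ _ _ _ _ 1).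
    apply: measurableT_comp; first exact: measurable_tilted_tail.
    by apply: measurable_funB => //; exact: measurable_rvsum.
  by move=> w; have /andP[h1 h2] := b w; rewrite ger0_norm.
split=> //; apply/andP; split; first by apply: Rint_ge0 => w; case/andP: (b w).
rewrite -[leRHS](Rint_cst Q); apply: Rint_le => // [|w]; first exact: integ_cst.
by case/andP: (b w).
Qed.

Lemma probability_tail : P [set w | y < S w] =
  (Z * EQ (fun w => tilted_tail t (S w - y)))%:E.
Proof.
have mA : measurable [set w | y < S w].
  have := measurable_event measurable_rvsum (measurable_itv `]y, +oo[%R).
  by congr (measurable _); apply/seteqP; split => w /=; rewrite in_itv/= andbT.
have -> : P [set w | y < S w] = (\int[P]_w (\1_[set w | y < S w] w)%:E)%E.
  by rewrite integral_indic// setIT.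
rewrite integral_exp_tilt; [|exact: measurable_indic|by []].
have [it _] := @integ_tilted_tail t (proj1 (andP t_range)).
rewrite EFinM (EFin_Rint it).
congr (_ * _)%E; apply: eq_integral => w _; congr (_%:E).
rewrite /tilted_tail subr_gt0 mulNr indicE.
case: ifPn => h; first by rewrite mem_set// mul1r.
by rewrite memNset ?mul0r//; apply/negP.
Qed.
Let h := 1 - 3 * t - 283 / 10 * t ^+ 2.
Let u := (1 - t)^-1.
Let G := (97 / 28 * (1 - t) + 24 * t * (2 - t)) * u ^+ 5.
Let v i := Ex (fun w => X i w ^+ 2).
Let var_ i := EQ (fun w => X i w ^+ 2) - tilted_mean P (X i) t ^+ 2.

Let h0 : 0 < h. Proof. exact: num_h_pos. Qed.
Let h1 : h <= 1.
Proof. by rewrite /h; case/andP: t_range => a b; have := sqr_ge0 t; lra. Qed.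
Let u1 : 1 <= u.
Proof.
by case/andP: t_range => a b; rewrite /u invf_ge1 ?gerBl// subr_gt0; case/andP: t01.
Qed.
Let u0 : 0 < u. Proof. exact: lt_le_trans ltr01 u1. Qed.
Let v0 i : 0 <= v i. Proof. by apply: Rint_ge0 => w; exact: sqr_ge0. Qed.

Let moment2 i : integQ (fun w => X i w ^+ 2) /\
  EQ (fun w => X i w ^+ 2) = Ex (fun w => X i w ^+ 2 * exp_weight P (X i) t (X i w)).
Proof.
have ip := integ_pow_exp_weight (mX i) (iX i) (mom i) t_range 2.
exact: (exp_tilt_moment (phi := fun z => z ^+ 2) (measurable_funX _ _) ip).
Qed.

Let var_ge i : h * v i <= var_ i.
Proof.
by rewrite /var_ (moment2 i).2; exact: (tilted_variance_ge (mX i) (iX i) (EX0 i) (mom i) t_range).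
Qed.

Let var_le i : var_ i <= u ^+ 3 * v i.
Proof.
rewrite /var_ (moment2 i).2; apply: le_trans (tilted_moment2_le (mX i) (iX i) (EX0 i) (mom i) t_range).
by rewrite gerBl sqr_ge0.
Qed.

Let moment3 i : integQ (fun w => `|X i w - tilted_mean P (X i) t| ^+ 3) /\
  EQ (fun w => `|X i w - tilted_mean P (X i) t| ^+ 3) <= G * v i.
Proof.
have [i3 h3] := tilted_abs_moment3_le (mX i) (iX i) (EX0 i) (mom i) t_range.
have m3 : measurable_fun setT (fun z : R => `|z| ^+ 3) by apply: measurable_funX; exact: normr_measurable.
have [iq3 e3] := exp_tilt_moment (phi := fun z => `|z| ^+ 3) m3 i3.
have [iq1 e1] := exp_tilt_mean i.
have [iq2 e2] := moment2 i.
have [] := abs_centered_moment3_le iq1 iq2 iq3.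
rewrite e1 => ia le; split=> //; apply: (le_trans le); rewrite e2.
rewrite ger0_norm; last exact: (tilted_mean_ge0 (mX i) (iX i) (EX0 i) (mom i) t_range).
by apply: le_trans h3; rewrite lerD2r; move: e3; rewrite /comp /= => ->.
Qed.

Variable r : R.
Hypotheses (r0 : 0 < r) (rV : r ^+ 2 * \sum_i v i = 1).

Let s := Num.sqrt (\sum_i var_ i).

Let Vr : \sum_i v i = r ^- 2.
Proof.
apply: (mulfI (lt0r_neq0 (exprn_gt0 2 r0))).
by rewrite rV mulfV// gt_eqF// exprn_gt0.
Qed.

Let s2_ge : h / r ^+ 2 <= \sum_i var_ i.
Proof.
apply: (@le_trans _ _ (\sum_i h * v i)); last by apply: ler_sum => i _; exact: var_ge.
by rewrite -mulr_sumr Vr.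
Qed.

Let s2_le : \sum_i var_ i <= u ^+ 3 / r ^+ 2.
Proof.
apply: (@le_trans _ _ (\sum_i u ^+ 3 * v i)); first by apply: ler_sum => i _; exact: var_le.
by rewrite -mulr_sumr Vr.
Qed.

Let s2_gt0 : 0 < \sum_i var_ i.
Proof. by apply: lt_le_trans s2_ge; rewrite divr_gt0// exprn_gt0. Qed.

Let s0 : 0 < s. Proof. by rewrite sqrtr_gt0. Qed.

Let s2E : s ^+ 2 = \sum_i var_ i. Proof. by rewrite sqr_sqrtr// ltW. Qed.

(** Square roots are avoided on both sides: sqrt h >= h since h <= 1, and in [s_le] the power
    u^(3/2) is at most u (1 + u) / 2. *)
Let s_ge : h / r <= s.
Proof.
rewrite -(@ler_pXn2r _ 2) ?nnegrE ?divr_ge0 ?(ltW s0) ?(ltW h0) ?(ltW r0)//.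
rewrite s2E; apply: le_trans s2_ge; rewrite expr_div_n ler_wpM2r ?invr_ge0 ?sqr_ge0//.
by rewrite expr2 ger_pMl.
Qed.

Let s_le : s <= u * (1 + u) / 2 / r.
Proof.
have q0 : 0 <= u * (1 + u) / 2 / r.
  by apply: divr_ge0; [apply: divr_ge0 => //; apply: mulr_ge0; have := u1; lra|exact: ltW].
rewrite -(@ler_pXn2r _ 2) ?nnegrE ?(ltW s0)//.
rewrite s2E; apply: (le_trans s2_le); rewrite expr_div_n ler_wpM2r ?invr_ge0 ?sqr_ge0//.
have -> : (u * (1 + u) / 2) ^+ 2 = u ^+ 3 + u ^+ 2 * ((u - 1) / 2) ^+ 2 by field.
by rewrite lerDl mulr_ge0// sqr_ge0.
Qed.

Let A := EQ (fun w => tilted_tail t (S w - y)).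

(** [stein_bound] for the summands centred and divided by s under the tilted law. A single
    normalised variance is at most kappa because v i <= 12 and s^2 >= h / r^2, and s^3 >= h^2 / r^3
    gives the third moments. *)
Lemma tail_stein (kappa : R) : kappa < 1 / 2 -> 12 * r ^+ 2 * u ^+ 3 / h <= kappa ->
  `|A - Mills (t * s)| <= (2 * mills_scaled 0 + 4 / (1 - 2 * kappa)) * (G / h ^+ 2 * r).
Proof.
move=> k12 hk.
pose b i := tilted_mean P (X i) t.
pose W i w := (X i w - b i) / s.
have mW i : measurable_fun setT (W i) by apply: measurable_funM => //; exact: measurable_funB.
have indW : mutually_independent Q W.
  apply: (mutually_independent_comp mutually_independent_exp_tilt (phi := fun i z => (z - b i) / s)).
  by move=> i; apply: measurable_funM => //; exact: measurable_funB.
have iXb i : integQ (fun w => X i w - b i).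
  by apply: integB; [exact: (exp_tilt_mean i).1|exact: integ_cst].
have EW0 i : EQ (W i) = 0.
  rewrite /W (RintZr _ (iXb i)) (RintB (exp_tilt_mean i).1 (integ_cst Q (b i))) Rint_cst.
  by rewrite (exp_tilt_mean i).2 subrr mul0r.
have iL i : integQ (fun w => b i ^+ 2 - 2 * b i * X i w).
  by apply: integB; [exact: integ_cst|apply: integZl; exact: (exp_tilt_mean i).1].
have iXb2 i : integQ (fun w => X i w ^+ 2 + (b i ^+ 2 - 2 * b i * X i w)).
  by apply: integD => //; exact: (moment2 i).1.
have W2 i : (fun w => W i w ^+ 2) = fun w => (X i w ^+ 2 + (b i ^+ 2 - 2 * b i * X i w)) / s ^+ 2.
  by apply/funext => w; rewrite /W; field; rewrite gt_eqF.
have iW2 i : integQ (fun w => W i w ^+ 2) by rewrite W2; exact: integZr.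
have EW2 i : EQ (fun w => W i w ^+ 2) = var_ i / s ^+ 2.
  rewrite W2 (RintZr _ (iXb2 i)) (RintD (moment2 i).1 (iL i)).
  rewrite (RintB (integ_cst Q (b i ^+ 2)) (integZl (2 * b i) (exp_tilt_mean i).1)) Rint_cst.
  rewrite (RintZl _ (exp_tilt_mean i).1) (exp_tilt_mean i).2 -/(b i) /var_ -/(b i).
  by congr (_ / _); ring.
have W3 i : (fun w => `|W i w| ^+ 3) = fun w => `|X i w - b i| ^+ 3 / s ^+ 3.
  apply/funext => w; rewrite /W normrM exprMn normfV exprVn.
  by rewrite (ger0_norm (ltW s0)).
have iW3 i : integQ (fun w => `|W i w| ^+ 3) by rewrite W3; apply: integZr; exact: (moment3 i).1.
have EW3 i : EQ (fun w => `|W i w| ^+ 3) <= G * v i / s ^+ 3.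
  rewrite W3 (RintZr _ (moment3 i).1) ler_wpM2r ?invr_ge0 ?exprn_ge0 ?(ltW s0)//.
  exact: (moment3 i).2.
have G0 : 0 < G.
  rewrite mulr_gt0 ?exprn_gt0//; case/andP: t_range => a1 a2.
  have : 0 <= t * (2 - t) by rewrite mulr_ge0//; lra.
  lra.
have -> : A = EQ (fun w => tilted_tail (t * s) (\sum_i W i w)).
  apply: eq_Rintegral => w _; rewrite /W -mulr_suml sumrB -/(S w) -/y /tilted_tail.
  rewrite pmulr_lgt0 ?invr_gt0//; case: ifP => // _; congr expR.
  by field; rewrite gt_eqF.
apply: stein_bound => //.
- by rewrite mulr_ge0// ?(ltW s0)//; case/andP: t_range.
- exact: index_enum_uniq.
- by rewrite mulr_gt0// divr_gt0// exprn_gt0.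
- move=> i _; rewrite EW2; apply: le_trans hk.
  rewrite ler_pdivrMr ?exprn_gt0// s2E.
  apply: (@le_trans _ _ (12 * r ^+ 2 * u ^+ 3 / h * (h / r ^+ 2))); last first.
    rewrite ler_wpM2l//; apply: divr_ge0; last exact: ltW.
    by apply: mulr_ge0; [apply: mulr_ge0 => //; exact: sqr_ge0|apply: exprn_ge0; exact: ltW].
  have -> : 12 * r ^+ 2 * u ^+ 3 / h * (h / r ^+ 2) = u ^+ 3 * 12.
    by field; rewrite !gt_eqF.
  apply: (le_trans (var_le i)); rewrite ler_wpM2l ?exprn_ge0 ?(ltW u0)//.
  exact: (variance_le12 (iX i) (mom i)).
- under eq_bigr do rewrite EW2.
  by rewrite -mulr_suml s2E divff// gt_eqF.
- apply: (@le_trans _ _ (\sum_i G * v i / s ^+ 3)); first by apply: ler_sum => i _; exact: EW3.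
  rewrite -mulr_suml -mulr_sumr ler_pdivrMr ?exprn_gt0//.
  rewrite Vr; have s3 : h / r ^+ 2 * (h / r) <= s ^+ 3.
    rewrite (exprSr s) s2E; apply: ler_pM => //.
      by apply: divr_ge0; [exact: ltW|exact: sqr_ge0].
    by apply: divr_ge0; exact: ltW.
  apply: (@le_trans _ _ (G / h ^+ 2 * r * (h / r ^+ 2 * (h / r)))).
    by rewrite le_eqVlt; apply/orP; left; apply/eqP; field; rewrite !gt_eqF.
  rewrite ler_wpM2l//; apply: ltW; rewrite mulr_gt0// divr_gt0// exprn_gt0//.
Qed.

Variable p : R.
Hypotheses (p_range : 0 <= p < 1 / 12) (yp : y = p * \sum_i v i).

Let p1 := t - 234 / 100 * t ^+ 2.
(** Errors are measured against r / D, and [Rfun_ge] bounds 1 / D by R(4 p). *)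
Let D := (1 - 12 * p) * (1 - 4 * p) ^+ 4.

Let V0 : 0 < \sum_i v i. Proof. by rewrite Vr invr_gt0 exprn_gt0. Qed.

Let p_ge : p1 <= p.
Proof.
rewrite -(ler_pM2r V0) -yp mulr_sumr; apply: ler_sum => i _.
exact: (tilted_mean_ge (mX i) (iX i) (EX0 i) (mom i) t_range).
Qed.

Let p_le : p <= t * (1 - t / 2) * u ^+ 2.
Proof.
rewrite -(ler_pM2r V0) -yp mulr_sumr; apply: ler_sum => i _.
exact: (tilted_mean_le (mX i) (iX i) (EX0 i) (mom i) t_range).
Qed.

Let p10 : 0 <= p1.
Proof. by rewrite /p1; case/andP: t_range => a b; nra. Qed.

Let D_gt0 : 0 < D.
Proof. by rewrite mulr_gt0 ?exprn_gt0//; case/andP: p_range => a b; lra. Qed.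

Let D_le : D <= h ^+ 2 * (1 - 4 * p1) ^+ 4.
Proof.
have pp := p_ge; case/andP: p_range => a b.
apply: ler_pM; [lra|by apply: exprn_ge0; lra| |].
  by apply: le_trans (num_h_sqr t_range); rewrite -/p1; lra.
by apply: lerXn2r; rewrite ?nnegrE; lra.
Qed.

Let D_le_h : D <= h ^+ 2.
Proof.
have pp := p_ge; have pp0 := p10; case/andP: p_range => a b.
apply: (le_trans D_le); rewrite -[leRHS]mulr1 ler_wpM2l ?sqr_ge0//.
by apply: exprn_ile1; lra.
Qed.

(** Both a = t s and x = p / r are close to t / r, so 1/a - 1/x is of order r: [s_ge] with [p_le]
    handles a <= x, and [s_le] with [p_ge] the other order. The bound 6 r for N becomes 3 r for
    [Mills] through the factor 1 / (2 N 0). *)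
Let mills_compare : D * `|Mills (t * s) - Mills (p / r)| <= 3 * r.
Proof.
case/andP: t_range => t0 t1; case/andP: p_range => p0 p12.
(* For t = 0 the reciprocals are meaningless, but then p = 0 and both arguments are 0. *)
have [tz|tn0] := eqVneq t 0.
  have pz : p = 0.
    by apply/le_anti; rewrite p0 andbT (le_trans p_le)// tz !mul0r.
  by rewrite pz tz !mul0r subrr normr0 mulr0 mulr_ge0// ltW.
have tp : 0 < t by rewrite lt0r tn0.
have p1p : 0 < p1.
  by have -> : p1 = t * (1 - 234 / 100 * t); [rewrite /p1; ring|apply: mulr_gt0; [exact: tp|lra]].
have pp : 0 < p by exact: lt_le_trans p_ge.
have inv_le (a b : R) : 0 < a -> a <= b -> b^-1 <= a^-1.
  by move=> a0 ab; rewrite lef_pV2 ?posrE// (lt_le_trans a0).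
pose N := @mills_scaled R.
have N01 : 1 <= N 0 := mills_scaled0_ge1.
suff key : D * `|N (t * s) - N (p / r)| <= 6 * r.
  rewrite !Mills_scaledE -/N -mulrBl normrM (ger0_norm (_ : 0 <= (2 * N 0)^-1)); last first.
    by rewrite invr_ge0; lra.
  rewrite mulrA ler_pdivrMr; last by lra.
  apply: (le_trans key); rewrite -[leLHS]mulr1.
  have -> : 3 * r * (2 * N 0) = 6 * r * N 0 by ring.
  by rewrite ler_wpM2l// mulr_ge0// ltW.
have ts0 : 0 < t * s by rewrite mulr_gt0.
have x0 : 0 < p / r by rewrite divr_gt0.
case/orP: (le_total (t * s) (p / r)) => hax.
  rewrite ger0_norm; last by rewrite subr_ge0; apply: mills_scaled_nincr => //; exact: ltW.
  have hs : N (t * s) - N (p / r) <= _ := mills_scaled_subV ts0 hax.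
  have e1 : (t * s)^-1 <= r / (t * h).
    have -> : r / (t * h) = (t * (h / r))^-1 by field; rewrite !gt_eqF.
    apply: inv_le; last exact: (ler_wpM2l t0 s_ge).
    by apply: mulr_gt0 => //; exact: divr_gt0.
  have e2 : r * ((1 - 2 * t) / t) <= (p / r)^-1.
    rewrite invf_div ler_wpM2l ?(ltW r0)// -[leRHS]mul1r ler_pdivrMr// mulrAC ler_pdivlMr//.
    rewrite mul1r; apply: (@le_trans _ _ ((1 - 2 * t) * (t * (1 - t / 2) * u ^+ 2))).
      by rewrite ler_wpM2l//; lra.
    have -> : (1 - 2 * t) * (t * (1 - t / 2) * u ^+ 2) = t * ((1 - 2 * t) * (1 - t / 2)) * u ^+ 2 by ring.
    rewrite /u exprVn ler_pdivrMr ?exprn_gt0//; last by lra.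
    by rewrite ler_wpM2l//; nra.
  apply: (@le_trans _ _ (h ^+ 2 * (r / (t * h) - r * ((1 - 2 * t) / t)))).
    apply: ler_pM => //; [exact: ltW|by rewrite subr_ge0; apply: mills_scaled_nincr => //; exact: ltW|lra].
  have -> : h ^+ 2 * (r / (t * h) - r * ((1 - 2 * t) / t)) = r * (h * ((1 - (1 - 2 * t) * h) / t)).
    by field; rewrite !gt_eqF.
  rewrite mulrC ler_wpM2r ?(ltW r0)//; apply: le_trans (num_mills t_range).
  rewrite -/h mulrC ler_wpM2r ?(ltW h0)// ler_pdivrMr//.
  by rewrite /h; have := exprn_ge0 3 t0; lra.
rewrite ler0_norm; last by rewrite subr_le0; apply: mills_scaled_nincr => //; exact: ltW.
rewrite opprB; have hs : N (p / r) - N (t * s) <= _ := mills_scaled_subV x0 hax.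
have e1 : (p / r)^-1 <= r / p1.
  by rewrite invf_div; apply: (ler_wpM2l (ltW r0)); exact: inv_le p_ge.
have e2 : r * ((1 - 3 / 2 * t) / t) <= (t * s)^-1.
  have -> : r * ((1 - 3 / 2 * t) / t) = (t * ((1 - 3 / 2 * t)^-1 / r))^-1.
    by field; rewrite !gt_eqF//; lra.
  apply: inv_le => //; apply: (ler_wpM2l t0).
  apply: (le_trans s_le); apply: ler_wpM2r; first by rewrite invr_ge0 ltW.
  have -> : u * (1 + u) / 2 = (2 - t) / (2 * (1 - t) ^+ 2).
    by rewrite /u; field; lra.
  have q2 : 0 < 2 * (1 - t) ^+ 2 by rewrite mulr_gt0// exprn_gt0//; lra.
  rewrite ler_pdivrMr// mulrC ler_pdivlMr; last by lra.
  by have := sqr_ge0 t; lra.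
apply: (@le_trans _ _ (1 * (r / p1 - r * ((1 - 3 / 2 * t) / t)))).
  apply: ler_pM; [exact: ltW|by rewrite subr_ge0; apply: mills_scaled_nincr => //; exact: ltW| |lra].
  by apply: (le_trans D_le_h); apply: exprn_ile1 => //; exact: ltW.
pose z := 1 - 234 / 100 * t; have z0 : 0 < z by rewrite /z; lra.
have p1E : p1 = t * z by rewrite /p1 /z; ring.
have -> : 1 * (r / p1 - r * ((1 - 3 / 2 * t) / t)) = r * ((z^-1 - 1) / t + 3 / 2).
  by rewrite p1E; move: z z0 {p1E} => z z0; field; rewrite tn0 gt_eqF.
rewrite mulrC; apply: (ler_wpM2r (ltW r0)).
suff : (z^-1 - 1) / t <= 4 by lra.
rewrite ler_pdivrMr// lerBlDr -[leLHS]mul1r ler_pdivrMr// /z.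
by nra.
Qed.

(* If the right-hand side is at least 1 the bound is trivial; otherwise [r] is
   small enough for the variances of the summands to be negligible. *)
Lemma tail_mills_bound : `|A - Mills (p / r)| <= 2799 / 100 * (r / D).
Proof.
have N01 : 1 <= @mills_scaled R 0 := mills_scaled0_ge1.
have M01 (w : R) : 0 <= w -> 0 <= Mills w <= 1.
  move=> w0; rewrite Mills_scaledE; apply/andP; split.
    by apply: divr_ge0; [exact: mills_scaled_ge0|lra].
  have n2 : 0 < 2 * @mills_scaled R 0 by lra.
  rewrite ler_pdivrMr// mul1r; apply: (le_trans (mills_scaled_nincr (lexx 0) w0)).
  by rewrite mulr_natl mulr2n lerDl; lra.
case/andP: t_range => t0 t1; case/andP: (p_range) => p0 p12.
have [small|big] := leP (2799 / 100 * (r / D)) 1; last first.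
  apply: le_trans (ltW big); rewrite ler_norml.
  have := M01 _ (divr_ge0 p0 (ltW r0)); have := (integ_tilted_tail t0).2; rewrite -/A.
  by move=> /andP[a1 a2] /andP[a3 a4]; apply/andP; split; lra.
have rD : 2799 / 100 * r <= D by move: small; rewrite mulrA ler_pdivrMr// mul1r.
(* From 27.99 r <= D <= h^2 and h u <= 1 follows (27.99 r)^2 u^3 <= h, and 12 / 27.99^2 is just
   below 1/65. *)
have hk : 12 * r ^+ 2 * u ^+ 3 / h <= 1 / 65.
  rewrite ler_pdivrMr//.
  have rh : 2799 / 100 * r <= h ^+ 2 := le_trans rD D_le_h.
  have hu : h * u <= 1.
    rewrite ler_pdivrMr ?mul1r; last by lra.
    by rewrite /h; have := sqr_ge0 t; lra.
  have r2 : (2799 / 100 * r) ^+ 2 <= (h ^+ 2) ^+ 2.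
    apply: lerXn2r => //; rewrite nnegrE; last exact: sqr_ge0.
    by apply: mulr_ge0; [lra|exact: ltW].
  have u30 : 0 <= u ^+ 3 by rewrite exprn_ge0// ltW.
  have hu3 : (h * u) ^+ 3 <= 1 by rewrite exprn_ile1// mulr_ge0// ltW.
  have h4 : (2799 / 100 * r) ^+ 2 * u ^+ 3 <= h.
    apply: (le_trans (ler_wpM2r u30 r2)).
    have -> : (h ^+ 2) ^+ 2 * u ^+ 3 = h * (h * u) ^+ 3 by ring.
    by rewrite ler_piMr// ltW.
  have q0 : 0 <= r ^+ 2 * u ^+ 3 by rewrite mulr_ge0// sqr_ge0.
  by lra.
have /tail_stein/(_ hk) st : 1 / 65 < 1 / 2 :> R by lra.
set C := (2 * _ + _) in st.
have [C0 C_le] : 0 <= C /\ C <= 696 / 100.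
  exact: (num_stein_constant N01 (@mills_scaled0_sqr_le2 R)).
have GD : D * (G / h ^+ 2) <= 358 / 100.
  have G0 : 0 <= G.
    rewrite mulr_ge0 ?exprn_ge0 ?(ltW u0)//.
    have : 0 <= t * (2 - t) by rewrite mulr_ge0//; lra.
    by lra.
  apply: (@le_trans _ _ (h ^+ 2 * (1 - 4 * p1) ^+ 4 * (G / h ^+ 2))).
    by rewrite ler_wpM2r// divr_ge0// sqr_ge0.
  have -> : h ^+ 2 * (1 - 4 * p1) ^+ 4 * (G / h ^+ 2) = G * (1 - 4 * p1) ^+ 4.
    by field; rewrite gt_eqF.
  rewrite /G mulrAC /u exprVn ler_pdivrMr; last by rewrite exprn_gt0//; lra.
  exact: num_third.
rewrite mulrA ler_pdivlMr// mulrC.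
have tri : `|A - Mills (p / r)| <= `|A - Mills (t * s)| + `|Mills (t * s) - Mills (p / r)|.
  by rewrite (le_trans _ (ler_normD _ _))// addrA subrK.
apply: (le_trans (ler_wpM2l (ltW D_gt0) tri)); rewrite mulrDr.
have i1 := ler_wpM2l (ltW D_gt0) st.
have i2 : D * (C * (G / h ^+ 2 * r)) <= 696 / 100 * (358 / 100) * r.
  have -> : D * (C * (G / h ^+ 2 * r)) = C * (D * (G / h ^+ 2)) * r by ring.
  rewrite ler_wpM2r ?(ltW r0)//; apply: (@le_trans _ _ (C * (358 / 100))); first exact: (ler_wpM2l C0 GD).
  by apply: ler_wpM2r; [exact: num_third_ge0|exact: C_le].
exact: num_total r0 (le_trans i1 i2) mills_compare.
Qed.
End exponential_tilt.

(** * The bounds B and R, and the expansion in units of eps *)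

Section rvsum_bound.
Context {d} {T : measurableType d} {R : realType} (P : probability T R).
Local Notation Ex f := (Rintegral P setT f).
Local Notation integ f := (P.-integrable setT (EFin \o f)).
Variables (I : finType) (X : I -> T -> R).
Hypotheses (mX : forall i, measurable_fun setT (X i)) (indX : mutually_independent P X)
  (iX : forall i k, integ (fun w => X i w ^+ k)) (EX0 : forall i, Ex (X i) = 0).
Hypothesis mom : forall i (k : nat), (2 <= k)%N ->
  `|Ex (fun w => X i w ^+ k)| <= k`!%:R / 2 * Ex (fun w => X i w ^+ 2).
Variable r : R.
Hypotheses (r0 : 0 < r) (rV : r ^+ 2 * \sum_i Ex (fun w => X i w ^+ 2) = 1).

Let Vr : \sum_i Ex (fun w => X i w ^+ 2) = r ^- 2.
Proof.
apply: (mulfI (lt0r_neq0 (exprn_gt0 2 r0))).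
by rewrite rV mulfV// gt_eqF// exprn_gt0.
Qed.

(** Each factor is at most 1 + v t^2 u / 2 <= exp(v t^2 u / 2), and the variances add up to 1 /
    r^2. *)
Lemma mgf_rvsum_le (t y : R) : 0 <= t < 1 ->
  ('E_P[fun w => expR (t * (rvsum X w - y))] <=
    (expR (t ^+ 2 * (1 - t)^-1 / (2 * r ^+ 2) - t * y))%:E)%E.
Proof.
move=> t01; have [t0 t1] := andP t01.
have ie i := integ_exp (mX i) (iX i) (mom i) t01.
have me (i : I) : measurable_fun setT (fun x : R => expR (t * x)).
  by apply: measurableT_comp => //; exact: measurable_funM.
have [ip Ep] := Rint_prod mX indX (index_enum_uniq I) me ie.
have e w : expR (t * (rvsum X w - y)) = expR (- (t * y)) * \prod_i expR (t * X i w).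
  by rewrite -expR_sum -mulr_sumr -expRD; congr expR; rewrite /rvsum; ring.
have ii : integ (fun w => expR (t * (rvsum X w - y))).
  by under eq_fun do rewrite e; exact: integZl.
rewrite expectation.unlock -(EFin_Rint ii) lee_fin.
under eq_Rintegral do rewrite e.
rewrite (RintZl _ ip) Ep addrC expRD ler_wpM2l ?expR_ge0//.
have -> : t ^+ 2 * (1 - t)^-1 / (2 * r ^+ 2) =
    \sum_i Ex (fun w => X i w ^+ 2) / 2 * (t ^+ 2 * (1 - t)^-1).
  by rewrite -mulr_suml -mulr_suml Vr; field; rewrite !gt_eqF ?subr_gt0.
rewrite expR_sum; apply: ler_prod => i _; apply/andP; split.
  by apply: Rint_ge0 => w; exact: expR_ge0.
apply: (le_trans (mgf_le (mX i) (iX i) (EX0 i) (mom i) t01)); exact: expR_ge1Dx.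
Qed.

(* The exponent [t = r z / (1 + r z)] with [z = xhat x r], for which [x = z + r z^2 / 2],
   gives exactly [- z^2 / 2]. *)
Lemma inf_mgf_le_Bfun (x : R) : 0 <= x ->
  (inf_mgf P (rvsum X) (x / r) <= (Bfun x r)%:E)%E.
Proof.
move=> x0; pose q := Num.sqrt (1 + 2 * x * r); pose z := xhat x r.
have q1 : 0 <= 1 + 2 * x * r by rewrite addr_ge0// !mulr_ge0// ltW.
have q2 : q ^+ 2 = 1 + 2 * x * r by rewrite sqr_sqrtr.
have q0 : 0 <= q by exact: sqrtr_ge0.
have zE : z = 2 * x / (1 + q) by [].
have z0 : 0 <= z by rewrite zE divr_ge0 ?mulr_ge0 ?addr_ge0.
have zq : z * (1 + q) = 2 * x by rewrite zE divfK// gt_eqF// ltr_pwDl.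
have xz : x = z + r * z ^+ 2 / 2.
  have h : r * z = q - 1.
    have q10 : 1 + q != 0 by rewrite gt_eqF// ltr_pwDl.
    by apply: (mulIf q10); rewrite -mulrA zq; lra.
  have : z * (r * z) = z * (q - 1) by rewrite h.
  by lra.
have rz : 0 < 1 + r * z by rewrite ltr_pwDl// mulr_ge0// ltW.
pose t := r * z / (1 + r * z).
have t01 : 0 <= t < 1.
  apply/andP; split; first by rewrite divr_ge0 ?mulr_ge0// ltW.
  by rewrite ltr_pdivrMr// mul1r ltrDr.
apply: ge_ereal_inf; eexists; first by exists t; [case/andP: t01|reflexivity].
apply: (le_trans (mgf_rvsum_le _ t01)); rewrite lee_fin /Bfun -/z ler_expR.
have -> : (1 - t)^-1 = 1 + r * z.
  by rewrite /t; field; rewrite gt_eqF//= gt_eqF// addrK.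
rewrite le_eqVlt; apply/orP; left; apply/eqP.
by rewrite /t xz; field; rewrite !gt_eqF.
Qed.

(** With c = 4 p: the exponent 3/2 exceeds 1 on a base at most 1, and 1 - c + 6 c^2 >= 1 - c cancels
    three of the seven factors 1 - c. *)
Lemma Rfun_ge (p : R) : 0 <= p < 1 / 12 ->
  ((1 - 12 * p) * (1 - 4 * p) ^+ 4)^-1 <= Rfun (4 * p).
Proof.
move=> /andP[p0 p1]; rewrite /Rfun.
have -> : 4 * p < 1 / 3 by lra.
set c := 4 * p; have c0 : 0 <= c by rewrite mulr_ge0.
have c1 : c < 1 / 3 by rewrite /c; lra.
have -> : 12 * p = 3 * c by rewrite /c; ring.
have a0 : 0 < 1 - 3 * c by lra.
have b0 : 0 < 1 - c by lra.
have pw : (1 - 3 * c) `^ (3 / 2) <= 1 - 3 * c.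
  by rewrite -[leRHS]powRr1 ?(ltW a0)// ger_powR ?a0//; lra.
have pw0 : 0 < (1 - 3 * c) `^ (3 / 2) by rewrite powR_gt0.
rewrite ler_pdivlMr; last by rewrite mulr_gt0// exprn_gt0.
rewrite mulrC ler_pdivrMr; last by rewrite mulr_gt0// exprn_gt0.
apply: (@le_trans _ _ ((1 - 3 * c) * (1 - c) ^+ 7)).
  by rewrite ler_wpM2r// exprn_ge0// ltW.
have -> : (1 - 3 * c) * (1 - c) ^+ 7 = (1 - c) ^+ 3 * ((1 - 3 * c) * (1 - c) ^+ 4) by ring.
apply: ler_wpM2r; first by apply: mulr_ge0; [exact: ltW|apply: exprn_ge0; exact: ltW].
have c2 : 0 <= 6 * c ^+ 2 by apply: mulr_ge0 => //; exact: sqr_ge0.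
by apply: lerXn2r; rewrite ?nnegrE; lra.
Qed.

Lemma rvsum_saddlepoint_bound (x : R) : 0 <= x -> x * r < 1 / 12 ->
  exists theta : R, `|theta| <= 1 /\
    P [set w | x / r < rvsum X w] =
    (inf_mgf P (rvsum X) (x / r) *
      (Mills x + (2799 / 100) * theta * Rfun (4 * (x * r)) * r)%:E)%E.
Proof.
move=> x0 xr; pose p := x * r.
have p_range : 0 <= p < 1 / 12 by rewrite mulr_ge0// ltW.
have p_range' : 0 <= p <= 1 / 12 by case/andP: p_range => -> /ltW.
have [t [t_range tE]] := saddlepoint_exists mX iX EX0 mom p_range'.
have yE : x / r = \sum_i tilted_mean P (X i) t.
  by rewrite tE Vr /p; field; rewrite gt_eqF.
have xE : x = p / r by rewrite /p mulfK// gt_eqF.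
have B := tail_mills_bound mX indX iX EX0 mom t_range r0 rV p_range tE.
rewrite yE (inf_mgf_saddlepoint mX indX iX EX0 mom t_range).
rewrite (probability_tail mX indX iX EX0 mom t_range).
set A := Rintegral _ _ _; set Z := mgf_at _ _ _.
have RD := Rfun_ge p_range.
have D0 : 0 < ((1 - 12 * p) * (1 - 4 * p) ^+ 4)^-1.
  by rewrite invr_gt0 mulr_gt0 ?exprn_gt0//; case/andP: p_range => ? ?; lra.
have R0 : 0 < Rfun (4 * p) := lt_le_trans D0 RD.
pose K := 2799 / 100 * Rfun (4 * p) * r.
have K0 : 0 < K by apply: mulr_gt0; [apply: mulr_gt0; [lra|exact: R0]|exact: r0].
exists ((A - Mills x) / K); split.
  rewrite normrM normfV (gtr0_norm K0) (ler_pdivrMr _ _ K0) mul1r {1}xE.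
  apply: (le_trans B).
  have -> : K = 2799 / 100 * (Rfun (4 * p) * r) by rewrite /K [RHS]mulrA.
  apply: ler_wpM2l; first by lra.
  rewrite mulrC; apply: ler_wpM2r; [exact: ltW|exact: RD].
rewrite -EFinM; congr (_ * _)%:E.
have -> : 2799 / 100 * ((A - Mills x) / K) * Rfun (4 * (x * r)) * r = (A - Mills x) / K * K.
  by rewrite /K -/p; ring.
by rewrite (divfK (lt0r_neq0 K0)) addrC subrK.
Qed.
End rvsum_bound.

(** * Sums of random variables *)

Section bernstein_condition_moments.
Context {d} {T : measurableType d} {R : realType} (P : probability T R).
Local Notation Ex f := (Rintegral P setT f).
Local Notation integ f := (P.-integrable setT (EFin \o f)).
Variables (Z : {RV P >-> R}) (eps : R).
Hypotheses (Z2 : P.-integrable setT (fun w => ((Z w) ^+ 2)%:E)) (eps0 : 0 < eps)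
  (bZ : bernstein_condition P Z eps).

Let mZ : measurable_fun setT (Z : T -> R). Proof. exact: measurable_funPT. Qed.

Lemma expectation_sqr : 'E_P[fun w => Z w ^+ 2] = (Ex (fun w => Z w ^+ 2))%:E.
Proof. by rewrite expectation.unlock -EFin_Rint. Qed.

(** A finite expectation gives integrability only for a nonnegative integrand, so even powers come
    first; an odd power is dominated by 1 plus the next even one. *)
Lemma bernstein_integ k : integ (fun w => Z w ^+ k).
Proof.
have mk j : measurable_fun setT (fun w => Z w ^+ j) by exact: measurable_funX.
have even_ (j : nat) : ~~ odd j -> integ (fun w => Z w ^+ j).
  case: j => [_|[//|[_|j oj]]].
  - by under eq_fun do rewrite expr0; exact: integ_cst.
  - exact: Z2.
  case: j oj => // j oj.
  apply/integrableP; split; first exact/measurable_EFinP.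
  have -> : (\int[P]_w `|(EFin \o (fun w : T => (Z w ^+ j.+4)%R)) w|)%E = 'E_P[fun w => Z w ^+ j.+4].
    rewrite expectation.unlock; apply: eq_integral => w _ /=.
    by rewrite ger0_norm// exprn_even_ge0.
  apply: (le_lt_trans (lee_abs _)); apply: (le_lt_trans (bZ (k := j.+4) isT)).
  by rewrite expectation_sqr -EFinM ltry.
have [ok|] := boolP (odd k); last exact: even_.
have i1 : integ (fun w => 1 + Z w ^+ k.+1).
  by apply: integD; [exact: integ_cst|apply: even_; rewrite /= ok].
apply: (integ_le (mk k) _ i1) => w.
have -> : Z w ^+ k.+1 = `|Z w| ^+ k.+1.
  by rewrite -normrX ger0_norm// exprn_even_ge0//= ok.
rewrite normrX; have [z1|/ltW z1] := leP `|Z w| 1.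
  by apply: (@le_trans _ _ 1); [exact: exprn_ile1|rewrite lerDl exprn_ge0].
apply: (@le_trans _ _ (`|Z w| ^+ k.+1)); last by rewrite lerDr.
by rewrite exprS ler_peMl ?exprn_ge0.
Qed.

Lemma bernstein_scaled_pow k w : (Z w / eps) ^+ k = (eps ^+ k)^-1 * Z w ^+ k.
Proof. by rewrite expr_div_n mulrC. Qed.

Lemma bernstein_scaled_integ k : integ (fun w => (Z w / eps) ^+ k).
Proof.
under eq_fun do rewrite bernstein_scaled_pow.
by apply: integZl; exact: bernstein_integ.
Qed.

Lemma bernstein_scaled_moment k : Ex (fun w => (Z w / eps) ^+ k) = Ex (fun w => Z w ^+ k) / eps ^+ k.
Proof.
under eq_Rintegral do rewrite bernstein_scaled_pow.
by rewrite (RintZl _ (bernstein_integ k)) mulrC.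
Qed.

Lemma bernstein_scaled_bound (k : nat) : (2 <= k)%N ->
  `|Ex (fun w => (Z w / eps) ^+ k)| <= k`!%:R / 2 * Ex (fun w => (Z w / eps) ^+ 2).
Proof.
rewrite leq_eqVlt => /orP[/eqP<-|k3].
  rewrite ger0_norm; last by apply: Rint_ge0 => w; exact: sqr_ge0.
  by rewrite (_ : 2`!%:R = 2%:R)// mulfV// mul1r.
rewrite !bernstein_scaled_moment normrM normfV (ger0_norm (exprn_ge0 k (ltW eps0))).
have := bZ k3; rewrite expectation_sqr expectation.unlock -(EFin_Rint (bernstein_integ k)).
rewrite -EFinM abse_EFin lee_fin => h.
rewrite ler_pdivrMr ?exprn_gt0//; apply: (le_trans h).
have -> : eps ^+ k = eps ^+ (k - 2) * eps ^+ 2 by rewrite -exprD subnK// ltnW.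
rewrite le_eqVlt; apply/orP; left; apply/eqP; field.
by rewrite gt_eqF.
Qed.

Lemma bernstein_scaled_mean : 'E_P[Z] = 0%E -> Ex (fun w => Z w / eps) = 0.
Proof.
have i1 : integ Z by have := bernstein_integ 1; under eq_fun do rewrite expr1.
rewrite expectation.unlock -(EFin_Rint i1) => -[EZ0].
by rewrite (RintZr _ i1) EZ0 mul0r.
Qed.

End bernstein_condition_moments.

Section finite_family.
Context {d} {T : measurableType d} {R : realType} (P : probability T R).
Local Notation Ex f := (Rintegral P setT f).
Local Notation integ f := (P.-integrable setT (EFin \o f)).

Lemma inf_mgf_scale (Y : T -> R) (a eps : R) : 0 < eps ->
  inf_mgf P (fun w => Y w / eps) (a / eps) = inf_mgf P Y a.
Proof.
move=> e0; congr ereal_inf; apply/seteqP; split => _ [l l0 <-].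
  exists (l / eps); first by rewrite /= divr_ge0// ltW.
  by congr expectation; apply/funext => w; congr expR; ring.
exists (l * eps); first by rewrite /= mulr_ge0// ltW.
by congr expectation; apply/funext => w; congr expR; field; rewrite gt_eqF.
Qed.

Lemma finite_family_large_deviation (I : finType) (xi : I -> {RV P >-> R}) (eps : R) :
  mutually_independent P (fun i => (xi i : T -> R)) ->
  (forall i, 'E_P[xi i] = 0%E) ->
  (forall i, P.-integrable setT (fun w => ((xi i w) ^+ 2)%:E)) ->
  0 < eps ->
  (forall i, bernstein_condition P (xi i) eps) ->
  let sigma2 := \sum_i fine 'E_P[fun w => (xi i w) ^+ 2] in
  0 < sigma2 ->
  let sigma := Num.sqrt sigma2 in
  let S := fun w => \sum_i xi i w in
  forall x : R, 0 <= x -> x < 1 / 12 * (sigma / eps) ->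
    (exists theta : R, `|theta| <= 1 /\
       P [set w | x * sigma < S w] =
       (inf_mgf P S (x * sigma) *
         (Mills x + (2799%:R / 100) * theta * Rfun (4 * x * eps / sigma)
                     * (eps / sigma))%:E)%E)
    /\ (inf_mgf P S (x * sigma) <= (Bfun x (eps / sigma))%:E)%E.
Proof.
move=> ind E0 i2 e0 bc sigma2 s20 sigma S x x0 xs.
have s0 : 0 < sigma by rewrite sqrtr_gt0.
(* In units of eps Bernstein's condition holds with constant 1, the variances sum to 1 / r^2, and
   the level x sigma becomes x / r. *)
pose X i w := xi i w / eps.
pose r := eps / sigma; have r0 : 0 < r by rewrite divr_gt0.
have mX i : measurable_fun setT (X i).
  by apply: measurable_funM => //; exact: measurable_funPT.
have indX : mutually_independent P X.
  by apply: (mutually_independent_comp ind (phi := fun _ z => z / eps)) => _; exact: measurable_funM.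
have iX i k : integ (fun w => X i w ^+ k) by exact: bernstein_scaled_integ.
have EX0 i : Ex (X i) = 0 by exact: bernstein_scaled_mean.
have mom i k : (2 <= k)%N -> `|Ex (fun w => X i w ^+ k)| <= k`!%:R / 2 * Ex (fun w => X i w ^+ 2).
  exact: bernstein_scaled_bound.
have rV : r ^+ 2 * \sum_i Ex (fun w => X i w ^+ 2) = 1.
  have -> : \sum_i Ex (fun w => X i w ^+ 2) = sigma2 / eps ^+ 2.
    rewrite mulr_suml; apply: eq_bigr => i _.
    by rewrite (bernstein_scaled_moment (i2 i) (bc i)) expectation_sqr.
  rewrite -(sqr_sqrtr (ltW s20)) -/sigma /r; field.
  by rewrite !gt_eqF.
have xr : x * r < 1 / 12.
  move: xs; rewrite -ltr_pdivrMr ?divr_gt0// invf_div.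
  by rewrite mulrA.
have SE w : rvsum X w = S w / eps by rewrite /rvsum /X -mulr_suml.
have aE : x / r = x * sigma / eps by rewrite /r; field; rewrite !gt_eqF.
have iE : inf_mgf P (rvsum X) (x / r) = inf_mgf P S (x * sigma).
  have -> : rvsum X = fun w => S w / eps by apply/funext.
  rewrite aE; exact: inf_mgf_scale.
split; last by rewrite -iE; exact: inf_mgf_le_Bfun.
have [theta [th]] := rvsum_saddlepoint_bound mX indX iX EX0 mom r0 rV x0 xr.
rewrite iE => h; exists theta; split=> //.
have -> : [set w | x * sigma < S w] = [set w | x / r < rvsum X w].
  by apply/seteqP; split => w /=; rewrite SE aE ltr_pM2r ?invr_gt0.
by rewrite h /r !mulrA.
Qed.

End finite_family.

(** * The i.i.d. case *)

Section iid.
Context {d} {T : measurableType d} {R : realType} (P : probability T R).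

Lemma mutually_independent_ord (X : nat -> T -> R) n :
  mutually_independent P X -> mutually_independent P (fun i : 'I_n => X i).
Proof.
move=> ind s B us mB.
(* Indices outside 'I_n receive the sure event. *)
pose B' k := if (insub k : option 'I_n) is Some i then B i else setT.
have B'E (i : 'I_n) : B' i = B i by rewrite /B' valK.
have mB' k : measurable (B' k) by rewrite /B'; case: (insub k).
have := ind (map val s) B'; rewrite (map_inj_uniq val_inj).
move=> /(_ us mB'); rewrite !big_map.
by under eq_bigr do rewrite B'E; under [RHS]eq_bigr do rewrite B'E.
Qed.

Lemma identically_distributed_sqr (X : nat -> {RV P >-> R}) i j :
  identically_distributed P (fun i => (X i : T -> R)) ->
  'E_P[fun w => X i w ^+ 2] = 'E_P[fun w => X j w ^+ 2].
Proof.
move=> idX; rewrite expectation.unlock.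
have m2 : measurable_fun setT (fun z : R => (z ^+ 2)%:E).
  by apply/measurable_EFinP; exact: measurable_funX.
have h k : (\int[P]_w (X k w ^+ 2)%:E = \int[pushforward P (X k)]_z (z ^+ 2)%:E)%E.
  rewrite ge0_integral_pushforward// => z _; by rewrite lee_fin sqr_ge0.
rewrite !h; apply: eq_measure_integral => A mA _.
by rewrite /pushforward; exact: idX.
Qed.

(** Away from the pole at 1/3 crude bounds suffice: the numerator is at most 2 and each of the two
    factors of the denominator is at least 1/4. *)
Lemma Rfun_le (c : R) : 0 <= c <= 1 / 6 -> 0 <= Rfun c <= 32.
Proof.
move=> /andP[c0 c1]; rewrite /Rfun; have -> : c < 1 / 3 by lra.
have a0 : 0 < 1 - 3 * c by lra.
have pw : (1 - 3 * c) ^+ 2 <= (1 - 3 * c) `^ (3 / 2).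
  by rewrite -powR_mulrn ?(ltW a0)// ger_powR ?a0//; lra.
have pw4 : 1 / 4 <= (1 - 3 * c) `^ (3 / 2) by apply: le_trans pw; nra.
have b7 : 1 / 4 <= (1 - c) ^+ 7.
  apply: (@le_trans _ _ ((5 / 6) ^+ 7)); first by lra.
  by apply: lerXn2r; rewrite ?nnegrE; lra.
have n0 : 0 <= 1 - c + 6 * c ^+ 2 by nra.
have n3 : (1 - c + 6 * c ^+ 2) ^+ 3 <= 2.
  apply: (@le_trans _ _ ((7 / 6) ^+ 3)); last by lra.
  by apply: lerXn2r; rewrite ?nnegrE//; nra.
have d0 : 1 / 16 <= (1 - 3 * c) `^ (3 / 2) * (1 - c) ^+ 7.
  have -> : 1 / 16 = 1 / 4 * (1 / 4) :> R by field.
  by apply: ler_pM => //; lra.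
apply/andP; split; first by apply: divr_ge0; [exact: exprn_ge0|lra].
rewrite ler_pdivrMr; last by lra.
by apply: (le_trans n3); lra.
Qed.

Lemma iid_large_deviation (xi : nat -> {RV P >-> R}) (eps : R) :
  mutually_independent P (fun i => (xi i : T -> R)) ->
  identically_distributed P (fun i => (xi i : T -> R)) ->
  (forall i, 'E_P[xi i] = 0%E) ->
  (forall i, P.-integrable setT (fun w => ((xi i w) ^+ 2)%:E)) ->
  0 < eps ->
  (forall i, bernstein_condition P (xi i) eps) ->
  0 < fine 'E_P[fun w => (xi 0%N w) ^+ 2] ->
  let sigma := fun n : nat =>
    Num.sqrt (\sum_(i < n) fine 'E_P[fun w => (xi i w) ^+ 2]) in
  let S := fun (n : nat) w => \sum_(i < n) xi i w in
  forall x : nat -> R, (forall n, 0 <= x n) ->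
    (fun n : nat => x n / Num.sqrt n%:R) @ \oo --> 0 ->
    exists C : R, \forall n \near \oo,
      (`| P [set w | (x n * sigma n < S n w)%R] -
          (Mills (x n))%:E * inf_mgf P (S n) (x n * sigma n) |
       <= (C * (Bfun (x n) (eps / sigma n) / Num.sqrt n%:R))%R%:E)%E.
Proof.
move=> ind idd E0 i2 e0 bc v0 sigma S x x0 xo.
set v := fine _ in v0; pose s1 := Num.sqrt v.
have s10 : 0 < s1 by rewrite sqrtr_gt0.
have sigmaE n : sigma n = Num.sqrt n%:R * s1.
  rewrite /sigma -sqrtrM//; congr Num.sqrt.
  under eq_bigr => i _ do rewrite (identically_distributed_sqr i 0 idd) -/v.
  by rewrite sumr_const card_ord mulr_natl.
(* 28 rounds up 27.99, 32 bounds R on [0, 1/6], and eps / sigma n is eps / s1 divided by sqrt n. *)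
exists (28 * 32 * (eps / s1)).
(* Since x n = o(sqrt n), eventually x n eps / sigma n < 1/24, which keeps the argument of R below
   1/6. *)
have c0 : 0 < s1 / eps / 24 by rewrite divr_gt0// divr_gt0.
near=> n.
have n0 : 0 < Num.sqrt n%:R :> R.
  by rewrite sqrtr_gt0 ltr0n; near: n; exists 1.
have xn : x n / Num.sqrt n%:R < s1 / eps / 24.
  apply: le_lt_trans (ler_norm _) _; rewrite -normrN -sub0r.
  by near: n; exact: cvgr_dist_lt xo _ c0.
have sn0 : 0 < sigma n by rewrite sigmaE mulr_gt0.
have s2n0 : 0 < \sum_(i < n) fine 'E_P[fun w => (xi i w) ^+ 2] by rewrite -sqrtr_gt0.
have xs : x n * eps / sigma n < 1 / 24.
  rewrite sigmaE; move: xn; rewrite ltr_pdivrMr// => xn.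
  rewrite ltr_pdivrMr ?mulr_gt0// -(ltr_pM2r e0) in xn *.
  apply: (lt_le_trans xn); rewrite le_eqVlt; apply/orP; left; apply/eqP.
  by field; rewrite gt_eqF.
have xs12 : x n < 1 / 12 * (sigma n / eps).
  move: xs; rewrite ltr_pdivrMr// -ltr_pdivlMr// => h; apply: (lt_trans h).
  have -> : 1 / 24 * sigma n / eps = 1 / 24 * (sigma n / eps) by rewrite mulrA.
  by rewrite ltr_pM2r ?divr_gt0//; lra.
have [[theta [th hP]] hB] := finite_family_large_deviation
  (mutually_independent_ord ind) (fun i : 'I_n => E0 i) (fun i => i2 i) e0 (fun i => bc i) s2n0 (x0 n) xs12.
rewrite -/(sigma n) -/(S n) in hP hB.
set J := inf_mgf _ _ _ in hP hB *.
have J0 : (0 <= J)%E.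
  apply: le_ereal_inf_tmp => _ [l _ <-]; rewrite expectation.unlock.
  by apply: integral_ge0 => w _; rewrite lee_fin expR_ge0.
have Jfin : J \is a fin_num by rewrite ge0_fin_numE// (le_lt_trans hB)// ltry.
move: J0 hB hP; rewrite -(fineK Jfin); move: (fine J) => j j0 hB hP.
rewrite hP -!EFinM -EFinB abse_EFin lee_fin.
rewrite !lee_fin in j0 hB.
set rho := Rfun _.
have /andP[rho0 rho32] : 0 <= rho <= 32.
  apply: Rfun_le; apply/andP; split.
    by rewrite divr_ge0 ?mulr_ge0 ?(ltW e0) ?(ltW sn0).
  by rewrite -!mulrA [x n * _]mulrA; lra.
have -> : j * (Mills (x n) + 2799%:R / 100 * theta * rho * (eps / sigma n)) - Mills (x n) * j =
  j * (theta * rho * (2799%:R / 100 * (eps / sigma n))) by ring.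
have es0 : 0 < eps / sigma n by rewrite divr_gt0.
have k0 : 0 <= 2799%:R / 100 * (eps / sigma n) by apply: mulr_ge0; [lra|exact: ltW].
rewrite (normrM j) (normrM (theta * rho)) (normrM theta).
rewrite (ger0_norm j0) (ger0_norm rho0) (ger0_norm k0).
have -> : 28 * 32 * (eps / s1) * (Bfun (x n) (eps / sigma n) / Num.sqrt n%:R) =
    Bfun (x n) (eps / sigma n) * (1 * 32 * (28 * (eps / sigma n))).
  by rewrite sigmaE; field; rewrite !gt_eqF.
have k28 : 2799%:R / 100 <= 28 :> R by lra.
move: (2799%:R / 100) k0 k28 => k k0 k28.
apply: ler_pM; [exact: j0| |exact: hB|].
  by rewrite mulr_ge0// mulr_ge0.
apply: ler_pM; [exact: mulr_ge0|exact: k0|exact: ler_pM|].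
by rewrite ler_wpM2r// ltW.
Unshelve. all: end_near. Qed.
End iid.

Theorem theorem4 (R : realType) (d : measure_display) (T : measurableType d)
  (P : probability T R) :
  (* Part 1 and 2: finite family xi_1, ..., xi_n *)
  (forall (n : nat) (xi : 'I_n -> {RV P >-> R}) (eps : R),
    mutually_independent P (fun i => (xi i : T -> R)) ->
    (forall i, 'E_P[xi i] = 0%E) ->
    (forall i, P.-integrable setT (fun w => ((xi i w) ^+ 2)%:E)) ->
    0 < eps ->
    (forall i, bernstein_condition P (xi i) eps) ->
    let sigma2 := \sum_(i < n) fine 'E_P[fun w => (xi i w) ^+ 2] in
    0 < sigma2 ->
    let sigma := Num.sqrt sigma2 in
    let S := fun w => \sum_(i < n) xi i w in
    forall x : R, 0 <= x -> x < 1 / 12 * (sigma / eps) ->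
      (exists theta : R, `|theta| <= 1 /\
         P [set w | x * sigma < S w] =
         (inf_mgf P S (x * sigma) *
           (Mills x + (2799%:R / 100) * theta * Rfun (4 * x * eps / sigma)
                       * (eps / sigma))%:E)%E)
      /\ (inf_mgf P S (x * sigma) <= (Bfun x (eps / sigma))%:E)%E)
  /\
  (* Part 3: i.i.d. case, distribution and eps fixed, n -> oo *)
  (forall (xi : nat -> {RV P >-> R}) (eps : R),
    mutually_independent P (fun i => (xi i : T -> R)) ->
    identically_distributed P (fun i => (xi i : T -> R)) ->
    (forall i, 'E_P[xi i] = 0%E) ->
    (forall i, P.-integrable setT (fun w => ((xi i w) ^+ 2)%:E)) ->
    0 < eps ->
    (forall i, bernstein_condition P (xi i) eps) ->
    0 < fine 'E_P[fun w => (xi 0%N w) ^+ 2] ->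
    let sigma := fun n : nat =>
      Num.sqrt (\sum_(i < n) fine 'E_P[fun w => (xi i w) ^+ 2]) in
    let S := fun (n : nat) w => \sum_(i < n) xi i w in
    forall x : nat -> R, (forall n, 0 <= x n) ->
      (fun n : nat => x n / Num.sqrt n%:R) @ \oo --> 0 ->
      exists C : R, \forall n \near \oo,
        (`| P [set w | (x n * sigma n < S n w)%R] -
            (Mills (x n))%:E * inf_mgf P (S n) (x n * sigma n) |
         <= (C * (Bfun (x n) (eps / sigma n) / Num.sqrt n%:R))%R%:E)%E).
Proof.
split=> [n xi eps|xi eps]; first exact: finite_family_large_deviation.
exact: iid_large_deviation.
Qed.
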